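(* The functor $\mathrm{GQ}_{\infty}(-):\mathbf{PAlg}_1\to \mathbf{VQuiv}_{\infty}$ is an equivalence of categories.
   Context: Throughout, $k$ is a perfect field with the discrete topology. Algebras. A pseudocompact algebra is an associative, unital, Hausdorff topological $k$-algebra $A$ having a basis of neighbourhoods of $0$ consisting of open ideals $I$ of finite codimension that intersect in $0$ and such that $A\cong\varprojlim_I A/I$. Its Jacobson radical $J(A)$ is the intersection of its maximal open left ideals; $J^0(A)=A$, $J^1(A)=J(A)$, $J^n(A)=J(A)J^{n-1}(A)$ for $n>1$. $A$ is pointed if $A/J(A)$ is isomorphic to a product of copies of $k$. The category $\mathbf{PAlg}$ has as objects the pointed pseudocompact algebras $A$ with $A/J^2(A)$ finite dimensional, and as morphisms the continuous unital algebra homomorphisms $A\to B$ whose induced map $A/J(A)\to B/J(B)$ is surjective (any unital homomorphism between such algebras sends $J(A)$ into $J(B)$). For $\alpha,\beta:A\to B$ in $\mathbf{PAlg}$, write $\alpha\sim_1\beta$ if $(\alpha-\beta)(A)\subseteq J(B)$ and $(\alpha-\beta)(J(A))\subseteq J^2(B)$. This is a congruence; $\mathbf{PAlg}_1=\mathbf{PAlg}/\sim_1$. Vquivers. A finite Vquiver $VQ=(VQ_0^*,VQ_{e,f})$ consists of a finite set $VQ_0^*=\{*\}\cup VQ_0$ of vertices ($*\notin VQ_0$) and, for each $e,f\in VQ_0^*$, a finite dimensional $k$-vector space $VQ_{e,f}$, with $VQ_{*,e}=VQ_{e,*}=0$ for every vertex $e$. A map of Vquivers $\rho:VR\to VQ$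 consists of a map $\rho_0:VR_0^*\to VQ_0^*$ with $\rho_0( * )=*$ that restricts to a bijection from the elements of $VR_0$ not mapping to $*$ onto $VQ_0$, together with a linear map $\rho_{e,f}:VR_{e,f}\to VQ_{\rho_0(e),\rho_0(f)}$ for each $e,f\in VR_0^*$. Completed path algebra. For a finite Vquiver $VQ$ let $\Sigma_{VQ}=\prod_{e\in VQ_0}k$ and let $VQ_1=\bigoplus_{e,f\in VQ_0}VQ_{e,f}$ be the $\Sigma_{VQ}$-bimodule with $x\cdot(\lambda_g)=x\lambda_e$, $(\lambda_g)\cdot x=\lambda_f x$ for $x\in VQ_{e,f}$. Put $k[[VQ]]=\prod_{n\ge 0}VQ_1^{\otimes n}$ (tensor powers over $\Sigma_{VQ}$, with $VQ_1^{\otimes 0}=\Sigma_{VQ}$; product topology; multiplication induced by concatenation of tensors), an object of $\mathbf{PAlg}$. A map $\rho:VR\to VQ$ induces the unique continuous unital algebra homomorphism $k[[\rho]]:k[[VR]]\to k[[VQ]]$ that sends the basis idempotent $e\in VR_0$ of $\Sigma_{VR}$ to the basis idempotent $\rho_0(e)$ if $\rho_0(e)\ne *$ and to $0$ otherwise, and equals $\rho_{e,f}$ on $VR_{e,f}$. Vquivers with ideals. A relation ideal of $k[[VQ]]$ is a closed ideal $I\subseteq J^2(k[[VQ]])$. $[\mathrm{id}_{VQ}]_1$ denotes the set (a normal subgroup of $\mathrm{Aut}(k[[VQ]])$) of all morphisms $\delta:k[[VQ]]\to k[[VQ]]$ in $\mathbf{PAlg}$ with $\delta\sim_1\mathrm{id}$.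 For a relation ideal $I$ put $[I]=\{\delta(I)\mid\delta\in[\mathrm{id}_{VQ}]_1\}$. The category $\mathbf{VQuiv}_\infty$ has objects the pairs $(VQ,[I])$ with $VQ$ a finite Vquiver and $I$ a relation ideal of $k[[VQ]]$; a morphism $\rho:(VQ,[I])\to(VR,[K])$ is a map of Vquivers $\rho:VQ\to VR$ such that $k[[\rho]]$ takes $I'$ into $K'$ for some $I'\in[I]$ and some $K'\in[K]$. Gabriel quiver. For $A\in\mathbf{PAlg}$ let $\mathcal{G}(A)$ be the group of automorphisms of $A$ of the form $x\mapsto (1+w)x(1+w)^{-1}$ with $w\in J(A)$, and write ${}^{\mathcal{G}}a$ for the $\mathcal{G}(A)$-orbit of $a$. Fix a complete set $E$ of (nonzero) primitive orthogonal idempotents of $A$. The Vquiver $\widetilde{\mathrm{GQ}}(A)$ has vertex set $\{*\}\cup\{{}^{\mathcal{G}}e\mid e\in E\}$ and spaces $\widetilde{\mathrm{GQ}}(A)_{{}^{\mathcal{G}}e,{}^{\mathcal{G}}f}=f\frac{J(A)}{J^2(A)}e$; it does not depend on $E$. For the class $[\alpha]$ in $\mathbf{PAlg}_1$ of $\alpha:A\to B$, $\widetilde{\mathrm{GQ}}([\alpha])$ sends ${}^{\mathcal{G}(A)}e$ to ${}^{\mathcal{G}(B)}\alpha(e)$ if $\alpha(e)\neq0$ and to $*$ otherwise, and sends $f(j+J^2(A))e$ to $\alpha(f)(\alpha(j)+J^2(B))\alpha(e)$; this is well-defined. Counit. Given $A\in\mathbf{PAlg}$, choose an algebra splitting $s$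 of $A\to A/J(A)$, put $\Sigma=s(A/J(A))$, and choose a $\Sigma$-bimodule splitting $t$ of $J(A)\to J(A)/J^2(A)$. The $\mathcal{G}(A)$-orbit of each primitive idempotent $e$ meets $\Sigma$ in exactly one element $e_\Sigma$. The continuous unital homomorphism $k[[\widetilde{\mathrm{GQ}}(A)]]\to A$ sending the idempotent of the vertex ${}^{\mathcal{G}}e$ to $e_\Sigma$ and $x\in f\frac{J(A)}{J^2(A)}e$ to $t(x)$ has a class $\varepsilon_A$ in $\mathbf{PAlg}_1$ independent of $s,t$; $\varepsilon_A$ is the counit of the adjunction between the completed path algebra functor $\mathbf{VQuiv}\to\mathbf{PAlg}_1$ (left adjoint; $\mathbf{VQuiv}$ being the category of finite Vquivers) and $\widetilde{\mathrm{GQ}}$. The functor $\mathrm{GQ}_\infty$. On objects $\mathrm{GQ}_\infty(A)=(\widetilde{\mathrm{GQ}}(A),[K_A])$, where $K_A$ is the kernel of any representative in $\mathbf{PAlg}$ of $\varepsilon_A$ (the class $[K_A]$ does not depend on the representative); on morphisms $\mathrm{GQ}_\infty([\alpha])=\widetilde{\mathrm{GQ}}([\alpha])$.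
   Formalization: As stated, the morphisms of VQuiv_∞ are not closed under composition (e.g. ideals (x²+y⁵), (x²+y⁵), (z⁴+y⁵) with one vertex), so it is not a category; here its morphisms are the finite composites of maps ρ satisfying the stated condition. *)

(* Defs.v *)
From HB Require Import structures.
From mathcomp Require Import all_boot all_order all_algebra separable.
From mathcomp Require Import all_classical topology.

Set Implicit Arguments.
Unset Strict Implicit.
Unset Printing Implicit Defensive.

Import GRing.Theory.

Local Open Scope classical_set_scope.
Local Open Scope ring_scope.
Local Open Scope quotient_scope.

Definition perfect_field (k : fieldType) : Prop :=
  forall p : {poly k}, irreducible_poly p -> separable_poly p.

Section QuotientModule.
Variables (R : pzRingType) (V : lmodType R).

Record submod := Submod {
  submod_set :> V -> Prop;
  submod0 : submod_set 0;
  submodP : forall (a : R) x y,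
    submod_set x -> submod_set y -> submod_set (a *: x + y) }.

Variable S : submod.

Lemma submodD x y : S x -> S y -> S (x + y).
Proof. by move=> Sx Sy; rewrite -[x]scale1r; apply: submodP. Qed.

Lemma submodZ a x : S x -> S (a *: x).
Proof. by move=> Sx; rewrite -[_ *: _]addr0; apply: submodP => //; apply: submod0. Qed.

Lemma submodN x : S x -> S (- x).
Proof. by rewrite -scaleN1r; apply: submodZ. Qed.

Definition lquot_rel (x y : V) : bool := `[< S (x - y) >].

Lemma lquot_rel_equiv : equiv_class_of lquot_rel.
Proof.
split=> [x|x y|y x z].
- by apply/asboolP; rewrite subrr; apply: submod0.
- by apply/asboolP/asboolP => /submodN; rewrite opprB.
- by move=> /asboolP xy /asboolP yz; apply/asboolP;
    rewrite -(subrKA y); apply: submodD.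
Qed.

Canonical lquot_equiv := EquivRelPack lquot_rel_equiv.

Definition lquot := {eq_quot lquot_rel}.
HB.instance Definition _ := Choice.on lquot.
HB.instance Definition _ := EqQuotient.on lquot.

Definition lquot_pi (x : V) : lquot := \pi_lquot x.

Lemma lquot_piP x y : lquot_pi x = lquot_pi y <-> S (x - y).
Proof. by split=> [/eqmodP/asboolP//|h]; apply/eqmodP/asboolP. Qed.

Lemma lquot_reprK X : lquot_pi (repr X) = X.
Proof. exact: reprK. Qed.

Lemma lquot_repr x : S (repr (lquot_pi x) - x).
Proof. by apply/lquot_piP; rewrite lquot_reprK. Qed.

Definition lquot_add (X Y : lquot) := lquot_pi (repr X + repr Y).
Definition lquot_opp (X : lquot) := lquot_pi (- repr X).
Definition lquot_scale (a : R) (X : lquot) := lquot_pi (a *: repr X).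

Lemma lquot_addE x y :
  lquot_add (lquot_pi x) (lquot_pi y) = lquot_pi (x + y).
Proof.
by apply/lquot_piP; rewrite opprD addrACA; apply: submodD; apply: lquot_repr.
Qed.

Lemma lquot_oppE x : lquot_opp (lquot_pi x) = lquot_pi (- x).
Proof.
by apply/lquot_piP; rewrite -opprD; apply/submodN/lquot_repr.
Qed.

Lemma lquot_scaleE a x : lquot_scale a (lquot_pi x) = lquot_pi (a *: x).
Proof.
by apply/lquot_piP; rewrite -scalerBr; apply/submodZ/lquot_repr.
Qed.

Lemma lquot_ind (P : lquot -> Prop) : (forall x, P (lquot_pi x)) -> forall X, P X.
Proof. by move=> h X; rewrite -[X]lquot_reprK. Qed.

Lemma lquot_addA : associative lquot_add.
Proof. by elim/lquot_ind=> x; elim/lquot_ind=> y; elim/lquot_ind=> z; rewrite !lquot_addE addrA. Qed.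
Lemma lquot_addC : commutative lquot_add.
Proof. by elim/lquot_ind=> x; elim/lquot_ind=> y; rewrite !lquot_addE addrC. Qed.
Lemma lquot_add0 : left_id (lquot_pi 0) lquot_add.
Proof. by elim/lquot_ind=> x; rewrite !lquot_addE add0r. Qed.
Lemma lquot_addN : left_inverse (lquot_pi 0) lquot_opp lquot_add.
Proof. by elim/lquot_ind=> x; rewrite lquot_oppE lquot_addE addNr. Qed.

HB.instance Definition _ := GRing.isZmodule.Build lquot
  lquot_addA lquot_addC lquot_add0 lquot_addN.

Lemma lquot_piD : {morph lquot_pi : x y / x + y}.
Proof. by move=> x y; rewrite -lquot_addE. Qed.

Lemma lquot_scaleA a b X : lquot_scale a (lquot_scale b X) = lquot_scale (a * b) X.
Proof. by elim/lquot_ind: X => x; rewrite !lquot_scaleE scalerA. Qed.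
Lemma lquot_scale1 : left_id 1 lquot_scale.
Proof. by elim/lquot_ind=> x; rewrite !lquot_scaleE scale1r. Qed.
Lemma lquot_scaleDr : right_distributive lquot_scale +%R.
Proof.
move=> a; elim/lquot_ind=> x; elim/lquot_ind=> y.
by rewrite -lquot_piD !lquot_scaleE -lquot_piD scalerDr.
Qed.
Lemma lquot_scaleDl X : {morph lquot_scale^~ X : a b / a + b}.
Proof.
by elim/lquot_ind: X => x a b; rewrite !lquot_scaleE -lquot_piD scalerDl.
Qed.

HB.instance Definition _ := GRing.Zmodule_isLmodule.Build R lquot
  lquot_scaleA lquot_scale1 lquot_scaleDr lquot_scaleDl.

Lemma lquot_pi_is_linear : linear lquot_pi.
Proof. by move=> a x y; rewrite lquot_piD -lquot_scaleE. Qed.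

HB.instance Definition _ := GRing.isLinear.Build R V lquot _ lquot_pi lquot_pi_is_linear.

End QuotientModule.
Arguments lquot_pi {R V} S x.
Arguments lquot {R V} S.


(* The zero algebra must be allowed (it corresponds to the Vquiver whose only
   vertex is None), whereas algType requires 1 != 0. The scalar action is therefore
   put on top of pzRingType, and *: on a topAlgType is the instance below. *)
HB.mixin Record PzRing_isAlgebra (k : fieldType) A of GRing.PzRing A := {
  alg_scale : k -> A -> A;
  alg_scaleA : forall a b x, alg_scale a (alg_scale b x) = alg_scale (a * b) x;
  alg_scale1 : left_id 1 alg_scale;
  alg_scaleDr : right_distributive alg_scale +%R;
  alg_scaleDl : forall x, {morph alg_scale^~ x : a b / a + b};
  alg_scaleAl : forall a x y, alg_scale a (x * y) = alg_scale a x * y;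
  alg_scaleAr : forall a x y, alg_scale a (x * y) = x * alg_scale a y }.

#[short(type="topAlgType")]
HB.structure Definition TopAlg (k : fieldType) :=
  {A of GRing.PzRing A & PzRing_isAlgebra k A & Topological A}.

HB.instance Definition _ (k : fieldType) (A : topAlgType k) :=
  GRing.Zmodule_isLmodule.Build k (TopAlg.sort A)
    alg_scaleA alg_scale1 alg_scaleDr alg_scaleDl.


Lemma talg_scalerAl (k : fieldType) (A : topAlgType k) (a : k) (x y : A) :
  a *: (x * y) = (a *: x : A) * y.
Proof. exact: alg_scaleAl. Qed.

Lemma talg_scalerAr (k : fieldType) (A : topAlgType k) (a : k) (x y : A) :
  a *: (x * y) = x * (a *: y : A).
Proof. exact: alg_scaleAr. Qed.

(* The vertex set is option vq_vert, with None for the distinguished vertex *. *)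
Record vquiver (k : fieldType) := Vquiver {
  vq_vert : finType;
  vq_sp : option vq_vert -> option vq_vert -> vectType k;
  vq_sp_starl : forall e (x : vq_sp None e), x = 0;
  vq_sp_starr : forall e (x : vq_sp e None), x = 0 }.

(* vqm0_bij: the vertices of VR not sent to * are in bijection with vq_vert VQ. *)
Record vqmap (k : fieldType) (VR VQ : vquiver k) := Vqmap {
  vqm0 : option (vq_vert VR) -> option (vq_vert VQ);
  vqm1 : forall e f, vq_sp e f -> vq_sp (vqm0 e) (vqm0 f);
  vqm0_star : vqm0 None = None;
  vqm0_bij : forall w, exists! v, vqm0 (Some v) = Some w;
  vqm1_linear : forall e f, linear (@vqm1 e f) }.

Definition vqmap_id (k : fieldType) (VQ : vquiver k) : vqmap VQ VQ.
Proof.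
refine (@Vqmap k VQ VQ id (fun e f x => x) erefl _ (fun e f a x y => erefl)).
by move=> w; exists w; split=> // v [].
Defined.

Definition vqmap_comp (k : fieldType) (VP VQ VR : vquiver k)
  (s : vqmap VQ VR) (r : vqmap VP VQ) : vqmap VP VR.
Proof.
refine (@Vqmap k VP VR (vqm0 s \o vqm0 r)
  (fun e f x => vqm1 s (vqm1 r x)) _ _ _).
- by rewrite /= !vqm0_star.
- move=> w; have [v [sv uv]] := vqm0_bij s w; have [u [ru uu]] := vqm0_bij r v.
  exists u; split=> [|u' /=]; first by rewrite /= ru.
  case E: (vqm0 r (Some u')) => [v'|]; last by rewrite vqm0_star.
  by move/uv => vv'; apply: uu; rewrite E -vv'.
- by move=> e f a x y; rewrite !vqm1_linear.
Defined.

Lemma vqmap_eq (k : fieldType) (VP VQ : vquiver k) r0 r1 p1 p2 p3 q1 q2 q3 :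
  @Vqmap k VP VQ r0 r1 p1 p2 p3 = @Vqmap k VP VQ r0 r1 q1 q2 q3.
Proof. by congr Vqmap; apply: Prop_irrelevance. Qed.

Lemma vqmap_comp_id (k : fieldType) (VP VQ : vquiver k) (r : vqmap VP VQ) :
  vqmap_comp r (vqmap_id VP) = r.
Proof. case: r => *; exact: vqmap_eq. Qed.

Lemma vqmap_id_comp (k : fieldType) (VP VQ : vquiver k) (r : vqmap VP VQ) :
  vqmap_comp (vqmap_id VQ) r = r.
Proof. case: r => *; exact: vqmap_eq. Qed.

Lemma vqmap_compA (k : fieldType) (VP VQ VR VS : vquiver k)
  (t : vqmap VR VS) (s : vqmap VQ VR) (r : vqmap VP VQ) :
  vqmap_comp t (vqmap_comp s r) = vqmap_comp (vqmap_comp t s) r.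
Proof. exact: vqmap_eq. Qed.

Section PathAlgebra.
Variables (k : fieldType) (Q : vquiver k).

Local Notation V := (vq_vert Q).

Definition vqSigma : pzRingType := {ffun V -> k}.

Lemma vqSigmaC : commutative (@GRing.mul vqSigma).
Proof. exact: (@ffun_mulC V k). Qed.

(* VQ_1, the direct sum of the spaces VQ_{e,f}; p = (e, f). *)
Definition vqArrows : Type := forall p : V * V, vq_sp (Some p.1) (Some p.2).

HB.instance Definition _ := Choice.copy vqArrows
  (forall p : V * V, vq_sp (Some p.1) (Some p.2)).

Implicit Types (x y z : vqArrows) (s t : vqSigma).

Definition vqa_add x y : vqArrows := fun p => x p + y p.
Definition vqa_zero : vqArrows := fun p => 0.
Definition vqa_opp x : vqArrows := fun p => - x p.
Definition vqa_lact s x : vqArrows := fun p => (s : {ffun V -> k}) p.2 *: x p.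
Definition vqa_ract x s : vqArrows := fun p => (s : {ffun V -> k}) p.1 *: x p.

Lemma vqa_addA : associative vqa_add.
Proof. by move=> x y z; apply: functional_extensionality_dep => p; apply: addrA. Qed.
Lemma vqa_addC : commutative vqa_add.
Proof. by move=> x y; apply: functional_extensionality_dep => p; apply: addrC. Qed.
Lemma vqa_add0 : left_id vqa_zero vqa_add.
Proof. by move=> x; apply: functional_extensionality_dep => p; apply: add0r. Qed.
Lemma vqa_addN : left_inverse vqa_zero vqa_opp vqa_add.
Proof. by move=> x; apply: functional_extensionality_dep => p; apply: addNr. Qed.
HB.instance Definition _ := GRing.isZmodule.Build vqArrows
  vqa_addA vqa_addC vqa_add0 vqa_addN.

Lemma vqa_lactA s t x : vqa_lact s (vqa_lact t x) = vqa_lact (s * t) x.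
Proof.
by apply: functional_extensionality_dep => p; rewrite /vqa_lact ffunE scalerA.
Qed.
Lemma vqa_lact1 : left_id 1 vqa_lact.
Proof.
by move=> x; apply: functional_extensionality_dep => p; rewrite /vqa_lact ffunE scale1r.
Qed.
Lemma vqa_lactDr : right_distributive vqa_lact +%R.
Proof.
by move=> s x y; apply: functional_extensionality_dep => p; apply: scalerDr.
Qed.
Lemma vqa_lactDl x : {morph vqa_lact^~ x : s t / s + t}.
Proof.
move=> s t; apply: functional_extensionality_dep => p.
by rewrite /vqa_lact ffunE scalerDl.
Qed.
HB.instance Definition _ := GRing.Zmodule_isLmodule.Build vqSigma vqArrows
  vqa_lactA vqa_lact1 vqa_lactDr vqa_lactDl.

Lemma vqa_ractC s x t : vqa_ract (s *: x) t = s *: vqa_ract x t.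
Proof.
by apply: functional_extensionality_dep => p; rewrite /vqa_ract scalerA mulrC -scalerA.
Qed.

Section Tensor.
Variable M : lmodType vqSigma.

(* VQ_1 (x)_Sigma M: formal sums of pure tensors (x, m), modulo the congruence
   generated by biadditivity and Sigma-balancedness. *)
Inductive tens_eq : seq (vqArrows * M) -> seq (vqArrows * M) -> Prop :=
| tens_refl u : tens_eq u u
| tens_sym u v : tens_eq u v -> tens_eq v u
| tens_trans u v w : tens_eq u v -> tens_eq v w -> tens_eq u w
| tens_cat u u' v v' : tens_eq u u' -> tens_eq v v' -> tens_eq (u ++ v) (u' ++ v')
| tens_catC u v : tens_eq (u ++ v) (v ++ u)
| tens_0l m : tens_eq [:: (0, m)] [::]
| tens_Dl x y m : tens_eq [:: (x + y, m)] [:: (x, m); (y, m)]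
| tens_Dr x m n : tens_eq [:: (x, m + n)] [:: (x, m); (x, n)]
| tens_bal x s m : tens_eq [:: (vqa_ract x s, m)] [:: (x, s *: m)].

Definition tens_rel u v : bool := `[< tens_eq u v >].

Lemma tens_rel_equiv : equiv_class_of tens_rel.
Proof.
split=> [u|u v|v u w].
- exact/asboolP/tens_refl.
- by apply/asboolP/asboolP => /tens_sym.
- by move=> /asboolP uv /asboolP vw; apply/asboolP/(tens_trans uv vw).
Qed.
Canonical tens_equiv := EquivRelPack tens_rel_equiv.

Definition tens := {eq_quot tens_rel}.
HB.instance Definition _ := Choice.on tens.
HB.instance Definition _ := EqQuotient.on tens.

Definition tens_pi u : tens := \pi_tens u.
Definition ptens x (m : M) : tens := tens_pi [:: (x, m)].

Lemma tens_piP u v : tens_pi u = tens_pi v <-> tens_eq u v.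
Proof. by split=> [/eqmodP/asboolP//|h]; apply/eqmodP/asboolP. Qed.
Lemma tens_reprK X : tens_pi (repr X) = X. Proof. exact: reprK. Qed.
Lemma tens_repr u : tens_eq (repr (tens_pi u)) u.
Proof. by apply/tens_piP; rewrite tens_reprK. Qed.

Lemma tens_indpi (P : tens -> Prop) : (forall u, P (tens_pi u)) -> forall X, P X.
Proof. by move=> h X; rewrite -[X]tens_reprK. Qed.

Definition tens_add (X Y : tens) := tens_pi (repr X ++ repr Y).
Definition tens_map (N : lmodType vqSigma) (f : vqArrows -> vqArrows) (g : M -> N)
  (u : seq (vqArrows * M)) : seq (vqArrows * N) := [seq (f p.1, g p.2) | p <- u].
Definition tens_opp (X : tens) := tens_pi (tens_map -%R id (repr X)).
Definition tens_scale s (X : tens) := tens_pi (tens_map ( *:%R s) id (repr X)).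

Lemma tens_addE u v : tens_add (tens_pi u) (tens_pi v) = tens_pi (u ++ v).
Proof. by apply/tens_piP; apply: tens_cat; apply: tens_repr. Qed.

End Tensor.

Lemma tens_mapP (M N : lmodType vqSigma) f (g : M -> N) u v :
  {morph f : x y / x + y} -> (forall s x, f (vqa_ract x s) = vqa_ract (f x) s) -> linear g ->
  tens_eq u v -> tens_eq (tens_map f g u) (tens_map f g v).
Proof.
move=> fD fZ gL.
have f0 : f 0 = 0 by apply: (addrI (f 0)); rewrite -fD !addr0.
have gD m n : g (m + n) = g m + g n by rewrite -[m in LHS]scale1r gL scale1r.
have g0 : g 0 = 0 by apply: (addrI (g 0)); rewrite -gD !addr0.
have gZ s m : g (s *: m) = s *: g m by rewrite -[s *: m]addr0 gL g0 addr0.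
elim=> {u v} /=.
- by move=> u; apply: tens_refl.
- by move=> u v _ /tens_sym.
- by move=> u v w _ uv _; apply: tens_trans.
- by move=> u u' v v' _ uu' _ vv'; rewrite /tens_map !map_cat; apply: tens_cat.
- by move=> u v; rewrite /tens_map !map_cat; apply: tens_catC.
- by move=> m; rewrite f0; apply: tens_0l.
- by move=> x y m; rewrite fD; apply: tens_Dl.
- by move=> x m n; rewrite gD; apply: tens_Dr.
- by move=> x s m; rewrite fZ gZ; apply: tens_bal.
Qed.

Section TensorModule.
Variable M : lmodType vqSigma.
Local Notation tens := (tens M).
Local Notation tens_pi := (@tens_pi M).

Lemma oppr_ract s x : - vqa_ract x s = vqa_ract (- x) s.
Proof. by apply: functional_extensionality_dep => p; rewrite /vqa_ract scalerN. Qed.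

Lemma tens_oppE u : tens_opp (tens_pi u) = tens_pi (tens_map -%R id u).
Proof.
apply/tens_piP/tens_mapP/tens_repr => //; first exact: opprD.
by move=> s x; apply: oppr_ract.
Qed.

Lemma tens_scaleE s u : tens_scale s (tens_pi u) = tens_pi (tens_map ( *:%R s) id u).
Proof.
apply/tens_piP/tens_mapP/tens_repr => //; first by move=> x y; rewrite scalerDr.
by move=> t x; rewrite vqa_ractC.
Qed.

Lemma tens_addA : associative (@tens_add M).
Proof.
elim/tens_indpi=> u; elim/tens_indpi=> v; elim/tens_indpi=> w.
by rewrite !tens_addE catA.
Qed.
Lemma tens_addC : commutative (@tens_add M).
Proof.
elim/tens_indpi=> u; elim/tens_indpi=> v.
by rewrite !tens_addE; apply/tens_piP/tens_catC.
Qed.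
Lemma tens_add0 : left_id (tens_pi [::]) (@tens_add M).
Proof. by elim/tens_indpi=> u; rewrite tens_addE. Qed.
Lemma tens_addN : left_inverse (tens_pi [::]) (@tens_opp M) (@tens_add M).
Proof.
elim/tens_indpi=> u; rewrite tens_oppE tens_addE; apply/tens_piP.
elim: u => [|[x m] u IH] /=; first exact: tens_refl.
have E : tens_eq ([:: (- x, m); (x, m)] ++ (tens_map -%R id u ++ u)) [::].
  rewrite -[X in tens_eq _ X]cats0; apply: tens_cat IH.
  by apply: tens_trans (tens_sym (tens_Dl _ _ _)) _; rewrite addNr; apply: tens_0l.
apply: tens_trans E.
apply: (@tens_cat _ [:: (- x, m)] [:: (- x, m)]); first exact: tens_refl.
rewrite -[(x, m) :: u]cat1s -[X in tens_eq _ X]cat1s !catA.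
by apply: tens_cat; [apply: tens_catC | apply: tens_refl].
Qed.
HB.instance Definition _ := GRing.isZmodule.Build tens
  tens_addA tens_addC tens_add0 tens_addN.

Lemma tens_piD u v : tens_pi (u ++ v) = tens_pi u + tens_pi v.
Proof. by rewrite -tens_addE. Qed.

Lemma tens_scaleA s t (X : tens) : tens_scale s (tens_scale t X) = tens_scale (s * t) X.
Proof.
elim/tens_indpi: X => u; rewrite !tens_scaleE; congr tens_pi.
by rewrite /tens_map -map_comp; apply: eq_map => p /=; rewrite scalerA.
Qed.
Lemma tens_scale1 : left_id 1 (@tens_scale M).
Proof.
elim/tens_indpi=> u; rewrite tens_scaleE; congr tens_pi.
by rewrite /tens_map -[RHS]map_id; apply: eq_map => -[x m] /=; rewrite scale1r.
Qed.
Lemma tens_scaleDr : right_distributive (@tens_scale M) +%R.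
Proof.
move=> s; elim/tens_indpi=> u; elim/tens_indpi=> v.
by rewrite -tens_piD !tens_scaleE -tens_piD /tens_map map_cat.
Qed.
Lemma tens_scaleDl (X : tens) : {morph (@tens_scale M)^~ X : s t / s + t}.
Proof.
elim/tens_indpi: X => u s t; rewrite !tens_scaleE -tens_piD.
elim: u => [|[x m] u IH] //=.
apply: etrans (_ : tens_pi ([:: ((s + t) *: x, m)] ++ tens_map ( *:%R (s + t)) id u) = _) _ => //.
rewrite tens_piD IH scalerDl.
have -> : tens_pi [:: (s *: x + t *: x, m)] = tens_pi [:: (s *: x, m)] + tens_pi [:: (t *: x, m)].
  by rewrite -tens_piD; apply/tens_piP/tens_Dl.
rewrite [RHS](_ : _ = tens_pi (([:: (s *: x, m)] ++ tens_map ( *:%R s) id u) ++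
  ([:: (t *: x, m)] ++ tens_map ( *:%R t) id u))) // !tens_piD.
by rewrite addrACA.
Qed.
HB.instance Definition _ := GRing.Zmodule_isLmodule.Build vqSigma tens
  tens_scaleA tens_scale1 tens_scaleDr tens_scaleDl.

Lemma ptensDl x y m : ptens (x + y) m = ptens x m + ptens y m :> tens.
Proof. by rewrite -tens_piD; apply/tens_piP/tens_Dl. Qed.
Lemma ptensDr x m n : ptens x (m + n) = ptens x m + ptens x n :> tens.
Proof. by rewrite -tens_piD; apply/tens_piP/tens_Dr. Qed.
Lemma ptens_bal x s m : ptens (vqa_ract x s) m = ptens x (s *: m) :> tens.
Proof. exact/tens_piP/tens_bal. Qed.
Lemma ptensZ s x m : s *: ptens x m = ptens (s *: x) m :> tens.
Proof. exact: tens_scaleE. Qed.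
Lemma ptens0l m : ptens 0 m = 0 :> tens.
Proof. exact/tens_piP/tens_0l. Qed.
Lemma ptens0r x : ptens x 0 = 0 :> tens.
Proof.
apply: (addrI (ptens x 0)); by rewrite -ptensDr !addr0.
Qed.

Lemma tens_ind (P : tens -> Prop) :
  P 0 -> (forall x m X, P X -> P (ptens x m + X)) -> forall X, P X.
Proof.
move=> P0 PD; elim/tens_indpi; elim=> [|[x m] u IH]; first exact: P0.
by rewrite -cat1s tens_piD; apply: PD.
Qed.

End TensorModule.

Definition tens_lift (M N : lmodType vqSigma) (g : M -> N) (X : tens M) : tens N :=
  tens_pi (tens_map id g (repr X)).

Section TensLift.
Variables (M N : lmodType vqSigma) (g : M -> N).
Hypothesis gL : linear g.

Lemma tens_liftE u : tens_lift g (tens_pi u) = tens_pi (tens_map id g u).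
Proof. by apply/tens_piP/tens_mapP/tens_repr. Qed.
Lemma tens_lift_ptens x m : tens_lift g (ptens x m) = ptens x (g m).
Proof. exact: tens_liftE. Qed.
Lemma tens_liftD X Y : tens_lift g (X + Y) = tens_lift g X + tens_lift g Y.
Proof.
elim/tens_indpi: X => u; elim/tens_indpi: Y => v.
by rewrite -tens_piD !tens_liftE -tens_piD /tens_map map_cat.
Qed.
Lemma tens_lift0 : tens_lift g 0 = 0.
Proof. exact: (tens_liftE [::]). Qed.
Lemma tens_liftZ s X : tens_lift g (s *: X) = s *: tens_lift g X.
Proof.
elim/tens_ind: X => [|x m X IH]; first by rewrite scaler0 tens_lift0 scaler0.
by rewrite scalerDr !tens_liftD IH ptensZ !tens_lift_ptens scalerDr ptensZ.
Qed.
Lemma tens_lift_linear : linear (tens_lift g).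
Proof. by move=> s X Y; rewrite tens_liftD tens_liftZ. Qed.
End TensLift.

(* Tensor powers over Sigma: T_0 = Sigma and T_(n+1) = VQ_1 (x)_Sigma T_n. *)
Fixpoint vqT (n : nat) : lmodType vqSigma :=
  if n is m.+1 then tens (vqT m) else vqSigma^o.

(* k[[VQ]], the product of the tensor powers. *)
Definition cpa_type : Type := forall n, vqT n.

Implicit Types a b c : cpa_type.

(* Left multiplication of the series b by the homogeneous tensor X of degree n,
   by concatenation: (x (x) t) . b = x (x) (t . b). *)
Fixpoint cpa_lmul b (n : nat) : vqT n -> cpa_type :=
  match n return vqT n -> cpa_type with
  | 0 => fun s j => (s : vqSigma) *: b j
  | m.+1 => fun X j =>
      match j return vqT j with
      | 0 => 0
      | i.+1 => tens_lift (fun t : vqT m => @cpa_lmul b m t i) X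
      end
  end.

Definition cpa_add a b : cpa_type := fun n => a n + b n.
Definition cpa_zero : cpa_type := fun n => 0.
Definition cpa_opp a : cpa_type := fun n => - a n.
Definition cpa_one : cpa_type :=
  fun n => match n return vqT n with 0 => (1 : vqSigma) | _ => 0 end.
Definition cpa_mul a b : cpa_type := fun n => \sum_(i < n.+1) cpa_lmul b (a i) n.
Definition cpa_scale (l : k) a : cpa_type := fun n => ([ffun => l] : vqSigma) *: a n.

Lemma cpa_ext a b : (forall n, a n = b n) -> a = b.
Proof. exact: functional_extensionality_dep. Qed.

HB.instance Definition _ := Topological.copy cpa_type
  (prod_topology (fun n => discrete_topology (vqT n))).

Lemma cpa_addA : associative cpa_add.
Proof. by move=> a b c; apply: cpa_ext => n; apply: addrA. Qed.
Lemma cpa_addC : commutative cpa_add.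
Proof. by move=> a b; apply: cpa_ext => n; apply: addrC. Qed.
Lemma cpa_add0 : left_id cpa_zero cpa_add.
Proof. by move=> a; apply: cpa_ext => n; apply: add0r. Qed.
Lemma cpa_addN : left_inverse cpa_zero cpa_opp cpa_add.
Proof. by move=> a; apply: cpa_ext => n; apply: addNr. Qed.
HB.instance Definition _ := GRing.isZmodule.Build cpa_type
  cpa_addA cpa_addC cpa_add0 cpa_addN.

Lemma cpaDE a b n : (a + b) n = a n + b n. Proof. by []. Qed.
Lemma cpa0E n : (0 : cpa_type) n = 0. Proof. by []. Qed.
Lemma cpa_sumE (I : Type) (r : seq I) (F : I -> cpa_type) n :
  (\sum_(i <- r) F i) n = \sum_(i <- r) F i n.
Proof.
elim: r => [|i r IH]; first by rewrite !big_nil.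
by rewrite !big_cons cpaDE IH.
Qed.

Lemma cpa_lmul_linear b n j : linear (fun t : vqT n => cpa_lmul b t j).
Proof.
elim: n j => [|n IH] j s X Y /=; first by rewrite scalerDl scalerA.
case: j => [|j]; first by rewrite scaler0 addr0.
exact: (tens_lift_linear (IH j)).
Qed.

Lemma cpa_lmulD b n j (X Y : vqT n) :
  cpa_lmul b (X + Y) j = cpa_lmul b X j + cpa_lmul b Y j.
Proof. by rewrite -[X in LHS]scale1r cpa_lmul_linear scale1r. Qed.
Lemma cpa_lmul0 b n j : cpa_lmul b (0 : vqT n) j = 0.
Proof. by apply: (addrI (cpa_lmul b (0 : vqT n) j)); rewrite -cpa_lmulD !addr0. Qed.
Lemma cpa_lmulZ b n j s (X : vqT n) : cpa_lmul b (s *: X) j = s *: cpa_lmul b X j.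
Proof. by rewrite -[s *: X]addr0 cpa_lmul_linear cpa_lmul0 addr0. Qed.
Lemma cpa_lmul_sum b n j (I : Type) (r : seq I) (F : I -> vqT n) :
  cpa_lmul b (\sum_(i <- r) F i) j = \sum_(i <- r) cpa_lmul b (F i) j.
Proof.
elim: r => [|i r IH]; first by rewrite !big_nil cpa_lmul0.
by rewrite !big_cons cpa_lmulD IH.
Qed.

Lemma cpa_lmul_lt b n j (X : vqT n) : (j < n)%N -> cpa_lmul b X j = 0.
Proof.
elim: n j X => [|n IH] [|j] //= X; rewrite ltnS => jn.
elim/tens_ind: X => [|x m X IHX]; first exact/tens_lift0/cpa_lmul_linear.
rewrite tens_liftD ?IHX ?addr0; last exact: cpa_lmul_linear.
by rewrite tens_lift_ptens ?IH ?ptens0r //; apply: cpa_lmul_linear.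
Qed.

Lemma cpa_lmul_ptens b n j x (t : vqT n) :
  cpa_lmul b (ptens x t : vqT n.+1) j.+1 = ptens x (cpa_lmul b t j).
Proof. exact: (tens_lift_ptens (cpa_lmul_linear b j)). Qed.

Lemma cpa_lmul_addr b c n (X : vqT n) j :
  cpa_lmul (b + c) X j = cpa_lmul b X j + cpa_lmul c X j.
Proof.
elim: n X j => [|n IH] X j; first exact: scalerDr.
case: j => [|j]; first by rewrite addr0.
elim/tens_ind: X => [|x m X IHX]; first by rewrite !cpa_lmul0 addr0.
by rewrite !cpa_lmulD IHX !cpa_lmul_ptens IH ptensDr addrACA.
Qed.

Lemma cpa_lmul1 n (X : vqT n) : cpa_lmul cpa_one X n = X.
Proof.
elim: n X => [|n IH] X /=; first exact: mulr1.
elim/tens_ind: X => [|x m X IHX].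
  by apply: (@tens_lift0 (vqT n)); exact: cpa_lmul_linear.
rewrite tens_liftD ?IHX; last exact: cpa_lmul_linear.
by rewrite tens_lift_ptens ?IH //; apply: cpa_lmul_linear.
Qed.

Lemma cpa_lmul1_neq n (X : vqT n) j : n != j -> cpa_lmul cpa_one X j = 0.
Proof.
elim: n X j => [|n IH] X [|j] //=; first by rewrite scaler0.
rewrite eqSS => nj; elim/tens_ind: X => [|x m X IHX].
  exact/tens_lift0/cpa_lmul_linear.
rewrite tens_liftD ?IHX ?addr0; last exact: cpa_lmul_linear.
by rewrite tens_lift_ptens ?IH ?ptens0r //; apply: cpa_lmul_linear.
Qed.

Lemma cpa_lmul_mul b c n (X : vqT n) j :
  cpa_lmul (cpa_mul b c) X j = cpa_mul (cpa_lmul b X) c j.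
Proof.
elim: n X j => [|n IH] X j.
  rewrite /cpa_mul /= scaler_sumr; apply: eq_bigr => i _.
  by rewrite cpa_lmulZ.
elim/tens_ind: X => [|x m X IHX].
  rewrite cpa_lmul0 /cpa_mul big1 // => i _.
  by rewrite cpa_lmul0 cpa_lmul0.
rewrite cpa_lmulD IHX /cpa_mul.
under [RHS]eq_bigr do rewrite cpa_lmulD cpa_lmulD.
rewrite big_split /=; congr (_ + _).
case: j {IHX} => [|j]; first by rewrite big_ord1 /= scale0r.
rewrite big_ord_recl [X in X + _]scale0r add0r.
rewrite -/(cpa_lmul _ (ptens x m : vqT n.+1) j.+1) cpa_lmul_ptens IH.
rewrite /cpa_mul; elim/big_rec2: _ => [|i u v _ <-]; first by rewrite ptens0r.
by rewrite ptensDr -cpa_lmul_ptens -cpa_lmul_ptens.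
Qed.

Lemma cpa_mulDl : left_distributive cpa_mul +%R.
Proof.
move=> a b c; apply: cpa_ext => n; rewrite cpaDE /cpa_mul -big_split /=.
by apply: eq_bigr => i _; rewrite cpa_lmulD.
Qed.
Lemma cpa_mulDr : right_distributive cpa_mul +%R.
Proof.
move=> a b c; apply: cpa_ext => n; rewrite cpaDE /cpa_mul -big_split /=.
by apply: eq_bigr => i _; rewrite cpa_lmul_addr.
Qed.
Lemma cpa_mul1l : left_id cpa_one cpa_mul.
Proof.
move=> a; apply: cpa_ext => n; rewrite /cpa_mul big_ord_recl big1 => [|i _].
  by rewrite addr0; apply: scale1r.
exact: cpa_lmul0.
Qed.
Lemma cpa_mul1r : right_id cpa_one cpa_mul.
Proof.
move=> a; apply: cpa_ext => n; rewrite /cpa_mul big_ord_recr /= big1 => [|i _].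
  by rewrite add0r; apply: cpa_lmul1.
by rewrite cpa_lmul1_neq // ltn_eqF.
Qed.
Lemma cpa_mulA : associative cpa_mul.
Proof.
move=> a b c; apply: cpa_ext => n.
transitivity (\sum_(i < n.+1) \sum_(m < n.+1) cpa_lmul c (cpa_lmul b (a i) m) n).
  by apply: eq_bigr => i _; rewrite cpa_lmul_mul.
rewrite exchange_big /=; apply: eq_bigr => m _.
rewrite /cpa_mul cpa_lmul_sum.
rewrite [RHS](big_ord_widen n.+1 (fun i => cpa_lmul c (cpa_lmul b (a i) m) n)) //.
rewrite [LHS](bigID (fun i : 'I_n.+1 => (i < m.+1)%N)) /=.
rewrite [X in _ + X]big1 ?addr0 // => i; rewrite -leqNgt => mi.
by rewrite [cpa_lmul b _ _]cpa_lmul_lt // cpa_lmul0.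
Qed.

HB.instance Definition _ := GRing.Zmodule_isPzRing.Build cpa_type
  cpa_mulA cpa_mul1l cpa_mul1r cpa_mulDl cpa_mulDr.

Lemma cpa_scaleA (l m : k) a : cpa_scale l (cpa_scale m a) = cpa_scale (l * m) a.
Proof.
apply: cpa_ext => n; rewrite /cpa_scale scalerA; congr (_ *: _).
by apply/ffunP => v; rewrite !ffunE.
Qed.
Lemma cpa_scale1 : left_id 1 cpa_scale.
Proof. by move=> a; apply: cpa_ext => n; apply: scale1r. Qed.
Lemma cpa_scaleDr : right_distributive cpa_scale +%R.
Proof. by move=> l a b; apply: cpa_ext => n; apply: scalerDr. Qed.
Lemma cpa_scaleDl a : {morph cpa_scale^~ a : l m / l + m}.
Proof.
move=> l m; apply: cpa_ext => n; rewrite cpaDE /cpa_scale -scalerDl; congr (_ *: _).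
by apply/ffunP => v; rewrite !ffunE.
Qed.
Lemma cpa_scaleAl l a b : cpa_scale l (a * b) = cpa_scale l a * b.
Proof.
apply: cpa_ext => n; rewrite /cpa_scale [LHS]scaler_sumr.
by apply: eq_bigr => i _; rewrite cpa_lmulZ.
Qed.
Lemma cpa_lmul_scale l b n (X : vqT n) j :
  cpa_lmul (cpa_scale l b) X j = ([ffun => l] : vqSigma) *: cpa_lmul b X j.
Proof.
elim: n X j => [|n IH] X j.
  by rewrite /= /cpa_scale !scalerA vqSigmaC.
case: j => [|j]; first by rewrite scaler0.
elim/tens_ind: X => [|x m X IHX]; first by rewrite !cpa_lmul0 scaler0.
rewrite !cpa_lmulD scalerDr IHX !cpa_lmul_ptens IH -ptens_bal ptensZ.
congr (ptens _ _ + _); apply: functional_extensionality_dep => p.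
by rewrite /vqa_ract ffunE [in RHS]/GRing.scale /= /vqa_lact ffunE.
Qed.
Lemma cpa_scaleAr l a b : cpa_scale l (a * b) = a * cpa_scale l b.
Proof.
apply: cpa_ext => n; rewrite /cpa_scale [LHS]scaler_sumr.
by apply: eq_bigr => i _; rewrite -cpa_lmul_scale.
Qed.

HB.instance Definition _ := PzRing_isAlgebra.Build k cpa_type
  cpa_scaleA cpa_scale1 cpa_scaleDr cpa_scaleDl cpa_scaleAl cpa_scaleAr.


Definition cpa : topAlgType k := cpa_type.

Definition vq_arrow (v w : V) (x : vq_sp (Some v) (Some w)) : vqArrows :=
  @dfwith _ (fun p : V * V => vq_sp (Some p.1) (Some p.2)) (fun=> 0) (v, w) x.

(* Both are extended by 0 to the vertex *. *)
Definition cpa_idem (v : option V) : cpa :=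
  fun n => match n return vqT n with
  | 0 => if v is Some u then [ffun u' => (u' == u)%:R] : vqSigma else 0
  | _ => 0
  end.

Definition cpa_arrow (v w : option V) : vq_sp v w -> cpa :=
  match v, w return vq_sp v w -> cpa with
  | Some v', Some w' => fun (x : vq_sp (Some v') (Some w')) n =>
      match n return vqT n with
      | 1 => @ptens (vqT 0) (vq_arrow x) (1 : vqSigma)
      | _ => 0
      end
  | _, _ => fun=> 0
  end.

End PathAlgebra.

Record category := Category {
  cat_ob :> Type;
  cat_hom : cat_ob -> cat_ob -> Type;
  cat_id : forall x, cat_hom x x;
  cat_comp : forall x y z, cat_hom y z -> cat_hom x y -> cat_hom x z;
  cat_comp1 : forall x y (f : cat_hom x y), cat_comp f (cat_id x) = f;
  cat_1comp : forall x y (f : cat_hom x y), cat_comp (cat_id y) f = f;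
  cat_compA : forall x y z t
    (h : cat_hom z t) (g : cat_hom y z) (f : cat_hom x y),
    cat_comp h (cat_comp g f) = cat_comp (cat_comp h g) f }.

Record functor (C D : category) := Functor {
  fun_ob :> C -> D;
  fun_hom : forall x y, cat_hom x y -> cat_hom (fun_ob x) (fun_ob y);
  fun_hom1 : forall x, fun_hom (cat_id x) = cat_id (fun_ob x);
  fun_homM : forall x y z (g : cat_hom y z) (f : cat_hom x y),
    fun_hom (cat_comp g f) = cat_comp (fun_hom g) (fun_hom f) }.

Definition functor_id (C : category) : functor C C :=
  @Functor C C id (fun x y f => f) (fun=> erefl) (fun _ _ _ _ _ => erefl).

Definition functor_comp (C D E : category)
    (G : functor D E) (F : functor C D) : functor C E.
Proof.
refine (@Functor C E (G \o F) (fun x y f => fun_hom G (fun_hom F f)) _ _).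
- by move=> x; rewrite /= !fun_hom1.
- by move=> x y z g f; rewrite /= !fun_homM.
Defined.

Definition is_iso (C : category) (x y : C) (f : cat_hom x y) : Prop :=
  exists g : cat_hom y x,
    cat_comp g f = cat_id x /\ cat_comp f g = cat_id y.

Definition nat_isomorphic (C D : category) (F G : functor C D) : Prop :=
  exists eta : forall x, cat_hom (F x) (G x),
    (forall x y (f : cat_hom x y),
       cat_comp (eta y) (fun_hom F f) = cat_comp (fun_hom G f) (eta x)) /\
    (forall x, is_iso (eta x)).

Definition is_equivalence (C D : category) (F : functor C D) : Prop :=
  exists G : functor D C,
    nat_isomorphic (functor_comp G F) (functor_id C) /\
    nat_isomorphic (functor_comp F G) (functor_id D).

Section Ideals.
Variables (k : fieldType) (A : topAlgType k).

Definition left_ideal (I : set A) : Prop :=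
  [/\ I 0, forall x y, I x -> I y -> I (x + y) & forall a x, I x -> I (a * x)].

Definition ideal (I : set A) : Prop :=
  left_ideal I /\ forall a x, I x -> I (x * a).

Definition max_open_left_ideal (L : set A) : Prop :=
  [/\ left_ideal L, open L, ~ L 1 &
    forall L', left_ideal L' -> open L' -> ~ L' 1 -> L `<=` L' -> L' = L].

Definition jac : set A := [set x | forall L, max_open_left_ideal L -> L x].

Definition ideal_mul (I I' : set A) : set A :=
  [set x | exists2 s : seq (A * A),
     (forall p, p \in s -> I p.1 /\ I' p.2) & x = \sum_(p <- s) p.1 * p.2].

Definition jac2 : set A := ideal_mul jac jac.

(* A / I is isomorphic to k^n for some n. *)
Definition fin_codim (I : set A) : Prop :=
  exists n (f : A -> 'rV[k]_n),
    [/\ linear f, range f = setT & I = [set x | f x = 0]].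

(* The last clause is the surjectivity of A -> lim_(I in B) A/I, a point of the
   limit being given by representatives x I; injectivity is the third clause. *)
Definition pseudocompact_basis (B : set (set A)) : Prop :=
  [/\ forall I, B I -> [/\ ideal I, open I & fin_codim I],
      forall U, nbhs 0 U -> exists2 I, B I & I `<=` U,
      \bigcap_(I in B) I = [set 0] &
      forall x : set A -> A,
        (forall I I', B I -> B I' -> I `<=` I' -> I' (x I - x I')) ->
        exists a, forall I, B I -> I (a - x I)].

(* k is discrete, so continuity of k * A -> A is continuity for each scalar. *)
Definition pseudocompact : Prop :=
  [/\ hausdorff_space A,
      continuous (fun p : A * A => p.1 + p.2),
      continuous (fun p : A * A => p.1 * p.2),
      forall c : k, continuous (fun x : A => c *: x) &
      exists B, pseudocompact_basis B].

(* The family chi induces A / J(A) ~ k^T, k^T with the product topology. *)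
Definition pointed_alg : Prop :=
  exists (T : Type) (chi : T -> A -> k),
    [/\ forall i, linear (chi i : A -> k^o) /\ monoid_morphism (chi i),
        forall i, continuous (chi i : A -> discrete_topology k),
        jac = [set x | forall i, chi i x = 0] &
        forall g : T -> k, exists x, forall i, chi i x = g i].

Lemma left_ideal_jac : left_ideal jac.
Proof.
split.
- by move=> L [[]].
- by move=> x y Jx Jy L mL; have [[_ LD _] _ _ _] := mL; exact: LD (Jx L mL) (Jy L mL).
- by move=> a x Jx L mL; have [[_ _ LM] _ _ _] := mL; exact: LM (Jx L mL).
Qed.

Lemma algZM (a : k) (x : A) : a *: x = (a *: (1 : A) : A) * x.
Proof. by rewrite -[x in LHS]mul1r; apply: alg_scaleAl. Qed.

Lemma left_idealP (I : set A) : left_ideal I ->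
  forall (a : k) x y, I x -> I y -> I (a *: x + y).
Proof. by case=> _ ID IM a x y Ix Iy; rewrite algZM; apply/ID/Iy/IM. Qed.

Lemma left_ideal_mul (I I' : set A) : left_ideal I -> left_ideal (ideal_mul I I').
Proof.
move=> [_ _ IM]; split.
- by exists [::] => //; rewrite big_nil.
- move=> x y [s Is ->] [t It ->]; exists (s ++ t); last by rewrite big_cat.
  by move=> p; rewrite mem_cat => /orP[/Is|/It].
- move=> a x [s Is ->]; exists [seq (a * p.1, p.2) | p <- s].
    by move=> _ /mapP[p /Is[I1 I2] ->]; split=> //; apply: IM.
  by rewrite big_map mulr_sumr; apply: eq_bigr => p _ /=; rewrite mulrA.
Qed.

Lemma left_ideal_jac2 : left_ideal jac2.
Proof. exact/left_ideal_mul/left_ideal_jac. Qed.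

Definition jac2_submod :=
  @Submod k _ jac2 (let: And3 h _ _ := left_ideal_jac2 in h)
    (left_idealP left_ideal_jac2).

Definition jac_submod :=
  @Submod k _ jac (let: And3 h _ _ := left_ideal_jac in h)
    (left_idealP left_ideal_jac).

End Ideals.
Arguments jac {k} A.
Arguments jac2 {k} A.

Notation quoJ A := (lquot (jac_submod A)).
Notation quoJ2 A := (lquot (jac2_submod A)).
Notation piJ A := (lquot_pi (jac_submod A)).
Notation piJ2 A := (lquot_pi (jac2_submod A)).

Definition alg_hom (k : fieldType) (A B : topAlgType k) (f : A -> B) : Prop :=
  linear f /\ monoid_morphism f.

(* pm_surj: the induced map A / J(A) -> B / J(B) is surjective. *)
Record palg_morph (k : fieldType) (A B : topAlgType k) (f : A -> B) : Prop :=
  PalgMorph {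
    pm_alg : alg_hom f;
    pm_cont : continuous f;
    pm_surj : forall b, exists a, jac B (f a - b) }.

Definition sim1 (k : fieldType) (A B : topAlgType k) (f g : A -> B) : Prop :=
  (forall a, jac B (f a - g a)) /\ (forall a, jac A a -> jac2 B (f a - g a)).

Record palg (k : fieldType) := Palg {
  palg_alg :> topAlgType k;
  palg_pc : pseudocompact palg_alg;
  palg_pt : pointed_alg palg_alg;
  palg_fin : fin_codim (jac2 palg_alg) }.

Section PAlg.
Variable k : fieldType.

Record palg_hom (A B : palg k) := PalgHom {
  ph_fun :> A -> B;
  ph_morph : palg_morph ph_fun }.

Section AlgHomTheory.
Variables (A B : topAlgType k) (f : A -> B).
Hypothesis fA : alg_hom f.
Lemma alg_homD : {morph f : x y / x + y}.
Proof. by move=> x y; rewrite -[x in LHS]scale1r fA.1 scale1r. Qed.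
Lemma alg_hom0 : f 0 = 0.
Proof. by apply: (addrI (f 0)); rewrite -alg_homD !addr0. Qed.
Lemma alg_homN : {morph f : x / - x}.
Proof. by move=> x; apply: (addrI (f x)); rewrite -alg_homD !subrr alg_hom0. Qed.
Lemma alg_homB : {morph f : x y / x - y}.
Proof. by move=> x y; rewrite alg_homD alg_homN. Qed.
Lemma alg_homM : {morph f : x y / x * y}. Proof. exact: fA.2.2. Qed.
Lemma alg_hom1 : f 1 = 1. Proof. exact: fA.2.1. Qed.
Lemma alg_hom_sum (I : Type) (r : seq I) (F : I -> A) :
  f (\sum_(i <- r) F i) = \sum_(i <- r) f (F i).
Proof.
elim: r => [|i r IH]; first by rewrite !big_nil alg_hom0.
by rewrite !big_cons alg_homD IH.
Qed.
End AlgHomTheory.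

Lemma palg_morph_jac (A : topAlgType k) (B : palg k) (f : A -> B) :
  alg_hom f -> continuous f -> forall a, jac A a -> jac B (f a).
Proof.
move=> fA fc a Ja; have [T [chi [chiA chic -> _]]] := palg_pt B => i /=.
have [chL [ch1 chM]] := chiA i.
have chD x y : chi i (x + y) = chi i x + chi i y.
  by rewrite -[x in LHS]scale1r chL; congr (_ + _); apply: mul1r.
have ch0 : chi i 0 = 0 by apply: (addrI (chi i 0)); rewrite -chD !addr0.
suff /Ja : max_open_left_ideal [set x | chi i (f x) = 0] by [].
split.
- split=> /=.
  + by rewrite alg_hom0.
  + by move=> x y fx fy; rewrite alg_homD // chD fx fy addr0.
  + by move=> b x fx; rewrite alg_homM // chM fx mulr0.
- pose g : A -> discrete_topology k := fun x => chi i (f x).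
  have gc : continuous g by move=> x; apply: (continuous_comp (fc x)); exact: chic.
  rewrite (_ : [set x | _] = g @^-1` [set 0]) //.
  by apply: open_comp; [move=> x _; exact: gc|exact: discrete_open].
- by rewrite /= alg_hom1 // ch1 => /eqP; rewrite oner_eq0.
- move=> L' [L0 LD LM] _ L1 sL; rewrite eqEsubset; split=> // x Lx.
  apply: contrapT => /= /eqP cx; apply: L1.
  set c := chi i (f x) in cx.
  pose y : A := c^-1 *: x.
  have -> : 1 = y + (1 - y) by rewrite addrC subrK.
  apply: LD; first by rewrite /y algZM; apply: LM.
  apply: sL => /=; rewrite alg_homB // alg_hom1 // /y.
  have fZ u v : f (u *: v) = u *: f v.
    by rewrite -[u *: v]addr0 fA.1 alg_hom0 // addr0.
  have chN u : chi i (- u) = - chi i u.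
    by apply: (addrI (chi i u)); rewrite -chD !subrr ch0.
  have chZ u v : chi i (u *: v) = u * chi i v.
    by rewrite -[u *: v]addr0 chL ch0 addr0.
  by rewrite fZ chD chN chZ -/c mulVf // ch1 subrr.
Qed.

Lemma palg_morph_jac2 (A : topAlgType k) (B : palg k) (f : A -> B) :
  alg_hom f -> continuous f -> forall a, jac2 A a -> jac2 B (f a).
Proof.
move=> fA fc a [s Js ->]; exists [seq (f p.1, f p.2) | p <- s].
  by move=> _ /mapP[p /Js[J1 J2] ->]; split; apply: palg_morph_jac.
rewrite big_map alg_hom_sum //; apply: eq_bigr => p _; exact: alg_homM.
Qed.

Lemma palg_morph_id (A : topAlgType k) : palg_morph (id : A -> A).
Proof.
split=> [||b]; first by do !split.
  by move=> x.
by exists b; rewrite subrr; have [] := left_ideal_jac A.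
Qed.

Lemma palg_morph_comp (A B : topAlgType k) (C : palg k) (g : B -> C) (f : A -> B) :
  palg_morph g -> palg_morph f -> palg_morph (g \o f).
Proof.
move=> [gA gc gs] [fA fc fs]; split.
- split=> [a x y|]; first by rewrite /= fA.1 gA.1.
  by split=> [|x y] /=; rewrite ?(alg_hom1 fA) ?(alg_homM fA) ?(alg_hom1 gA) ?(alg_homM gA).
- by move=> x; apply: continuous_comp; [apply: fc|apply: gc].
- move=> c; have [b Jb] := gs c; have [a Ja] := fs b; exists a => /=.
  rewrite -(subrK (g b) (g (f a))) -addrA.
  have [_ JD _] := left_ideal_jac C; apply: JD => //.
  by rewrite -alg_homB //; apply: palg_morph_jac.
Qed.

Definition palg_id (A : palg k) : palg_hom A A := PalgHom (palg_morph_id A).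
Definition palg_comp (A B C : palg k) (g : palg_hom B C) (f : palg_hom A B) :
  palg_hom A C := PalgHom (palg_morph_comp (ph_morph g) (ph_morph f)).

Lemma palg_hom_eq (A B : palg k) (f g : palg_hom A B) : f =1 g -> f = g.
Proof.
case: f g => [f pf] [g pg] /= /funext fg; rewrite fg in pf *.
by congr PalgHom; apply: Prop_irrelevance.
Qed.

Definition palg_rel (A B : palg k) (f g : {classic palg_hom A B}) : bool :=
  `[< sim1 f g >].

Lemma sim1_equiv (A B : topAlgType k) :
  [/\ forall f : A -> B, sim1 f f,
      forall f g : A -> B, sim1 f g -> sim1 g f &
      forall f g h : A -> B, sim1 f g -> sim1 g h -> sim1 f h].
Proof.
have [J0 JD _] := left_ideal_jac B; have [J20 J2D _] := left_ideal_jac2 B.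
split=> [f|f g [H1 H2]|f g h [H1 H2] [H3 H4]].
- by split=> a; rewrite subrr.
- split=> a => [|Ja]; rewrite -opprB.
    exact: (submodN (S := jac_submod B) (H1 a)).
  exact: (submodN (S := jac2_submod B) (H2 a Ja)).
- split=> a => [|Ja]; rewrite -(subrKA (g a)); first exact: JD.
  by apply: J2D; [apply: H2|apply: H4].
Qed.

Lemma palg_rel_equiv (A B : palg k) : equiv_class_of (@palg_rel A B).
Proof.
have [r s t] := sim1_equiv A B.
split=> [f|f g|g f h].
- exact/asboolP/r.
- by apply/asboolP/asboolP; apply: s.
- by move=> /asboolP fg /asboolP gh; apply/asboolP/(t _ _ _ fg gh).
Qed.
Canonical palg_rel_equivrel (A B : palg k) := EquivRelPack (palg_rel_equiv A B).

Definition palg1_hom (A B : palg k) : Type := {eq_quot (@palg_rel A B)}.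
HB.instance Definition _ (A B : palg k) := EqQuotient.on (palg1_hom A B).

Definition palg1_class (A B : palg k) (f : palg_hom A B) : palg1_hom A B :=
  \pi_(palg1_hom A B) (f : {classic palg_hom A B}).
Definition palg1_repr (A B : palg k) (f : palg1_hom A B) : palg_hom A B :=
  (repr f : {classic palg_hom A B}).

Lemma palg1_classP (A B : palg k) (f g : palg_hom A B) :
  palg1_class f = palg1_class g <-> sim1 f g.
Proof. by split=> [/eqmodP/asboolP//|h]; apply/eqmodP/asboolP. Qed.

Lemma palg1_reprK (A B : palg k) (f : palg1_hom A B) :
  palg1_class (palg1_repr f) = f.
Proof. exact: reprK. Qed.

Lemma sim1_comp (A B C : palg k) (g g' : palg_hom B C) (f f' : palg_hom A B) :
  sim1 g g' -> sim1 f f' -> sim1 (palg_comp g f) (palg_comp g' f').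
Proof.
move=> [g1 g2] [f1 f2].
have [[gA gc _] [fA' fc' _]] := (ph_morph g, ph_morph f').
have E a : palg_comp g f a - palg_comp g' f' a =
    g (f a - f' a) + (g (f' a) - g' (f' a)).
  by rewrite /= (alg_homB gA) addrA subrK.
have [_ JD _] := left_ideal_jac C; have [_ J2D _] := left_ideal_jac2 C.
split=> a => [|Ja]; rewrite E.
  exact: JD (palg_morph_jac gA gc (f1 a)) (g1 _).
exact: J2D (palg_morph_jac2 gA gc (f2 a Ja)) (g2 _ (palg_morph_jac fA' fc' Ja)).
Qed.

Definition palg1_comp (A B C : palg k) (g : palg1_hom B C) (f : palg1_hom A B) :
  palg1_hom A C := palg1_class (palg_comp (palg1_repr g) (palg1_repr f)).

Lemma palg1_compE (A B C : palg k) (g : palg_hom B C) (f : palg_hom A B) :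
  palg1_comp (palg1_class g) (palg1_class f) = palg1_class (palg_comp g f).
Proof. by apply/palg1_classP/sim1_comp; apply/palg1_classP/palg1_reprK. Qed.

Lemma palg1_ind (A B : palg k) (P : palg1_hom A B -> Prop) :
  (forall f, P (palg1_class f)) -> forall F, P F.
Proof. by move=> h F; rewrite -[F]palg1_reprK. Qed.

Definition palg1 : category.
Proof.
refine (@Category (palg k) palg1_hom (fun A => palg1_class (palg_id A))
  palg1_comp _ _ _).
- by move=> A B; elim/palg1_ind=> f; rewrite palg1_compE; congr palg1_class;
    apply: palg_hom_eq.
- by move=> A B; elim/palg1_ind=> f; rewrite palg1_compE; congr palg1_class;
    apply: palg_hom_eq.
- move=> A B C D; elim/palg1_ind=> h; elim/palg1_ind=> g; elim/palg1_ind=> f.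
  by rewrite !palg1_compE; congr palg1_class; apply: palg_hom_eq.
Defined.

End PAlg.

Lemma fin_dim_vector_axiom (k : fieldType) (W : lmodType k) n (i : W -> 'rV[k]_n) :
  linear i -> injective i -> exists m, inhabited (vector_axiom_def m W).
Proof.
move=> iL inji.
have iD x y : i (x + y) = i x + i y by rewrite -[x in LHS]scale1r iL scale1r.
have i0 : i 0 = 0 by apply: (addrI (i 0)); rewrite -iD !addr0.
have iZ a x : i (a *: x) = a *: i x by rewrite -[a *: x]addr0 iL i0 addr0.
pose P m := `[< exists2 B : 'M[k]_(m, n), row_free B & forall r, exists w, row r B = i w >].
have P0 : exists m, P m.
  exists 0; apply/asboolP; exists 0; last by case.
  by rewrite /row_free mxrank0.
have Pn m : P m -> (m <= n)%N.
  by move=> /asboolP[B /eqP rB _]; rewrite -rB; apply: rank_leq_col.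
case: (ex_maxnP P0 Pn) => m /asboolP[B freeB rowB] maxm.
have sub w : (i w <= B)%MS.
  apply: contraT => nsub; suff /maxm : P (1 + m)%N by rewrite ltnn.
  apply/asboolP; exists (col_mx (i w) B).
    rewrite /row_free -addsmxE.
    have : (\rank B < \rank (i w + B)%MS)%N.
      apply: rank_ltmx; rewrite /ltmx addsmxSr /=.
      by apply: contra nsub; apply: submx_trans; apply: addsmxSl.
    move/eqP: freeB => ->; rewrite eqn_leq => ->; rewrite andbT.
    by rewrite addsmxE rank_leq_row.
  move=> r; case: (split_ordP r) => j ->.
    by exists w; rewrite rowKu; apply/rowP => l; rewrite (ord1 j) mxE.
  by rewrite rowKd; apply: rowB.
have im u : exists w, i w = u *m B.
  suff [w E] : exists w, i w = \sum_r u 0 r *: row r B by exists w; rewrite mulmx_sum_row E.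
  elim/big_rec: _ => [|r x _ [w <-]]; first by exists 0.
  have [w' ->] := rowB r; exists (u 0 r *: w' + w); exact: iL.
exists m; constructor; exists (fun w => i w *m pinvmx B) => [a x y|].
  by rewrite iL mulmxDl scalemxAl.
exists (fun u => sval (cid (im u))) => [w|u].
  by case: cid => w' /= E; apply: inji; rewrite E mulmxKpV.
by case: cid => w' /= ->; rewrite -mulmxA mulmxVp ?mulmx1.
Qed.

Section GabrielQuiver.
Variables (k : fieldType) (A : palg k).

(* The orbit of a under the automorphisms x |-> (1 + w) x (1 + w)^-1, w in J(A). *)
Definition inner_orbit (a : A) : set A :=
  [set b | exists w u : A, [/\ jac A w, (1 + w) * u = 1, u * (1 + w) = 1 &
                               b = (1 + w) * a * u]].

Definition prim_idem (e : A) : Prop :=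
  [/\ e != 0, e * e = e &
    forall a b : A, a * a = a -> b * b = b -> a * b = 0 -> b * a = 0 ->
      e = a + b -> a = 0 \/ b = 0].

Definition complete_prim_idem (E : seq A) : Prop :=
  [/\ uniq E, forall e, e \in E -> prim_idem e,
      forall e f, e \in E -> f \in E -> e != f -> e * f = 0 &
      \sum_(e <- E) e = 1].

(* The fixed complete set of primitive orthogonal idempotents. It is finite, as
   its elements have nonzero orthogonal images in the finite dimensional A / J(A). *)
Definition idem_seq : seq A := xget [::] complete_prim_idem.

Definition gq_vert : finType := seq_sub [seq inner_orbit e | e <- idem_seq].

(* The member e of the fixed set whose orbit is v; 0 for the vertex *. *)
Definition gq_rep (v : option gq_vert) : A :=
  if v is Some u then
    nth 0 idem_seq (index (val u) [seq inner_orbit e | e <- idem_seq])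
  else 0.

(* X belongs to the subspace f (J / J^2) e of A / J^2. *)
Definition gq_mem (e f : A) (X : quoJ2 A) : bool :=
  `[< exists2 j, jac A j & X = piJ2 A (f * j * e) >].

Lemma gq_mem_submod e f : submod_closed (gq_mem e f).
Proof.
have [J0 _ _] := left_ideal_jac A.
split=> [|a X Y].
  by apply/asboolP; exists 0 => //; rewrite mulr0 mul0r [RHS]linear0.
move=> /asboolP[i Ji ->] /asboolP[j Jj ->]; apply/asboolP.
exists (a *: i + j); first exact: left_idealP (left_ideal_jac A) _ _ _ Ji Jj.
rewrite -[LHS]linearP; congr lquot_pi.
rewrite mulrDr mulrDl; congr (_ + _).
by rewrite -talg_scalerAr -talg_scalerAl.
Qed.
HB.instance Definition _ e f :=
  GRing.isSubmodClosed.Build k _ (gq_mem e f) (gq_mem_submod e f).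

Record gq_space (e f : A) := GqSpace {
  gq_coset :> quoJ2 A;
  gq_cosetP : gq_mem e f gq_coset }.
HB.instance Definition _ e f := [isSub for @gq_coset e f].
HB.instance Definition _ e f := [Choice of gq_space e f by <:].
HB.instance Definition _ e f := [SubChoice_isSubLmodule of gq_space e f by <:].

Lemma gq_space_fin_dim e f : exists m, inhabited (vector_axiom_def m (gq_space e f)).
Proof.
have [n [g [gL _ gK]]] := palg_fin A.
have gB x y : g (x - y) = g x - g y.
  by rewrite addrC -scaleN1r gL scaleN1r addrC.
have gP x y : g x = g y <-> piJ2 A x = piJ2 A y.
  rewrite (rwP eqP) -subr_eq0 -gB -(rwP eqP).
  rewrite (_ : (g (x - y) = 0) = jac2 A (x - y)); last by rewrite gK.
  by split=> /(@lquot_piP _ _ (jac2_submod A)).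
have gr (X : quoJ2 A) x : X = piJ2 A x -> g (repr X) = g x.
  by move=> ->; apply/gP/lquot_reprK.
have gD a (X Y : quoJ2 A) : g (repr (a *: X + Y)) = a *: g (repr X) + g (repr Y).
  by rewrite -gL; apply: gr; rewrite lquot_pi_is_linear !lquot_reprK.
apply: (@fin_dim_vector_axiom k (gq_space e f) n (fun X => g (repr (val X)))).
  by move=> a X Y; apply: gD.
by move=> X Y /gP; rewrite !lquot_reprK; apply: val_inj.
Qed.

Let gq_dim e f := sval (cid (gq_space_fin_dim e f)).
Lemma gq_space_dim e f : inhabited (vector_axiom_def (gq_dim e f) (gq_space e f)).
Proof. exact: svalP (cid (gq_space_fin_dim e f)). Qed.

HB.instance Definition _ e f := Lmodule_hasFinDim.Build k (gq_space e f)
  (inhabited_witness (gq_space_dim e f)).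
End GabrielQuiver.

Lemma gq_space0r (k : fieldType) (A : palg k) f (x : gq_space (0 : A) f) : x = 0.
Proof.
apply: val_inj; have /asboolP[j _ E] := gq_cosetP x.
by rewrite [LHS]E mulr0; apply: linear0.
Qed.

Lemma gq_space0l (k : fieldType) (A : palg k) e (x : gq_space e (0 : A)) : x = 0.
Proof.
apply: val_inj; have /asboolP[j _ E] := gq_cosetP x.
by rewrite [LHS]E mul0r mul0r; apply: linear0.
Qed.

Definition gq (k : fieldType) (A : palg k) : vquiver k :=
  @Vquiver k (gq_vert A) (fun v w => gq_space (gq_rep v) (gq_rep w))
    (fun v => @gq_space0r k A (gq_rep v)) (fun v => @gq_space0l k A (gq_rep v)).

Definition gq_val (k : fieldType) (A : palg k) (v w : option (vq_vert (gq A)))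
  (x : vq_sp v w) : quoJ2 A := gq_coset (x : gq_space (gq_rep v) (gq_rep w)).

(* rho is the map of Vquivers induced by alpha. When alpha e or alpha f is 0 the
   last equation reads 0 = 0. *)
Definition gq_hom_spec (k : fieldType) (A B : palg k) (alpha : palg_hom A B)
    (rho : vqmap (gq A) (gq B)) : Prop :=
  (forall (v : vq_vert (gq A)) e, e \in idem_seq A -> val v = inner_orbit e ->
     if alpha e == 0 then vqm0 rho (Some v) = None
     else exists2 w : vq_vert (gq B), vqm0 rho (Some v) = Some w &
                                      val w = inner_orbit (alpha e)) /\
  (forall (v w : vq_vert (gq A)) e f, e \in idem_seq A -> val v = inner_orbit e ->
     f \in idem_seq A -> val w = inner_orbit f ->
     forall (x : vq_sp (Some v) (Some w)) j, jac A j ->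
       gq_val x = piJ2 A (f * j * e) ->
       gq_val (vqm1 rho x) = piJ2 B (alpha f * alpha j * alpha e)).

Section RelationIdeals.
Variables (k : fieldType) (Q : vquiver k).

Definition rel_ideal (I : set (cpa Q)) : Prop :=
  [/\ ideal I, closed I & I `<=` jac2 (cpa Q)].

Definition id1 (d : cpa Q -> cpa Q) : Prop := palg_morph d /\ sim1 d id.

Definition rel_class (I : set (cpa Q)) : set (set (cpa Q)) :=
  [set I' | exists2 d, id1 d & I' = d @` I].

Definition is_rel_class (C : set (set (cpa Q))) : Prop :=
  exists2 I, rel_ideal I & C = rel_class I.

End RelationIdeals.

Section VQuivInfty.
Variable k : fieldType.

Record vqi := Vqi {
  vqi_quiver : vquiver k;
  vqi_class : set (set (cpa vqi_quiver));
  vqi_classP : is_rel_class vqi_class }.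
Arguments vqi_class : clear implicits.

(* These conditions determine phi = k[[rho]]. *)
Definition is_cpa_map (VR VQ : vquiver k) (rho : vqmap VR VQ)
    (phi : cpa VR -> cpa VQ) : Prop :=
  [/\ alg_hom phi, continuous phi,
      forall v, phi (cpa_idem v) = cpa_idem (vqm0 rho v) &
      forall v w (x : vq_sp v w), phi (cpa_arrow x) = cpa_arrow (vqm1 rho x)].

Definition vqi_takes (X Y : vqi) (rho : vqmap (vqi_quiver X) (vqi_quiver Y)) : Prop :=
  exists2 phi, is_cpa_map rho phi &
    exists I' K', [/\ vqi_class X I', vqi_class Y K' & phi @` I' `<=` K'].

(* The maps satisfying vqi_takes are not closed under composition, so the
   morphisms are taken to be their composites, i.e. the category they generate.
   Example, one vertex throughout, listing the loops: {x, y} -> {x, y, z} the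
   inclusion, {x, y, z} -> {y, z} killing x, with the closed ideals generated by
   x^2 + y^5, x^2 + y^5 and z^4 + y^5. Both maps satisfy vqi_takes (for the
   second, use the automorphism x |-> x + z^2); their composite does not. *)
Inductive vqi_mor : forall X Y : vqi,
    vqmap (vqi_quiver X) (vqi_quiver Y) -> Prop :=
| vqi_mor_takes X Y rho : vqi_takes rho -> @vqi_mor X Y rho
| vqi_mor_comp X Y Z sigma rho : @vqi_mor Y Z sigma -> @vqi_mor X Y rho ->
    @vqi_mor X Z (vqmap_comp sigma rho).

Record vqi_hom (X Y : vqi) := VqiHom {
  vqih_map : vqmap (vqi_quiver X) (vqi_quiver Y);
  vqih_mor : vqi_mor vqih_map }.

Lemma vqi_hom_eq X Y (f g : vqi_hom X Y) : vqih_map f = vqih_map g -> f = g.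
Proof.
case: f g => f pf [g pg] /= E; rewrite E in pf *.
by congr VqiHom; apply: Prop_irrelevance.
Qed.

Lemma vqi_takes_id (X : vqi) : vqi_takes (X := X) (vqmap_id (vqi_quiver X)).
Proof.
exists id; first by do !split=> //; move=> x.
have [I _ E] := vqi_classP X.
exists I, I; split=> //; last by move=> _ [x Ix <-].
all: rewrite E; exists id; last by rewrite image_id.
all: split; first exact: palg_morph_id.
all: by have [r _ _] := sim1_equiv (cpa (vqi_quiver X)) (cpa (vqi_quiver X)); apply: r.
Qed.

Definition vqi_id (X : vqi) : vqi_hom X X := VqiHom (vqi_mor_takes (vqi_takes_id X)).
Definition vqi_comp (X Y Z : vqi) (g : vqi_hom Y Z) (f : vqi_hom X Y) : vqi_hom X Z :=
  VqiHom (vqi_mor_comp (vqih_mor g) (vqih_mor f)).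

Definition vquiv_infty : category.
Proof.
refine (@Category vqi vqi_hom vqi_id vqi_comp _ _ _).
- by move=> X Y f; apply: vqi_hom_eq; apply: vqmap_comp_id.
- by move=> X Y f; apply: vqi_hom_eq; apply: vqmap_id_comp.
- by move=> X Y Z T h g f; apply: vqi_hom_eq; apply: vqmap_compA.
Defined.

End VQuivInfty.

Section Counit.
Variables (k : fieldType) (A : palg k).

(* The subalgebra Sigma is range s. *)
Definition alg_splitting (s : quoJ A -> A) : Prop :=
  [/\ linear s, s (piJ A 1) = 1,
      forall a b, s (piJ A (a * b)) = s (piJ A a) * s (piJ A b) &
      forall X, piJ A (s X) = X].

(* Only the values of t on J(A) / J^2(A) are constrained, and used. *)
Definition bimod_splitting (s : quoJ A -> A) (t : quoJ2 A -> A) : Prop :=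
  [/\ forall j, jac A j -> jac A (t (piJ2 A j)),
      forall j, jac A j -> piJ2 A (t (piJ2 A j)) = piJ2 A j,
      forall (c : k) i j, jac A i -> jac A j ->
        t (piJ2 A (c *: i + j)) = c *: t (piJ2 A i) + t (piJ2 A j) &
      forall X Y j, jac A j ->
        t (piJ2 A (s X * j * s Y)) = s X * t (piJ2 A j) * s Y].

Definition counit_of (s : quoJ A -> A) (t : quoJ2 A -> A)
    (phi : cpa (gq A) -> A) : Prop :=
  [/\ alg_hom phi, continuous phi,
      forall v : vq_vert (gq A),
        val v (phi (cpa_idem (Some v))) /\ range s (phi (cpa_idem (Some v))) &
      forall (v w : vq_vert (gq A)) (x : vq_sp (Some v) (Some w)),
        phi (cpa_arrow x) = t (gq_val x)].

Definition counit_rep (phi : cpa (gq A) -> A) : Prop :=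
  palg_morph phi /\
  exists s t phi0, [/\ alg_splitting s, bimod_splitting s t,
                       counit_of s t phi0 & sim1 phi phi0].

(* [K_A]; it does not depend on the representative phi of the counit. *)
Definition gq_class : set (set (cpa (gq A))) :=
  [set I | exists2 phi, counit_rep phi & rel_class [set x | phi x = 0] I].

End Counit.
Arguments gq_class {k} A.

(* The functor GQ_infty: all data are determined, by gq_class on objects and by
   gq_hom_spec on morphisms; an inhabitant records that they are well defined
   and functorial. *)
Record gq_infty (k : fieldType) := GqInfty {
  gqi_classP : forall A : palg k, is_rel_class (gq_class A);
  gqi_ob := fun A : palg k => Vqi (gqi_classP A);
  gqi_hom : forall A B : palg k, palg1_hom A B -> vqi_hom (gqi_ob A) (gqi_ob B);
  gqi_homP : forall (A B : palg k) (alpha : palg_hom A B),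
    gq_hom_spec alpha (vqih_map (gqi_hom (palg1_class alpha)));
  gqi_hom1 : forall A, gqi_hom (palg1_class (palg_id A)) = vqi_id (gqi_ob A);
  gqi_homM : forall A B C (g : palg1_hom B C) (f : palg1_hom A B),
    gqi_hom (palg1_comp g f) = vqi_comp (gqi_hom g) (gqi_hom f) }.

Definition gq_infty_functor (k : fieldType) (G : gq_infty k) :
    functor (palg1 k) (vquiv_infty k) :=
  @Functor (palg1 k) (vquiv_infty k) (gqi_ob G) (@gqi_hom k G)
    (@gqi_hom1 k G) (@gqi_homM k G).

(* Main.v *)
From HB Require Import structures.
Require Import Defs.
From mathcomp Require Import all_boot all_order all_algebra.
From mathcomp Require Import all_classical topology.

Set Implicit Arguments.
Unset Strict Implicit.
Unset Printing Implicit Defensive.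

Import GRing.Theory.

Local Open Scope classical_set_scope.
Local Open Scope ring_scope.

(** The functor is determined by the counit [k[[gq A]] -> A], whose kernel [K_A] is the
    relation ideal attached to [A]. Everything rests on two facts.

    First, in an object [A] of PAlg the powers of [J(A)] are open and define the topology
    ([jpow_closed], [jpow_nbhs]): since [J(A) / J^2(A)] is finite dimensional, each power
    has finite codimension, and a convergent series of products can be regrouped along
    finitely many generators. So a morphism is onto as soon as it is onto modulo
    [J] and [J^2] ([jpow_onto]); homomorphisms preserving radicals are automatically
    continuous; and an endomorphism similar to the identity (in the relation [~_1]) is an
    automorphism ([sim1_id_bij]). In particular the counit is onto, so that
    [A = k[[gq A]] / K_A].

    Second, a completed path algebra has a universal property ([cpa_universal]), hence a
    lifting property ([cpa_lift]): if [p : D -> B] maps [J(D)] onto [J(B)], and [p \o f0] is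
    similar to [f : k[[Q]] -> B], then [f] is exactly [p \o h] for some [h] similar to [f0].
    The vertices are moved by conjugation with a unit that lifts, the arrows by elements of
    [J^2]. Applied to two representatives of the counit, this shows that their kernels have
    the same class. Applied to a counit and to [al \o counit], it shows that a morphism
    [al : A -> B] inducing [r] on Gabriel quivers comes from some [d : k[[gq A]] -> k[[gq B]]]
    similar to [k[[r]]] that sends [K_A] into [K_B]; conversely such a [d] induces a morphism
    of the quotients. As similarity to [k[[r]]] determines the class of [d], and the counit
    is onto, [GQ_infty] is full and faithful once the morphisms of VQuiv_infty are known to
    be the maps [r] for which such a [d] exists.

    The last point is not immediate, because a morphism is a composite of maps [r] for
    which [k[[r]]] itself sends an ideal of one class into an ideal of the other. That
    composites give some [d] is clear ([vqi_mor_tracks]). In the other direction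
    ([tracks_vqi_mor]), [r] is factored as [Q -> P -> R], where [P] has the arrows of both
    [Q] and [R]; [d] extends to [k[[P]]], and on [k[[P]]] the extension differs from the
    map induced by [P -> R] only by an automorphism similar to the identity, by the lifting
    property.

    Finally [(VQ, [I])] is isomorphic to the image of [k[[VQ]] / I], which is an object of
    PAlg by a recognition principle for filtered algebras ([exists_cpa_quotient]). *)

(** * Linear sets and finite codimension *)

Section LinearSets.
Variables (k : fieldType).

Definition linear_set (V : lmodType k) (W : set V) : Prop :=
  W 0 /\ forall (a : k) x y, W x -> W y -> W (a *: x + y).

Section Closure.
Variables (V : lmodType k) (W : set V).
Hypothesis WL : linear_set W.

Lemma linear_setD x y : W x -> W y -> W (x + y).
Proof. by move=> Wx Wy; rewrite -[x]scale1r; apply: WL.2. Qed.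
Lemma linear_setZ a x : W x -> W (a *: x).
Proof. by move=> Wx; rewrite -[_ *: _]addr0; apply: WL.2 => //; apply: WL.1. Qed.
Lemma linear_setN x : W x -> W (- x).
Proof. by move=> Wx; rewrite -scaleN1r; apply: linear_setZ. Qed.
Lemma linear_setB x y : W x -> W y -> W (x - y).
Proof. by move=> Wx Wy; apply/linear_setD/linear_setN. Qed.
Lemma linear_setBC x y : W (x - y) -> W (y - x).
Proof. by rewrite -[y - x]opprB; apply: linear_setN. Qed.
Lemma linear_set_trans y x z : W (x - y) -> W (y - z) -> W (x - z).
Proof. by move=> xy yz; rewrite -(subrKA y); apply: linear_setD. Qed.
Lemma linear_set_congr x y : W (x - y) -> W y -> W x.
Proof. by move=> xy Wy; rewrite -(subrK y x); apply: linear_setD. Qed.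
Lemma linear_set_sum (I : Type) (r : seq I) (P : pred I) (F : I -> V) :
  (forall i, P i -> W (F i)) -> W (\sum_(i <- r | P i) F i).
Proof.
move=> WF; elim/big_rec: _ => [|i x Pi Wx]; first exact: WL.1.
by apply: linear_setD => //; apply: WF.
Qed.
End Closure.

Section LinearFun.
Variables (V W : lmodType k) (f : V -> W).
Hypothesis fL : linear f.
Lemma lin_funD x y : f (x + y) = f x + f y.
Proof. by rewrite -[x in LHS]scale1r fL scale1r. Qed.
Lemma lin_fun0 : f 0 = 0.
Proof. by apply: (addrI (f 0)); rewrite -lin_funD !addr0. Qed.
Lemma lin_funZ a x : f (a *: x) = a *: f x.
Proof. by rewrite -[a *: x]addr0 fL lin_fun0 addr0. Qed.
Lemma lin_funN x : f (- x) = - f x.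
Proof. by rewrite -scaleN1r lin_funZ scaleN1r. Qed.
Lemma lin_funB x y : f (x - y) = f x - f y.
Proof. by rewrite lin_funD lin_funN. Qed.
Lemma lin_fun_sum (I : Type) (r : seq I) (P : pred I) (F : I -> V) :
  f (\sum_(i <- r | P i) F i) = \sum_(i <- r | P i) f (F i).
Proof.
by elim/big_rec2: _ => [|i y x _ <-]; [exact: lin_fun0 | rewrite lin_funD].
Qed.
Lemma linear_set_image (X : set V) : linear_set X -> linear_set (f @` X).
Proof.
move=> XL; split; first by exists 0; [exact: XL.1 | exact: lin_fun0].
move=> a _ _ [x Xx <-] [y Xy <-]; exists (a *: x + y); last exact: fL.
exact: XL.2.
Qed.
End LinearFun.

Lemma linear_setT (V : lmodType k) : linear_set [set: V].
Proof. by split. Qed.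

(** Among the subspaces contained in [W], one of maximal dimension is all of [W]. *)
Lemma linear_vspace (V : vectType k) (W : set V) : linear_set W ->
  exists U : {vspace V}, forall v, (v \in U) <-> W v.
Proof.
move=> WL.
pose P m := `[< exists2 U : {vspace V}, \dim U = m & forall v, v \in U -> W v >].
have P0 : exists m, P m.
  exists 0; apply/asboolP; exists 0%VS; first exact: dimv0.
  by move=> v; rewrite memv0 => /eqP->; apply: WL.1.
have Pn m : P m -> (m <= \dim {:V})%N.
  by move=> /asboolP[U <- _]; apply/dimvS/subvf.
case: (ex_maxnP P0 Pn) => m /asboolP[U dU WU] maxm.
exists U => v; split=> [/WU//|Wv].
apply: contraT => nv; suff /maxm : P m.+1 by rewrite ltnn.
apply/asboolP; exists (U + <[v]>)%VS.
  rewrite dimv_disjoint_sum; last first.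
    apply/eqP; rewrite -subv0; apply/subvP=> x; rewrite memv_cap memv0.
    case/andP=> xU /vlineP[a xE]; rewrite xE; have [->|a0] := eqVneq a 0.
      by rewrite scale0r.
    by case/negP: nv; rewrite -(scalerK a0 v) -xE memvZ.
  rewrite dU dim_vline; case: eqVneq nv => [->|_ _]; first by rewrite mem0v.
  by rewrite addn1.
move=> x /memv_addP[u uU [w /vlineP[a ->] ->]].
by rewrite addrC; apply: WL.2 => //; apply: WU.
Qed.

(** A map with kernel [W] becomes surjective when it is replaced by its coordinates
    in a basis of its image. *)
Lemma fin_codimI (A : topAlgType k) n (f : A -> 'rV[k]_n) (W : set A) :
  linear f -> W = [set x | f x = 0] -> fin_codim W.
Proof.
move=> fL WE.
have imL : linear_set (range f) by apply: linear_set_image.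
have [U UP] := linear_vspace imL.
pose g (x : A) := \row_i coord (vbasis U) i (f x).
have gE x : \sum_i g x 0 i *: (vbasis U)`_i = f x.
  have fU : f x \in U by apply/UP; exists x.
  rewrite [RHS](coord_vbasis fU); apply: eq_bigr => i _.
  by rewrite mxE.
exists (\dim U), g; split.
- by move=> a x y; apply/rowP => i; rewrite !mxE fL linearP.
- rewrite -subTset => r _.
  have : \sum_i r 0 i *: (vbasis U)`_i \in U.
    by apply: memv_suml => i _; apply/memvZ/vbasis_mem/mem_nth; rewrite size_tuple.
  move=> /UP[x _ fx]; exists x => //; apply/rowP => i; rewrite mxE fx.
  by rewrite coord_sum_free // (basis_free (vbasisP U)).
- rewrite WE; apply/seteqP; split=> x /= fx.
    by apply/rowP => i; rewrite !mxE fx linear0.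
  by rewrite -gE fx; apply: big1 => i _; rewrite mxE scale0r.
Qed.

Definition fin_span (V : lmodType k) (X W : set V) : Prop :=
  exists (T : finType) (v : T -> V), (forall t, X (v t)) /\
    forall x, X x -> exists c : T -> k, W (x - \sum_t c t *: v t).

(** The quotient by [W] is the space of coefficient vectors modulo those whose
    combination lies in [W]. *)
Lemma fin_span_codim (A : topAlgType k) (W : set A) :
  linear_set W -> fin_span setT W -> fin_codim W.
Proof.
move=> WL [T [v [_ span]]].
pose comb (c : 'rV[k]_#|T|) := \sum_t c 0 (enum_rank t) *: v t.
have combL : linear comb.
  move=> a c d; rewrite /comb scaler_sumr -big_split /=; apply: eq_bigr => t _.
  by rewrite !mxE scalerDl scalerA.
have NL : linear_set [set c | W (comb c)].
  split=> /= [|a c d Wc Wd]; last by rewrite combL; apply: WL.2.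
  by rewrite (lin_fun0 combL); apply: WL.1.
have [U UP] := linear_vspace NL.
have ex x : exists c : 'rV[k]_#|T|, W (x - comb c).
  have [c Wc] := span x Logic.I; exists (\row_i c (enum_val i)).
  by rewrite /comb; under eq_bigr do rewrite mxE enum_rankK.
pose c x := sval (cid (ex x)).
have cP x : W (x - comb (c x)) by rewrite /c; case: cid.
pose q (d : 'rV[k]_#|T|) : 'rV[k]_#|T| := d - projv U d.
have qL : linear q.
  by move=> a d e; rewrite /q linearP scalerBr opprD addrACA.
have q0 d : q d = 0 <-> W (comb d).
  split=> [/eqP|/UP dU]; last by rewrite /q projv_id ?subrr.
  by rewrite subr_eq0 => /eqP dE; apply/UP; rewrite dE memv_proj.
have qc : linear (fun x => q (c x)).
  move=> a x y; rewrite -qL; apply/eqP; rewrite -subr_eq0; apply/eqP.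
  rewrite -(lin_funB qL); apply/q0.
  rewrite (lin_funB combL) combL.
  apply: (linear_set_trans (y := a *: x + y) WL).
    exact/(linear_setBC WL)/cP.
  by rewrite opprD addrACA -scalerBr; apply: WL.2; apply: cP.
apply: (fin_codimI qc); apply/seteqP; split=> x /= Wx.
  by apply/q0; apply: (linear_set_congr WL) Wx; apply/(linear_setBC WL)/cP.
by move/q0: Wx; apply: (linear_set_congr WL).
Qed.

Section FinCodim.
Variables (A : topAlgType k) (W : set A).
Hypothesis finW : fin_codim W.

(** The rank of the image in a finite dimensional quotient measures the linear sets
    above [W]; it gives both chain conditions. *)
Lemma fin_codim_rank : exists (n : nat) (r : set A -> nat),
  forall X Y, linear_set X -> linear_set Y -> W `<=` X -> X `<=` Y ->
    [/\ (r X <= r Y)%N, (r Y <= n)%N & ((r Y <= r X)%N -> Y `<=` X)].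
Proof.
have [n [f [fL _ WE]]] := finW.
have ex X : exists U : {vspace 'rV[k]_n}, linear_set X -> forall v, (v \in U) <-> (f @` X) v.
  have [XL|nX] := pselect (linear_set X); last by exists 0%VS.
  by have [U UP] := linear_vspace (linear_set_image fL XL); exists U.
exists (\dim {: 'rV[k]_n}), (fun X => \dim (sval (cid (ex X)))) => X Y XL YL WX XY.
case: cid => U /= /(_ XL) UP; case: cid => U' /= /(_ YL) UP'.
have UU' : (U <= U')%VS.
  by apply/subvP => _ /UP[x /XY Yx <-]; apply/UP'; exists x.
split; [exact: dimvS|exact/dimvS/subvf|move=> d y Yy].
have EU : U = U' by apply/eqP; rewrite eqEdim UU'.
have /UP[x Xx fx] : f y \in U by rewrite EU; apply/UP'; exists y.
apply: (linear_set_congr XL) Xx; apply: WX; rewrite WE /=.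
by rewrite (lin_funB fL) fx subrr.
Qed.

Section Chains.
Variable P : set (set A).
Hypothesis PL : forall X, P X -> linear_set X /\ W `<=` X.
Hypothesis Pex : exists X, P X.

Lemma fin_codim_noetherian :
  exists2 X, P X & forall Y, P Y -> X `<=` Y -> Y = X.
Proof.
have [n [r rP]] := fin_codim_rank.
pose p m := `[< exists2 X, P X & r X = m >].
have p0 : exists m, p m.
  by have [X PX] := Pex; exists (r X); apply/asboolP; exists X.
have pn m : p m -> (m <= n)%N.
  by move=> /asboolP[X /PL[XL WX] <-]; have [] := rP X X XL XL WX (fun=> id).
case: (ex_maxnP p0 pn) => m /asboolP[X PX rX] maxm; exists X => // Y PY XY.
have [[XL WX] [YL WY]] := (PL PX, PL PY).
have [_ _ h] := rP X Y XL YL WX XY.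
apply/seteqP; split=> //; apply: h; rewrite rX; apply: maxm.
by apply/asboolP; exists Y.
Qed.

Lemma fin_codim_artinian :
  exists2 X, P X & forall Y, P Y -> Y `<=` X -> Y = X.
Proof.
have [n [r rP]] := fin_codim_rank.
pose p m := `[< exists2 X, P X & r X = m >].
have p0 : exists m, p m.
  by have [X PX] := Pex; exists (r X); apply/asboolP; exists X.
case: (ex_minnP p0) => m /asboolP[X PX rX] minm; exists X => // Y PY YX.
have [[XL WX] [YL WY]] := (PL PX, PL PY).
have [_ _ h] := rP Y X YL XL WY YX.
apply/seteqP; split=> //; apply: h; rewrite rX; apply: minm.
by apply/asboolP; exists Y.
Qed.
End Chains.

Lemma fin_codim_span (X : set A) : linear_set X -> fin_span X W.
Proof.
move=> XL; have [n [f [fL _ WE]]] := finW.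
have [U UP] := linear_vspace (linear_set_image fL XL).
have ex i : exists x, X x /\ f x = (vbasis U)`_(i : 'I_(\dim U)).
  have /UP[x Xx fx] : (vbasis U)`_i \in U.
    by apply/vbasis_mem/mem_nth; rewrite size_tuple.
  by exists x.
exists 'I_(\dim U), (fun i => sval (cid (ex i))); split.
  by move=> i; case: cid => x [].
move=> x Xx; exists (fun i => coord (vbasis U) i (f x)).
rewrite WE /= (lin_funB fL).
have fU : f x \in U by apply/UP; exists x.
rewrite {1}(coord_vbasis fU).
rewrite (lin_fun_sum fL); under [X in _ - X]eq_bigr do rewrite (lin_funZ fL).
by rewrite -sumrB big1 // => i _; case: cid => y /= [_ ->]; rewrite subrr.
Qed.

End FinCodim.
End LinearSets.

(** * Powers of the Jacobson radical *)

Section IdealMul.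
Variables (k : fieldType) (A : topAlgType k).
Implicit Types I J L : set A.

Lemma left_ideal_linear I : left_ideal I -> linear_set I.
Proof. by move=> lI; split; [case: lI | exact: left_idealP]. Qed.

Lemma ideal_linear I : ideal I -> linear_set I.
Proof. by case=> /left_ideal_linear. Qed.

Lemma mem_ideal_mul I J x y : I x -> J y -> ideal_mul I J (x * y).
Proof.
move=> Ix Jy; exists [:: (x, y)]; last by rewrite big_seq1.
by move=> p; rewrite inE => /eqP->.
Qed.

Lemma ideal_mul_sub I J L : linear_set L ->
  (forall x y, I x -> J y -> L (x * y)) -> ideal_mul I J `<=` L.
Proof.
move=> LL IJL _ [s sIJ ->]; rewrite big_seq.
by apply: (linear_set_sum LL) => p /sIJ[]; apply: IJL.
Qed.

Lemma ideal_mulS I I' J J' : I `<=` I' -> J `<=` J' ->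
  ideal_mul I J `<=` ideal_mul I' J'.
Proof.
by move=> II' JJ' _ [s sIJ ->]; exists s => // p /sIJ[/II'? /JJ'].
Qed.

Lemma left_ideal_setT : left_ideal [set: A].
Proof. by split. Qed.

Lemma ideal_setT : ideal [set: A].
Proof. by split => //; apply: left_ideal_setT. Qed.

Lemma ideal_mul_ideal I J : ideal I -> ideal J -> ideal (ideal_mul I J).
Proof.
move=> [lI _] [lJ Jr]; split; first exact: left_ideal_mul.
move=> a _ [s sIJ ->]; rewrite mulr_suml big_seq.
apply: (linear_set_sum (left_ideal_linear (left_ideal_mul J lI))) => p /sIJ[Ip Jp].
by rewrite -mulrA; apply: mem_ideal_mul => //; apply: Jr.
Qed.

(** Powers are taken without closure. That they are closed, and even open, is a
    theorem on the objects of PAlg. *)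
Definition jpow (n : nat) : set A := iter n (ideal_mul (jac A)) setT.

Lemma jpowS n : jpow n.+1 = ideal_mul (jac A) (jpow n).
Proof. by []. Qed.

End IdealMul.
Arguments jpow {k} A n : simpl never.

Section Pseudocompact.
Variables (k : fieldType) (A : palg k).
Implicit Types (I L X : set A) (x y : A).

Lemma palg_addc (a : A) : continuous (fun y : A => a + y).
Proof.
have [_ addc _ _ _] := palg_pc A.
move=> y; have := @continuous_comp _ _ _ (fun y : A => (a, y))
  (fun p : A * A => p.1 + p.2) y _ (addc (a, y)).
by apply; apply: cvg_pair; [exact: cvg_cst | exact: cvg_id].
Qed.

Lemma palg_nbhs_shift (a : A) (U : set A) : nbhs a U <-> nbhs 0 [set y | U (a + y)].
Proof.
have h (b c : A) V : nbhs (b + c) V -> nbhs c [set y | V (b + y)].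
  exact: (@palg_addc b c V).
split=> aU; first by apply: h; rewrite addr0.
have := h (- a) a [set y | U (a + y)]; rewrite addNr => /(_ aU) /=.
have -> : [set y | U (a + (- a + y))] = U; last by [].
by apply/funext => y /=; rewrite addrA subrr add0r.
Qed.

Lemma jac_ideal : ideal (jac A).
Proof.
split; first exact: left_ideal_jac.
have [T [chi [chiA _ -> _]]] := palg_pt A => a x /= Jx i.
by have [_ [_ chiM]] := chiA i; rewrite chiM Jx mul0r.
Qed.

Lemma jacM_l a x : jac A x -> jac A (a * x).
Proof. by have [[_ _ h] _] := jac_ideal; apply: h. Qed.
Lemma jacM_r a x : jac A x -> jac A (x * a).
Proof. by have [_ h] := jac_ideal; apply: h. Qed.

Lemma jac_linear : linear_set (jac A).
Proof. exact: ideal_linear jac_ideal. Qed.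

Lemma jpow_ideal n : ideal (jpow A n).
Proof.
elim: n => [|n IH]; first exact: ideal_setT.
by apply: ideal_mul_ideal => //; apply: jac_ideal.
Qed.

Lemma jpow_linear n : linear_set (jpow A n).
Proof. exact: ideal_linear (jpow_ideal n). Qed.

Lemma jpowM_l n a x : jpow A n x -> jpow A n (a * x).
Proof. by have [[_ _ h] _] := jpow_ideal n; apply: h. Qed.
Lemma jpowM_r n a x : jpow A n x -> jpow A n (x * a).
Proof. by have [_ h] := jpow_ideal n; apply: h. Qed.

Lemma jpow1 : jpow A 1 = jac A.
Proof.
apply/seteqP; split=> [|x Jx].
  by apply: ideal_mul_sub (jac_linear) _ => x y Jx _; apply: jacM_r.
by rewrite -[x]mulr1; apply: mem_ideal_mul.
Qed.

Lemma jpow2 : jpow A 2 = jac2 A.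
Proof. by rewrite jpowS jpow1. Qed.

Lemma jpowM m n x y : jpow A m x -> jpow A n y -> jpow A (m + n) (x * y).
Proof.
elim: m x => [|m IH] x; first by move=> _; apply: jpowM_l.
move=> [s sJ ->] Jy; rewrite mulr_suml big_seq.
apply: (linear_set_sum (jpow_linear _)) => p /sJ[J1 J2].
by rewrite -mulrA; apply: mem_ideal_mul => //; apply: IH.
Qed.

Lemma jpowS_sub n : jpow A n.+1 `<=` jpow A n.
Proof. by apply: ideal_mul_sub (jpow_linear n) _ => x y _; apply: jpowM_l. Qed.

Lemma jpow_dec m n : (m <= n)%N -> jpow A n `<=` jpow A m.
Proof.
move=> /subnK <-; elim: (n - m)%N => [|d IH] //.
by rewrite addSn; apply: subset_trans IH; apply: jpowS_sub.
Qed.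

Section OpenIdeal.
Variable I : set A.
Hypotheses (idI : ideal I) (openI : open I) (finI : fin_codim I).

Let IL := ideal_linear idI.

Lemma open_left_ideal L : left_ideal L -> I `<=` L -> open L.
Proof.
move=> /left_ideal_linear LL IL'; rewrite openE => x Lx.
apply/palg_nbhs_shift; apply: (@filterS _ _ _ I).
  by move=> y /IL' Ly; apply: linear_setD.
by apply: open_nbhs_nbhs; split=> //; apply: IL.1.
Qed.

(** If [1 + w] had no left inverse modulo [I], then [A (1 + w) + I] would lie in
    a maximal left ideal, which is open because it contains [I] and so contains
    [w], hence also [1]. *)
Lemma jac_left_inv w : jac A w -> exists a, I (a * (1 + w) - 1).
Proof.
move=> Jw; apply: contrapT => no_inv.
pose P L := [/\ left_ideal L, I `<=` L, L (1 + w) & ~ L 1].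
have PX : exists L, P L.
  exists [set x | exists a, I (a * (1 + w) - x)]; split.
  - split=> [|x y [a ax] [b bx]|b x [a ax]].
    + by exists 0; rewrite mul0r subrr; apply: IL.1.
    + by exists (a + b); rewrite mulrDl opprD addrACA; apply: linear_setD.
    + exists (b * a); rewrite -mulrA -mulrBr.
      by have [[_ _ h] _] := idI; apply: h.
  - by move=> x Ix; exists 0; rewrite mul0r sub0r; apply: linear_setN.
  - by exists 1; rewrite mul1r subrr; apply: IL.1.
  - exact: no_inv.
have [|L [lL sL L1w L1] maxL] := fin_codim_noetherian finI _ PX.
  by move=> L [/left_ideal_linear].
have LL := left_ideal_linear lL.
apply: (L1); rewrite -(addrK w 1); apply: linear_setB => //.
apply: Jw; split=> // [|M lM _ M1 sM]; first exact: open_left_ideal.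
by apply: maxL => //; split; [|apply: subset_trans sM|apply: sM|].
Qed.

(** A minimal left ideal [X] containing [I] on which no power of [J(A)] acts as
    zero modulo [I] has a maximal proper left subideal [Y] containing [I]; as
    [X / Y] is simple, [J(A) X] lies in [Y], contradicting minimality. *)
Lemma jpow_sub_open_ideal : exists n, jpow A n `<=` I.
Proof.
apply: contrapT => not_nil.
pose P X := [/\ left_ideal X, I `<=` X &
                forall n, ~ iter n (ideal_mul (jac A)) X `<=` I].
have PX : exists X, P X.
  by exists setT; split=> [||n sI] //; apply: not_nil; exists n.
have [|X [lX IX nX] minX] := fin_codim_artinian finI _ PX.
  by move=> X [/left_ideal_linear].
have XL := left_ideal_linear lX.
pose Q Y := [/\ left_ideal Y, I `<=` Y, Y `<=` X & ~ X `<=` Y].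
have QY : exists Y, Q Y by exists I; split=> //; [case: idI | exact: (nX 0)].
have [|Y [lY IY YX nXY] maxY] := fin_codim_noetherian finI _ QY.
  by move=> Y [/left_ideal_linear].
have YL := left_ideal_linear lY.
have JX : ideal_mul (jac A) X `<=` Y.
  apply: ideal_mul_sub => // j x Jj Xx; apply: contrapT => nY.
  (* By maximality of [Y], the left ideal [A j x + Y] is all of [X]. *)
  pose Z := [set z | exists a, Y (z - a * (j * x))].
  have QZ : ~ Q Z.
    move=> /maxY ZY; apply: nY; rewrite -ZY.
      by exists 1; rewrite mul1r subrr; apply: YL.1.
    by move=> y Yy; exists 0; rewrite mul0r subr0.
  have [a Za] : Z x.
    apply: contrapT => nZ; apply: QZ; split.
    - split=> [|y z [a ya] [b zb]|b y [a ya]].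
      + by exists 0; rewrite mul0r subrr; apply: YL.1.
      + by exists (a + b); rewrite mulrDl opprD addrACA; apply: linear_setD.
      + exists (b * a); rewrite -mulrA -mulrBr.
        by have [_ _ h] := lY; apply: h.
    - by move=> y Iy; exists 0; rewrite mul0r subr0; apply: IY.
    - move=> y [a ya]; apply: (linear_set_congr XL (YX _ ya)).
      by have [_ _ h] := lX; apply/h/h.
    - by move=> /(_ _ Xx).
  have [b Ib] := jac_left_inv (linear_setN jac_linear (jacM_l a Jj)).
  apply: nY; have [_ _ Yl] := lY; apply: (Yl).
  have Yb : Y (b * (1 - a * j) * x).
    by rewrite -mulrA mulrBl mul1r -mulrA; apply: Yl.
  apply: (linear_set_congr YL) Yb; rewrite -[X in X - _]mul1r -mulrBl.
  by apply: IY; have [_ h] := idI; apply/h/(linear_setBC IL).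
have nP : ~ P Y by move=> /minX YE; apply: nXY; rewrite YE.
apply: nP; split=> // n sI; apply: (nX n.+1).
rewrite iterSr; apply: subset_trans sI.
by elim: n {nX} => //= n IH; apply: ideal_mulS.
Qed.

End OpenIdeal.
End Pseudocompact.

(** * The topology of an object of PAlg is adic *)

Section Adic.
Variables (k : fieldType) (A : palg k).
Implicit Types (I U : set A) (x y : A).

Lemma jpow_tail (u : nat -> A) m n : (forall i, jpow A i (u i)) -> (m <= n)%N ->
  jpow A m (\sum_(i < n) u i - \sum_(i < m) u i).
Proof.
move=> Ju /subnKC <-; elim: (n - m)%N => [|d IH].
  by rewrite addn0 subrr; apply: (jpow_linear A m).1.
rewrite addnS big_ord_recr /= addrAC; apply: (linear_setD (jpow_linear A m) IH).
by apply: jpow_dec (Ju _); apply: leq_addr.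
Qed.

Section Basis.
Variable B : set (set A).
Hypothesis basisB : pseudocompact_basis B.

Let idB I : B I -> ideal I.
Proof. by have [h _ _ _] := basisB => /h[]. Qed.
Let linB I : B I -> linear_set I.
Proof. by move/idB/ideal_linear. Qed.

Lemma basis_jpow I : B I -> exists n, jpow A n `<=` I.
Proof.
by have [h _ _ _] := basisB => /h[idI oI fI]; apply: jpow_sub_open_ideal.
Qed.

Lemma basis_meet I I' : B I -> B I' -> exists2 I'', B I'' & I'' `<=` I `&` I'.
Proof.
move=> BI BI'; have [h nb _ _] := basisB; apply: nb.
have nI L : B L -> nbhs 0 L.
  by move=> BL; apply: open_nbhs_nbhs; split; [have [] := h _ BL | exact: (linB BL).1].
by apply: filterI; apply: nI.
Qed.

(** The class of [s] modulo [I] is that of any partial sum going up to an [n] with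
    [J^n(A)] inside [I]. *)
Lemma basis_complete (u : nat -> A) : (forall n, jpow A n (u n)) ->
  exists s, forall I, B I -> exists N, forall n, (N <= n)%N -> I (s - \sum_(i < n) u i).
Proof.
move=> Ju.
have /choice[N NP] : forall I, exists n, B I -> jpow A n `<=` I.
  move=> I; have [BI|nB] := pselect (B I); last by exists 0.
  by have [n JI] := basis_jpow BI; exists n.
have [_ _ _ complB] := basisB.
have [I I' BI BI' II'|s sP] := complB (fun I => \sum_(i < N I) u i).
  have [le|/ltnW le] := leqP (N I') (N I).
    by apply: (NP _ BI'); apply: jpow_tail.
  apply: (linear_setBC (linB BI')); apply: II'; apply: (NP _ BI).
  exact: jpow_tail.
exists s => I BI; exists (N I) => n le.
apply: (linear_set_trans (linB BI) (sP _ BI)).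
by apply/(linear_setBC (linB BI))/(NP _ BI)/jpow_tail.
Qed.

(** The closure of [J^n(A)]. *)
Let K n : set A := [set y | forall I, B I -> exists2 z, jpow A n z & I (y - z)].

(** In a product [j * b] with [j] in [J(A)] and [b] in [J^n(A)], only the class of
    [j] in the finite dimensional space [J(A) / J^2(A)] matters modulo
    [J^(n+2)(A)]. *)
Lemma jpow_gens : exists (T : finType) (v : T -> A), (forall t, jac A (v t)) /\
  forall n x, jpow A n.+1 x -> exists c : T -> A, (forall t, jpow A n (c t)) /\
    jpow A n.+2 (x - \sum_t v t * c t).
Proof.
have [T [v [Jv span]]] := fin_codim_span (palg_fin A) (jac_linear A).
exists T, v; split=> // n.
apply: ideal_mul_sub => [|j b Jj Jb].
  split=> [|a x y [c [Jc xc]] [d [Jd yd]]].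
    exists (fun=> 0); split; first by move=> _; apply: (jpow_linear A n).1.
    by rewrite big1 ?subrr => [|t _]; [apply: (jpow_linear A n.+2).1 | rewrite mulr0].
  exists (fun t => a *: c t + d t); split; first by move=> t; apply: (jpow_linear A n).2.
  have -> : a *: x + y - \sum_t v t * (a *: c t + d t) =
            a *: (x - \sum_t v t * c t) + (y - \sum_t v t * d t).
    under eq_bigr do rewrite mulrDr -talg_scalerAr.
    by rewrite big_split /= -scaler_sumr scalerBr opprD addrACA.
  exact: (jpow_linear A n.+2).2.
have [c cP] := span j Jj; exists (fun t => c t *: b); split.
  by move=> t; apply: (linear_setZ (jpow_linear A n)).
have -> : \sum_t v t * (c t *: b) = (\sum_t c t *: v t) * b.
  rewrite mulr_suml; apply: eq_bigr => t _.
  by rewrite -talg_scalerAr talg_scalerAl.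
rewrite -mulrBl -[n.+2]/(2 + n)%N; apply: jpowM Jb.
by rewrite jpow2.
Qed.

Lemma jpow_span n : fin_span setT (jpow A n).
Proof.
case: n => [|n].
  by exists 'I_0, (fun=> 0); split=> // x _; exists (fun=> 0).
elim: n => [|n [S [w [_ wspan]]]].
  have [T [v [_ span]]] := fin_codim_span (palg_fin A) (linear_setT A).
  exists T, v; split=> // x /span[c Jc]; exists c.
  by apply: jpow_dec (isT : (1 <= 2)%N) _ _; rewrite jpow2.
have [T [v [Jv vspan]]] := jpow_gens.
exists (S + T * S)%type, (fun p => match p with inl s => w s | inr (t, s) => v t * w s end).
split=> // x _; have [c /vspan[d [Jd xd]]] := wspan x Logic.I.
have /choice[e eP] t : exists e : S -> k, jpow A n.+1 (d t - \sum_s e s *: w s).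
  exact: wspan.
exists (fun p => match p with inl s => c s | inr (t, s) => e t s end).
rewrite big_sumType /= opprD addrA.
apply: (linear_set_trans (jpow_linear _ _) xd).
rewrite (eq_bigr (fun p => v p.1 * (e p.1 p.2 *: w p.2))) => [|[t s] _ /=]; last first.
  by rewrite talg_scalerAr.
rewrite -(pair_bigA _ (fun t s => v t * (e t s *: w s))) /= -sumrB.
apply: (linear_set_sum (jpow_linear _ _)) => t _.
rewrite -mulr_sumr -mulrBr -[n.+2]/(1 + n.+1)%N; apply: jpowM (eP t).
by rewrite jpow1.
Qed.

Lemma jpow_fin_codim n : fin_codim (jpow A n).
Proof. exact: fin_span_codim (jpow_linear A n) (jpow_span n). Qed.

Let linK n : linear_set (K n).
Proof.
split=> [I BI|a x y Kx Ky I BI].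
  by exists 0; rewrite ?subrr; [apply: (jpow_linear A n).1 | apply: (linB BI).1].
have [[z Jz Iz] [t Jt It]] := (Kx I BI, Ky I BI).
exists (a *: z + t); first exact: (jpow_linear A n).2.
by rewrite opprD addrACA -scalerBr; apply: (linB BI).2.
Qed.

Let subK n : jpow A n `<=` K n.
Proof. by move=> x Jx I BI; exists x; rewrite ?subrr //; apply: (linB BI).1. Qed.

(** As [J^n(A)] has finite codimension, the descending family of the
    [J^n(A) + I] has a least member. *)
Let openK n : exists2 I, B I & I `<=` K n.
Proof.
pose sum I := [set y | exists2 z, jpow A n z & I (y - z)].
have linsum I : B I -> linear_set (sum I).
  move=> BI; split=> [|a x y [z Jz Iz] [t Jt It]].
    by exists 0; rewrite ?subrr; [apply: (jpow_linear A n).1 | apply: (linB BI).1].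
  exists (a *: z + t); first exact: (jpow_linear A n).2.
  by rewrite opprD addrACA -scalerBr; apply: (linB BI).2.
have [||X [I BI XE] minX] := @fin_codim_artinian _ _ _ (jpow_fin_codim n)
    (fun X => exists2 I, B I & X = sum I).
- move=> _ [I BI ->]; split; first exact: linsum.
  by move=> x Jx; exists x; rewrite ?subrr //; apply: (linB BI).1.
- have [_ nb _ _] := basisB; have [I BI _] := nb setT filterT.
  by exists (sum I), I.
exists I => // x Ix I' BI'; have [I'' BI'' sI''] := basis_meet BI BI'.
have EX : sum I'' = X.
  apply: minX; first by exists I''.
  by rewrite XE => y [z Jz Iz]; exists z => //; have [] := sI'' _ Iz.
have : sum I'' x.
  rewrite EX XE; exists 0; first exact: (jpow_linear A n).1.
  by rewrite subr0.
by move=> [z Jz Iz]; exists z => //; have [] := sI'' _ Iz.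
Qed.

Let K_jpow n x : K n x -> exists2 z, jpow A n z & K n.+1 (x - z).
Proof.
have [I BI sI] := openK n.+1.
by move=> /(_ I BI)[z Jz Iz]; exists z => //; apply: sI.
Qed.

(** Approximate [y] in the closure of [J^(n+1)(A)] by [\sum_t v t * c t] with [c t]
    in [J^n(A)], then the error in the same way, and so on. By completeness the
    coefficients found for each generator [v t] add up to some [s t], and
    [y = \sum_t v t * s t] exactly. *)
Lemma jpow_closed n : K n `<=` jpow A n.
Proof.
elim: n => [//|n IH] y Ky; have [T [v [Jv vP]]] := jpow_gens.
have step m x : exists c : T -> A, K m.+1 x ->
    (forall t, jpow A m (c t)) /\ K m.+2 (x - \sum_t v t * c t).
  have [Kx|nK] := pselect (K m.+1 x); last by exists (fun=> 0).
  have [z Jz Kz] := K_jpow Kx; have [c [Jc zc]] := vP m z Jz.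
  exists c => _; split=> //; apply: (linear_set_trans (linK _) Kz).
  exact: subK.
have [f fP] : {f : nat -> A -> T -> A | forall m x, K m.+1 x ->
    (forall t, jpow A m (f m x t)) /\ K m.+2 (x - \sum_t v t * f m x t)}.
  exists (fun m x => sval (cid (step m x))) => m x Kx.
  by case: cid => c /= /(_ Kx).
(* [ys i] is the error after [i] approximations. *)
pose ys := fix ys i := if i is j.+1 then ys j - \sum_t v t * f (n + j)%N (ys j) t else y.
have ysP i : K (n + i).+1 (ys i).
  elim: i => [|i IHi] /=; first by rewrite addn0.
  by rewrite addnS; have [_] := fP _ _ IHi.
pose u t i := f (n + i)%N (ys i) t.
have Ju t i : jpow A (n + i) (u t i) by have [+ _] := fP _ _ (ysP i); apply.
have yE N : ys N = y - \sum_t v t * \sum_(i < N) u t i.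
  elim: N => [|N IHN].
    by rewrite big1 ?subr0 // => t _; rewrite big_ord0 mulr0.
  rewrite [LHS]/= {1}IHN -addrA -opprD -big_split /=; congr (_ - _).
  by apply: eq_bigr => t _; rewrite big_ord_recr mulrDr.
have /choice[s sP] t : exists s, forall I, B I -> exists N, forall m, (N <= m)%N ->
    I (s - \sum_(i < m) u t i).
  by apply: basis_complete => i; apply: jpow_dec (Ju t i); apply: leq_addl.
have Ks t : jpow A n (s t).
  apply: IH => I BI; have [N NP] := sP t I BI.
  exists (\sum_(i < N) u t i); last exact: NP.
  apply: (linear_set_sum (jpow_linear A n)) => i _.
  by apply: jpow_dec (Ju t i); apply: leq_addr.
have -> : y = \sum_t v t * s t.
  apply/eqP; rewrite -subr_eq0; apply/eqP.
  have [_ _ sep _] := basisB; suff : (\bigcap_(I in B) I) (y - \sum_t v t * s t) by rewrite sep.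
  move=> I BI; have [M MI] := basis_jpow BI.
  have /choice[N NP] := fun t => sP t I BI.
  pose L := maxn M (\max_t N t).
  apply: (linear_set_trans (linB BI) (y := \sum_t v t * \sum_(i < L) u t i)).
    rewrite -yE; have [z Jz Iz] := ysP L I BI.
    apply: (linear_set_congr (linB BI) Iz); apply: MI; apply: jpow_dec Jz.
    by rewrite -addnS (leq_trans (leq_maxl M (\max_t N t))) // addnS ltnW // ltnS leq_addl.
  rewrite -sumrB; apply: (linear_set_sum (linB BI)) => t _.
  rewrite -mulrBr; have [[_ _ h] _] := idB BI; apply: h.
  apply: (linear_setBC (linB BI)); apply: NP.
  by rewrite (leq_trans _ (leq_maxr _ _)) // (leq_bigmax t).
by apply: (linear_set_sum (jpow_linear A n.+1)) => t _; rewrite jpowS; apply: mem_ideal_mul.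
Qed.

Lemma basis_sub_jpow n : exists2 I, B I & I `<=` jpow A n.
Proof.
by have [I BI sI] := openK n; exists I => //; apply: subset_trans sI (@jpow_closed n).
Qed.

End Basis.

Let basis : exists B, pseudocompact_basis (A := A) B.
Proof. by have [] := palg_pc A. Qed.

(** The powers of [J(A)] are open because they are closed of finite codimension, and
    every open ideal contains one of them. So the topology is the adic one. *)
Lemma jpow_nbhs x U : nbhs x U <-> exists n, forall y, jpow A n y -> U (x + y).
Proof.
have [B bB] := basis; have [hB nb _ _] := bB.
rewrite palg_nbhs_shift; split=> [/nb[I BI sI]|[n nU]].
  by have [n sn] := basis_jpow bB BI; exists n => y /sn/sI.
have [I BI sI] := basis_sub_jpow bB n.
apply: (@filterS _ _ _ I) => [y /sI/nU//|].
have [iI oI _] := hB _ BI; apply: open_nbhs_nbhs; split=> //.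
exact: (ideal_linear iI).1.
Qed.

Lemma jpow_sep x : (forall n, jpow A n x) -> x = 0.
Proof.
move=> Jx; have [B bB] := basis; have [_ _ sep _] := bB.
suff : (\bigcap_(I in B) I) x by rewrite sep.
by move=> I BI; have [n] := basis_jpow bB BI; apply.
Qed.

Lemma jpow_sep_eq x y : (forall n, jpow A n (x - y)) -> x = y.
Proof. by move=> /jpow_sep/eqP; rewrite subr_eq0 => /eqP. Qed.

Lemma jpow_complete (u : nat -> A) : (forall n, jpow A n (u n)) ->
  exists s, forall n, jpow A n (s - \sum_(i < n) u i).
Proof.
move=> Ju; have [B bB] := basis; have [s sP] := basis_complete bB Ju.
exists s => n; have [I BI sI] := basis_sub_jpow bB n.
have [N NP] := sP I BI.
apply: (linear_set_trans (jpow_linear A n) (y := \sum_(i < maxn N n) u i)).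
  by apply/sI/NP/leq_maxl.
exact/jpow_tail/leq_maxr.
Qed.

End Adic.

(** * Units and idempotents *)

Section Units.
Variables (k : fieldType) (A : palg k).
Implicit Types (x y a b e g w u : A).

Lemma jacX w n : jac A w -> jpow A n (w ^+ n).
Proof.
move=> Jw; elim: n => [|n IH]; first by [].
by rewrite exprS jpowS; apply: mem_ideal_mul.
Qed.

(** The inverse is the sum of the geometric series. *)
Lemma jac_right_inv w : jac A w -> exists u, (1 + w) * u = 1 /\ jac A (u - 1).
Proof.
move=> Jw; have JNw := linear_setN (jac_linear A) Jw.
have [s sP] := jpow_complete (fun n => jacX n JNw).
exists s; split; last by have := sP 1%N; rewrite big_ord1 expr0 jpow1.
apply: jpow_sep_eq => n; rewrite -[s](subrK (\sum_(i < n) (- w) ^+ i)) mulrDr.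
rewrite -addrA; apply: (linear_setD (jpow_linear A n)).
  by apply: jpowM_l; apply: sP.
have -> : (1 + w) * \sum_(i < n) (- w) ^+ i = 1 - (- w) ^+ n.
  rewrite -[RHS]opprB subrX1 -mulNr; congr (_ * _).
  by rewrite opprB opprK.
by rewrite addrAC subrr add0r; apply/(linear_setN (jpow_linear A n))/jacX.
Qed.

Lemma jac_unit w : jac A w -> exists u, [/\ (1 + w) * u = 1, u * (1 + w) = 1 & jac A (u - 1)].
Proof.
move=> Jw; have [u [wu Ju]] := jac_right_inv Jw.
have [v [uv _]] := jac_right_inv Ju; rewrite addrCA subrr addr0 in uv.
have wv : 1 + w = v by rewrite -[LHS]mulr1 -{2}uv mulrA wu mul1r.
by exists u; split=> //; rewrite wv.
Qed.

Lemma jac_idem0 g : jac A g -> g * g = g -> g = 0.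
Proof.
move=> Jg gg; have [u [gu _ _]] := jac_unit (linear_setN (jac_linear A) Jg).
by rewrite -[g]mulr1 -gu mulrA mulrBr mulr1 gg subrr mul0r.
Qed.

(** Newton's iteration for the equation [x^2 = x]: with [b = x^2 - x], the step
    [x + b (1 - 2 x)] replaces [b] by a multiple of [b^2]. All iterates are polynomials
    in [a] without constant term, so a one-sided identity of [a] is one of the limit. *)
Lemma idem_lift a : jac A (a * a - a) -> exists g, [/\ g * g = g, jac A (g - a),
  forall f, f * a = a -> f * g = g & forall f, a * f = a -> g * f = g].
Proof.
move=> Ja; have JL := jpow_linear A.
pose next x := x + (x * x - x) * (1 - x - x).
pose s n := iter n next a.
have nextP x n : jpow A n.+1 (x * x - x) -> jpow A n.+2 (next x * next x - next x).
  rewrite /next; set b := x * x - x => Jb; set c := 1 - x - x.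
  have bx : b * x = x * b by rewrite /b mulrBl mulrBr mulrA.
  have xx : x * x = x + b by rewrite /b addrC subrK.
  clearbody b; have bc : b * c = c * b by rewrite /c !mulrBr !mulrBl mulr1 mul1r bx.
  have xc : x * c = c * x by rewrite /c !mulrBr !mulrBl mulr1 mul1r.
  have xcE : x * c = - (x + b + b).
    by rewrite /c !mulrBr mulr1 xx opprD !addrA subrr sub0r -!opprD (addrC b).
  have cc : 1 - c * c = - (b + b + (b + b)).
    rewrite {1}/c !mulrBl mul1r xcE !opprK {1}/c.
    have add t : 1 - x - x + (x + t) + (x + t) = 1 + (t + t).
      by rewrite !addrA subrK -(addrA (1 - x)) (addrC t) !addrA subrK.
    rewrite -(addrA x) add.
    by rewrite opprD addrA subrr sub0r.
  have cE : c * c = c - x * c - x * c by rewrite {1}/c !mulrBl mul1r.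
  (* As [x], [b] and [c] commute, the new value of [b] is [b (1 - c^2) + b^2 c^2], and
     [1 - c^2] is a multiple of [b]. *)
  clearbody c; have -> : (x + b * c) * (x + b * c) - (x + b * c) = b * (1 - c * c) + b * b * (c * c).
    have xbc : x * (b * c) = b * (x * c) by rewrite mulrA -bx -mulrA.
    have bcx : b * c * x = b * (x * c) by rewrite -mulrA -xc.
    have bcbc : b * c * (b * c) = b * b * (c * c).
      by rewrite -mulrA [c * (b * c)]mulrA -bc !mulrA.
    rewrite mulrDl !(mulrDr _ x (b * c)) xx xbc bcx bcbc.
    rewrite (mulrBr b) mulr1 {2}cE !(mulrBr b).
    move: (b * (x * c)) (b * b * (c * c)) (b * c) => y z t.
    have -> : b - (t - y - y) + z = b + y + y + z - t.
      by rewrite !opprB !addrA [LHS]addrAC; congr (_ + _); rewrite -!addrA (addrC _ b) ?addrA.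
    rewrite opprD !addrA; congr (_ - t).
    by rewrite addrC -!addrA addKr.
  rewrite cc mulrN !mulrDr; have Jbb : jpow A n.+2 (b * b).
    by apply: jpow_dec (jpowM Jb Jb); rewrite addnS ltnS leq_addr.
  apply: (linear_setD (JL _)); last by apply: jpowM_r.
  by apply: (linear_setN (JL _)); do !apply: (linear_setD (JL _)).
have sP n : jpow A n.+1 (s n * s n - s n).
  by elim: n => [|n IH]; [rewrite jpow1 | apply: nextP].
have uP n : jpow A n.+1 (s n.+1 - s n).
  by rewrite /s /= /next -/(s n) addrAC subrr add0r; apply/jpowM_r/sP.
have [t tP] := jpow_complete (fun n => jpowS_sub (uP n)).
pose g := a + t.
have gP n : jpow A n (g - s n).
  have -> : g - s n = t - \sum_(i < n) (s i.+1 - s i).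
    rewrite -(big_mkord xpredT (fun i => s i.+1 - s i)) telescope_sumr //.
    by rewrite opprB addrA /g (addrC a).
  exact: tP.
exists g; split.
- apply: jpow_sep_eq => n.
  have -> : g * g - g = g * (g - s n) + (g - s n) * s n + (s n * s n - s n) - (g - s n).
    by rewrite mulrBr mulrBl opprB !addrA !subrK.
  apply: (linear_setB (JL n)) => //; apply: (linear_setD (JL n)); last exact/jpowS_sub/sP.
  by apply: (linear_setD (JL n)); [apply: jpowM_l | apply: jpowM_r].
- apply: (linear_set_trans (jac_linear A) (y := s 1%N)); first by rewrite -jpow1.
  by rewrite -jpow1; apply: (uP 0%N).
- move=> f fa; have fs n : f * s n = s n.
    elim: n => [//|n IH]; rewrite /s /= /next -/(s n) mulrDr IH mulrA.
    by rewrite (mulrBr f) mulrA IH.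
  apply: jpow_sep_eq => n; rewrite -[g in f * g](subrK (s n)) mulrDr fs -addrA.
  apply: (linear_setD (JL n)); first exact: jpowM_l.
  exact: (linear_setBC (JL n)).
- move=> f af; have sf n : s n * f = s n.
    elim: n => [//|n IH]; rewrite /s /= /next -/(s n) mulrDl IH.
    rewrite [X in _ + X](_ : _ = (s n * s n - s n) * (1 - s n - s n)) //.
    have comm : (s n * s n - s n) * (1 - s n - s n) = (1 - s n - s n) * (s n * s n - s n).
      have bs : (s n * s n - s n) * s n = s n * (s n * s n - s n).
        by rewrite mulrBl mulrBr mulrA.
      move: (s n * s n - s n) bs => b bs.
      by rewrite !mulrBr !mulrBl mulr1 mul1r bs.
    by rewrite comm -mulrA (mulrBl f) -mulrA IH.
  apply: jpow_sep_eq => n; rewrite -[g in g * f](subrK (s n)) mulrDl sf -addrA.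
  apply: (linear_setD (JL n)); first exact: jpowM_r.
  exact: (linear_setBC (JL n)).
Qed.

Definition orth_idems (V : finType) (e : V -> A) : Prop :=
  (forall v v', e v * e v' = e v *+ (v == v')) /\ \sum_v e v = 1.

Lemma orth_idemsM (V : finType) (e : V -> A) v : orth_idems e -> e v * e v = e v.
Proof. by case=> eM _; rewrite eM eqxx. Qed.

Lemma orth_idems_corner (V : finType) (e : V -> A) v v' x : orth_idems e ->
  e v' * (e v' * x * e v) * e v = e v' * x * e v.
Proof. by move=> eO; rewrite !mulrA orth_idemsM // -!mulrA orth_idemsM. Qed.

Lemma orth_idems_decomp (V : finType) (e : V -> A) x : orth_idems e ->
  x = \sum_v \sum_v' e v' * x * e v.
Proof.
move=> [_ e1]; rewrite -[x in LHS]mulr1 -e1 mulr_sumr; apply: eq_bigr => v _.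
by rewrite -[x in LHS]mul1r -e1 !mulr_suml.
Qed.

(** The element [\sum_v e' v * e v] intertwines the two families, and it is a unit
    because it is congruent to [\sum_v e' v * e' v = 1] modulo [J(A)]. *)
Lemma orth_idems_conj (V : finType) (e e' : V -> A) :
  orth_idems e -> orth_idems e' -> (forall v, jac A (e v - e' v)) ->
  exists w u, [/\ jac A w, (1 + w) * u = 1, u * (1 + w) = 1 &
    forall v, e' v = (1 + w) * e v * u].
Proof.
move=> [eM e1] [eM' e1'] Jee'.
pose w := \sum_v e' v * e v - 1.
have Jw : jac A w.
  rewrite /w -[X in _ - X]e1' -sumrB; apply: (linear_set_sum (jac_linear A)) => v _.
  rewrite -[X in _ - X](_ : e' v * e' v = _); last by rewrite eM' eqxx.
  by rewrite -mulrBr; apply: jacM_l.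
have wE : 1 + w = \sum_v e' v * e v by rewrite /w addrC subrK.
have [u [wu uw _]] := jac_unit Jw; exists w, u; split=> // v.
have -> : (1 + w) * e v = e' v * (1 + w).
  rewrite wE mulr_suml mulr_sumr (bigD1 v) //= [RHS](bigD1 v) //=.
  rewrite -mulrA eM mulrA eM' !eqxx !big1 ?addr0 // => x /negbTE xv.
    by rewrite mulrA eM' eq_sym xv mul0r.
  by rewrite -mulrA eM xv mulr0.
by rewrite -mulrA wu mulr1.
Qed.

End Units.

(** * Morphisms and similarity *)

Section Morphisms.
Variables (k : fieldType) (A B : palg k) (f : A -> B).
Hypothesis fA : alg_hom f.

Section Jac.
Hypothesis fJ : forall a, jac A a -> jac B (f a).

Lemma alg_hom_jpow n a : jpow A n a -> jpow B n (f a).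
Proof.
elim: n a => [//|n IH] _ [s sJ ->]; rewrite (alg_hom_sum fA) big_seq.
apply: (linear_set_sum (jpow_linear B n.+1)) => p /sJ[J1 J2].
by rewrite (alg_homM fA) jpowS; apply: mem_ideal_mul; [apply: fJ|apply: IH].
Qed.

Lemma alg_hom_continuous : continuous f.
Proof.
move=> x U /= /jpow_nbhs[n nU]; apply/jpow_nbhs; exists n => y Jy /=.
by rewrite (alg_homD fA); apply/nU/alg_hom_jpow.
Qed.

(** Successive approximation: the two hypotheses give, for products of elements of
    [J(B)], preimages modulo the next power, and the corrections form a convergent
    series. *)
Lemma jpow_onto :
  (forall b, exists a, jac B (b - f a)) ->
  (forall b, jac B b -> exists2 a, jac A a & jac2 B (b - f a)) ->
  forall n b, jpow B n b -> exists2 a, jpow A n a & f a = b.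
Proof.
move=> onto0 onto1.
have step n b : jpow B n b -> exists2 a, jpow A n a & jpow B n.+1 (b - f a).
  elim: n b => [|n IH] b.
    by move=> _; have [a Ja] := onto0 b; exists a; rewrite // jpow1.
  move: b; apply: ideal_mul_sub => [|j b Jj Jb].
    split=> [|c x y [a Ja xa] [d Jd yd]].
      by exists 0; rewrite ?(alg_hom0 fA) ?subrr; apply: (jpow_linear _ _).1.
    exists (c *: a + d); first exact: (jpow_linear _ _).2.
    by rewrite fA.1 opprD addrACA -scalerBr; apply: (jpow_linear _ _).2.
  have [a Ja ja] := onto1 j Jj; have [d Jd bd] := IH b Jb.
  exists (a * d); first by rewrite jpowS; apply: mem_ideal_mul.
  rewrite (alg_homM fA) -[X in X - _](subrK (f a * b)) -addrA -mulrBl -mulrBr.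
  apply: (linear_setD (jpow_linear _ _)).
    by rewrite -[n.+2]/(2 + n)%N; apply: jpowM => //; rewrite jpow2.
  by rewrite jpowS; apply: mem_ideal_mul => //; apply: fJ.
move=> n b Jb.
have [g gP] : {g : nat -> B -> A | forall m y, jpow B m y ->
    jpow A m (g m y) /\ jpow B m.+1 (y - f (g m y))}.
  have ex m y : exists a, jpow B m y -> jpow A m a /\ jpow B m.+1 (y - f a).
    have [Jy|nJ] := pselect (jpow B m y); last by exists 0.
    by have [a Ja ya] := step m y Jy; exists a.
  by exists (fun m y => sval (cid (ex m y))) => m y; case: cid.
pose ys := fix ys i := if i is j.+1 then ys j - f (g (n + j)%N (ys j)) else b.
have ysP i : jpow B (n + i) (ys i).
  elim: i => [|i IHi] /=; first by rewrite addn0.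
  by rewrite addnS; have [] := gP _ _ IHi.
pose u i := g (n + i)%N (ys i).
have Ju i : jpow A (n + i) (u i) by have [] := gP _ _ (ysP i).
have yE N : ys N = b - f (\sum_(i < N) u i).
  elim: N => [|N IHN]; first by rewrite big_ord0 (alg_hom0 fA) subr0.
  rewrite big_ord_recr (alg_homD fA) opprD addrA -IHN //.
have [s sP] : exists s, forall m, jpow A m (s - \sum_(i < m) u i).
  by apply: jpow_complete => i; apply: jpow_dec (Ju i); apply: leq_addl.
exists s.
  apply: (linear_set_congr (jpow_linear A n) (sP n)).
  apply: (linear_set_sum (jpow_linear A n)) => i _.
  by apply: jpow_dec (Ju i); apply: leq_addr.
apply: jpow_sep_eq => m; apply: (linear_setBC (jpow_linear B m)).
rewrite -[b](subrK (f (\sum_(i < m) u i))) -yE -addrA -(alg_homB fA).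
apply: (linear_setD (jpow_linear B m)).
  by apply: jpow_dec (ysP m); apply: leq_addl.
apply: alg_hom_jpow; exact/(linear_setBC (jpow_linear A m)).
Qed.

End Jac.

Lemma palg_morphI : (forall a, jac A a -> jac B (f a)) ->
  (forall b, exists a, jac B (f a - b)) -> palg_morph f.
Proof. by move=> fJ fs; split=> //; apply: alg_hom_continuous. Qed.

End Morphisms.

Lemma palg_morphJ (k : fieldType) (A B : palg k) (f : A -> B) : palg_morph f ->
  forall a, jac A a -> jac B (f a).
Proof. by case=> fA fc _; apply: palg_morph_jac. Qed.

Lemma palg_morphJ2 (k : fieldType) (A B : palg k) (f : A -> B) : palg_morph f ->
  forall a, jac2 A a -> jac2 B (f a).
Proof. by case=> fA fc _; apply: palg_morph_jac2. Qed.

Section Jac2.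
Variables (k : fieldType) (A : palg k).

Lemma jac2_linear : linear_set (jac2 A).
Proof. exact: left_ideal_linear (left_ideal_jac2 A). Qed.

Lemma jac2_jac : jac2 A `<=` jac A.
Proof. by move=> b; rewrite -jpow2 -jpow1; apply: jpowS_sub. Qed.

(** Corners of [J(A) / J^2(A)] only depend on the idempotents modulo [J(A)]. *)
Lemma jac2_sandwich (a a' y b b' : A) : jac A (a - a') -> jac A (b - b') -> jac A y ->
  jac2 A (a * y * b - a' * y * b').
Proof.
move=> Ja Jb Jy.
have -> : a * y * b - a' * y * b' = (a - a') * y * b + a' * (y * (b - b')).
  by rewrite !mulrBl !mulrBr !mulrA addrA subrK.
apply: (linear_setD jac2_linear).
  by rewrite -mulrA; apply: mem_ideal_mul => //; apply: jacM_r.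
have [_ _ Jl] := left_ideal_jac2 A; apply: Jl; exact: mem_ideal_mul.
Qed.
End Jac2.

Section Sim1.
Variables (k : fieldType).

Lemma sim1_refl (A B : palg k) (f : A -> B) : sim1 f f.
Proof. by have [h _ _] := sim1_equiv A B; apply: h. Qed.
Lemma sim1_sym (A B : palg k) (f g : A -> B) : sim1 f g -> sim1 g f.
Proof. by have [_ h _] := sim1_equiv A B; apply: h. Qed.
Lemma sim1_trans (A B : palg k) (f g h : A -> B) : sim1 f g -> sim1 g h -> sim1 f h.
Proof. by have [_ _ t] := sim1_equiv A B; apply: t. Qed.

Lemma sim1_compl (A B C : palg k) (g : B -> C) (f f' : A -> B) :
  palg_morph g -> sim1 f f' -> sim1 (g \o f) (g \o f').
Proof.
move=> gm [f1 f2]; have gA := pm_alg gm.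
split=> a => [|Ja] /=; rewrite -(alg_homB gA).
  exact: palg_morphJ.
by apply: palg_morphJ2 => //; apply: f2.
Qed.

Lemma sim1_compr (A B C : palg k) (g g' : B -> C) (f : A -> B) :
  palg_morph f -> sim1 g g' -> sim1 (g \o f) (g' \o f).
Proof.
move=> fm [g1 g2]; split=> a => [|Ja] /=; first exact: g1.
exact: g2 (palg_morphJ fm Ja).
Qed.

Lemma sim1_jac (A B : palg k) (f g : A -> B) : sim1 f g ->
  (forall a, jac A a -> jac B (g a)) -> forall a, jac A a -> jac B (f a).
Proof.
by move=> [fg _] gJ a Ja; apply: (linear_set_congr (jac_linear B) (fg a)); apply: gJ.
Qed.

Lemma sim1_morph (A B : palg k) (f g : A -> B) : alg_hom f -> sim1 f g ->
  palg_morph g -> palg_morph f.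
Proof.
move=> fA fg gm; apply: palg_morphI => //.
  by apply: (sim1_jac fg); apply: palg_morphJ.
move=> b; have [a ab] := pm_surj gm b; exists a.
by apply: (linear_set_trans (jac_linear B) (fg.1 a)).
Qed.

(** Such a [d] acts trivially on the quotients of the adic filtration: this is
    assumed on the first two, and the others are generated by them. *)
Lemma sim1_id_bij (A : palg k) (d : A -> A) : alg_hom d -> sim1 d id ->
  exists d', [/\ cancel d d', cancel d' d, palg_morph d' & sim1 d' id].
Proof.
move=> dA d1; have [dJ0 dJ1] := d1; have JL := jac_linear A.
have dm : palg_morph d := sim1_morph dA d1 (palg_morph_id A).
have dn n a : jpow A n a -> jpow A n.+1 (d a - a).
  elim: n a => [|n IH] a; first by move=> _; rewrite jpow1.
  move: a; apply: ideal_mul_sub => [|j b Jj Jb].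
    split=> [|c x y dx dy].
      by rewrite (alg_hom0 dA) subrr; apply: (jpow_linear _ _).1.
    by rewrite dA.1 opprD addrACA -scalerBr; apply: (jpow_linear _ _).2.
  have -> : d (j * b) - j * b = (d j - j) * d b + j * (d b - b).
    by rewrite (alg_homM dA) mulrBl mulrBr addrA subrK.
  apply: (linear_setD (jpow_linear _ _)).
    rewrite -[n.+2]/(2 + n)%N; apply: jpowM; first by rewrite jpow2; apply: dJ1.
    by apply: (alg_hom_jpow dA (palg_morphJ dm)).
  by rewrite jpowS; apply: mem_ideal_mul => //; apply: IH.
have d_inj : injective d.
  move=> x y dxy; apply: jpow_sep_eq; elim=> [//|n IH].
  have /(linear_setN (jpow_linear _ _)) := dn n _ IH.
  by rewrite (alg_homB dA) dxy subrr sub0r opprK.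
have onto n b : jpow A n b -> exists2 a, jpow A n a & d a = b.
  apply: (jpow_onto dA (palg_morphJ dm)) => [x|x Jx]; exists x => //.
    exact: (linear_setBC JL (dJ0 x)).
  by apply: (linear_setBC (@jac2_linear k A)); apply: dJ1.
have ex b : exists a, d a = b by have [a _ ab] := onto 0%N b Logic.I; exists a.
pose d' b := sval (cid (ex b)).
have d'K : cancel d' d by move=> b; apply: svalP (cid (ex b)).
have dK : cancel d d' by move=> a; apply: d_inj; rewrite d'K.
have d'A : alg_hom d'.
  split; last split.
  - by move=> c x y; apply: d_inj; rewrite dA.1 !d'K.
  - by apply: d_inj; rewrite d'K (alg_hom1 dA).
  - by move=> x y; apply: d_inj; rewrite (alg_homM dA) !d'K.
have d'1 : sim1 d' id.
  split=> b => [|Jb].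
    by apply: (linear_setBC JL); rewrite -{1}[b]d'K; apply: dJ0.
  apply: (linear_setBC (@jac2_linear k A)).
  rewrite -{1}[b]d'K; apply: dJ1.
  have [|a Ja <-] := onto 1%N b; first by rewrite jpow1.
  by rewrite dK -jpow1.
exists d'; split=> //; exact: sim1_morph (palg_morph_id A).
Qed.

End Sim1.

(** * Orbits of idempotents and points *)

Section Orbits.
Variables (k : fieldType) (A : palg k).
Implicit Types (a b e g : A).

Lemma inner_orbit_refl a : inner_orbit a a.
Proof.
exists 0, 1; rewrite addr0 !mul1r mulr1; split=> //.
by have [] := left_ideal_jac A.
Qed.

Lemma inner_orbit_sym a b : inner_orbit a b -> inner_orbit b a.
Proof.
move=> [w [u [Jw wu uw ->]]]; have [u' [wu' u'w Ju']] := jac_unit Jw.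
have uE : u = 1 + (u' - 1).
  by rewrite addrCA subrr addr0 -[u]mulr1 -wu' mulrA uw mul1r.
exists (u' - 1), (1 + w); rewrite -uE; split=> //.
by rewrite !mulrA uw mul1r -mulrA uw mulr1.
Qed.

Lemma inner_orbit_trans b a c : inner_orbit a b -> inner_orbit b c -> inner_orbit a c.
Proof.
move=> [w [u [Jw wu uw ->]]] [w' [u' [Jw' wu' uw' ->]]].
exists ((1 + w') * (1 + w) - 1), (u * u'); rewrite addrCA subrr addr0; split.
- have -> : (1 + w') * (1 + w) - 1 = w' * (1 + w) + w.
    by rewrite mulrDl mul1r addrAC [1 + w]addrC addrK addrC.
  by apply: (linear_setD (jac_linear A)) => //; apply: jacM_r.
- by rewrite -mulrA (mulrA (1 + w)) wu mul1r.
- by rewrite -mulrA (mulrA u') uw' mul1r.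
- by rewrite !mulrA.
Qed.

Lemma inner_orbit_eq a b : inner_orbit a b -> inner_orbit a = inner_orbit b.
Proof.
move=> ab; apply/seteqP; split=> c; apply: inner_orbit_trans => //.
exact: inner_orbit_sym.
Qed.

(** The unit [1 + w] is congruent to [1] modulo [J(A)]. *)
Lemma inner_orbit_jac a b : inner_orbit a b -> jac A (b - a).
Proof.
move=> [w [u [Jw wu uw ->]]].
have -> : (1 + w) * a * u - a = ((1 + w) * a - a * (1 + w)) * u.
  by rewrite mulrBl -[a * (1 + w) * u]mulrA wu mulr1.
rewrite (mulrDl _ _ a) (mulrDr a) mul1r mulr1 opprD addrACA subrr add0r.
by apply: jacM_r; apply: (linear_setB (jac_linear A)); [apply: jacM_r|apply: jacM_l].
Qed.

Lemma idem_compl e : e * e = e -> orth_idems (fun b : bool => if b then e else 1 - e).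
Proof.
move=> ee; split; last by rewrite big_bool /= addrC subrK.
by case=> -[]; rewrite /= ?mulr1n ?mulr0n ?ee // !(mulrBl, mulrBr) ?mul1r ?mulr1 ee
  ?subrr ?subr0.
Qed.

(** The case of the two families [e, 1 - e]. *)
Lemma idem_inner_orbit a b : a * a = a -> b * b = b -> jac A (a - b) -> inner_orbit a b.
Proof.
move=> aa bb Jab; have [|w [u [Jw wu uw E]]] := orth_idems_conj (idem_compl aa) (idem_compl bb).
  case=> //; have -> : 1 - a - (1 - b) = b - a.
    by rewrite opprB [_ + (b - 1)]addrC addrA subrK.
  exact: (linear_setBC (jac_linear A)).
by exists w, u; split=> //; apply: (E true).
Qed.

End Orbits.

Section Idempotents.
Variables (k : fieldType) (A : palg k).
Implicit Types (a b e g : A).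

(** Orthogonal idempotents outside [J(A)] are linearly independent modulo
    [J(A)]. *)
Lemma orth_idems_card_bound : exists n, forall (V : finType) (e : V -> A),
  orth_idems e -> (forall v, e v != 0) -> (#|V| <= n)%N.
Proof.
have [n [f [fL _ fJ]]] := jpow_fin_codim A 1; rewrite jpow1 in fJ.
exists n => V e eO e0; pose M := \matrix_(i < #|V|) f (e (enum_val i)).
suff /eqP <- : row_free M by apply: rank_leq_col.
apply: inj_row_free => c cM; apply/rowP => i; rewrite [RHS]mxE.
have Jc : jac A (\sum_i c 0 i *: e (enum_val i)).
  rewrite fJ /= (lin_fun_sum fL) -[RHS]cM mulmx_sum_row.
  by apply: eq_bigr => j _; rewrite (lin_funZ fL) rowK.
have /(jacM_l (e (enum_val i))) := Jc; rewrite mulr_sumr (bigD1 i) //= big1 ?addr0.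
  rewrite -talg_scalerAr (orth_idemsM _ eO) => Jce.
  apply/eqP; apply: contraT => ci.
  have Je : jac A (e (enum_val i)).
    by rewrite -[e _](scalerK ci); apply: (linear_setZ (jac_linear A)).
  by have := e0 (enum_val i); rewrite (jac_idem0 Je) ?eqxx // (orth_idemsM _ eO).
move=> j ji; have [eM _] := eO; rewrite -talg_scalerAr eM (inj_eq enum_val_inj).
by rewrite eq_sym (negbTE ji) scaler0.
Qed.

Lemma sum_option (V : finType) (F : option V -> A) :
  \sum_x F x = F None + \sum_v F (Some v).
Proof.
rewrite (bigD1 None) //=; congr (_ + _).
rewrite (reindex_omap Some id) /=; last by case.
by apply: eq_bigl => v; rewrite eqxx.
Qed.

Lemma orth_idems_split (V : finType) (e : V -> A) (v : V) a b : orth_idems e ->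
  e v = a + b -> a * a = a -> b * b = b -> a * b = 0 -> b * a = 0 ->
  orth_idems (fun x : option V => if x is Some w then if w == v then b else e w else a).
Proof.
move=> [eM e1] ev aa bb ab ba.
have ea : e v * a = a by rewrite ev mulrDl aa ba addr0.
have ae : a * e v = a by rewrite ev mulrDr aa ab addr0.
have eb : e v * b = b by rewrite ev mulrDl bb ab add0r.
have be : b * e v = b by rewrite ev mulrDr bb ba add0r.
have L w x : w != v -> e v * x = x -> e w * x = 0.
  by move=> wv <-; rewrite mulrA eM (negbTE wv) mul0r.
have R w x : w != v -> x * e v = x -> x * e w = 0.
  by move=> wv <-; rewrite -mulrA eM eq_sym (negbTE wv) mulr0.
split.
  move=> [w|] [w'|] /=.
  - rewrite (inj_eq Some_inj).
    case: (eqVneq w v) => [wE|wv]; case: (eqVneq w' v) => [wE'|wv'].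
    + by rewrite wE wE' eqxx bb.
    + by rewrite wE eq_sym (negbTE wv') R.
    + by rewrite wE' (negbTE wv) L.
    + exact: eM.
  - by rewrite mulr0n; case: eqVneq => // wv; rewrite L.
  - by rewrite mulr0n; case: eqVneq => // wv; rewrite R.
  - by rewrite mulr1n.
rewrite sum_option /= (bigD1 v) //= eqxx addrA -ev -[RHS]e1 [RHS](bigD1 v) //=.
by congr (_ + _); apply: eq_bigr => w /negbTE ->.
Qed.

(** A decomposition of [1] of maximal length cannot be refined. *)
Lemma exists_complete_prim_idem : exists E, @complete_prim_idem k A E.
Proof.
pose P m := `[< exists (V : finType) (e : V -> A),
  [/\ #|V| = m, orth_idems e & forall v, e v != 0] >].
have P0 : exists m, P m.
  have [A0|A1] := eqVneq (1 : A) 0.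
    exists 0; apply/asboolP; exists 'I_0, (fun=> 0); split; first exact: card_ord.
      by split=> [[]//|]; rewrite big_ord0.
    by case.
  exists 1; apply/asboolP; exists unit, (fun=> 1); split=> //; first exact: card_unit.
  split=> [[] []|]; first by rewrite mulr1.
  by rewrite (big_pred1 tt) //; case.
have [n bound] := orth_idems_card_bound.
have Pn m : P m -> (m <= n)%N.
  by move=> /asboolP[V [e [<- eO e0]]]; apply: bound e0.
case: (ex_maxnP P0 Pn) => m /asboolP[V [e [cV eO e0]]] maxm.
have [eM e1] := eO.
exists [seq e v | v <- enum V]; split.
- rewrite map_inj_uniq ?enum_uniq // => v w evw; apply/eqP; apply: contraT => vw.
  by have := eM v w; rewrite -evw (orth_idemsM _ eO) (negbTE vw) => /eqP; rewrite (negbTE (e0 v)).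
- move=> _ /mapP[v _ ->]; split=> //; first exact: orth_idemsM.
  move=> a b aa bb ab ba ev; apply: contrapT => /not_orP[/eqP a0 /eqP b0].
  suff /maxm : P m.+1 by rewrite ltnn.
  apply/asboolP; exists (option V); eexists; split; first by rewrite card_option cV.
    exact: (orth_idems_split eO ev aa bb ab ba).
  by case=> [w|] //=; case: (eqVneq w v).
- move=> _ _ /mapP[v _ ->] /mapP[w _ ->] vw; rewrite eM; case: (eqVneq v w) vw => [->|//].
  by rewrite eqxx.
- by rewrite big_map big_enum.
Qed.

Lemma idem_seqP : complete_prim_idem (idem_seq A).
Proof. by have [E EP] := exists_complete_prim_idem; apply: xgetPex; exists E. Qed.

(** If a primitive idempotent [e] had two points, an idempotent lifting of
    [e x e], with [x] separating them, would split [e]. *)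
Lemma prim_idem_point (T : Type) (chi : T -> A -> k) e :
  (forall i, linear (chi i : A -> k^o) /\ monoid_morphism (chi i)) ->
  jac A = [set x | forall i, chi i x = 0] ->
  (forall g : T -> k, exists x, forall i, chi i x = g i) ->
  prim_idem e -> exists2 i, chi i e = 1 & forall j, chi j e != 0 -> j = i.
Proof.
move=> chiA JE chis [e0 ee prim].
have chiL i := (chiA i).1; have chiM i x y : chi i (x * y) = chi i x * chi i y.
  by have [_ [_ h]] := chiA i.
have chi01 i x : x * x = x -> chi i x != 0 -> chi i x = 1.
  by move=> xx x0; apply: (mulfI x0); rewrite -chiM xx mulr1.
have [i ei] : exists i, chi i e != 0.
  apply: contrapT => nex; case/eqP: e0; apply: jac_idem0 => //.
  by rewrite JE => i /=; apply/eqP; apply: contraT => ei; case: nex; exists i.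
exists i; first exact: chi01.
move=> j ej; apply: contrapT => ji.
have [x xP] := chis (fun t => if `[< t = i >] then 1 else 0).
have xi : chi i x = 1 by rewrite xP asboolT.
have xj : chi j x = 0 by rewrite xP asboolF.
(* As [chi i a = 1] and [chi j a = 0], neither [g] nor [e - g] vanishes below. *)
pose a := e * x * e.
have chia t : chi t a = chi t e * chi t x.
  rewrite /a !chiM; have [->|t0] := eqVneq (chi t e) 0; first by rewrite !mul0r.
  by rewrite (chi01 _ _ ee t0) mulr1.
have Ja : jac A (a * a - a).
  rewrite JE => t /=; rewrite (lin_funB (chiL t)) chiM chia xP.
  have [->|t0] := eqVneq (chi t e) 0; first by rewrite !mul0r subrr.
  by rewrite (chi01 _ _ ee t0) !mul1r; case: ifP; rewrite ?mulr1 ?mulr0 subrr.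
have [g [gg Jg gl gr]] := idem_lift Ja.
have eg : e * g = g by apply: gl; rewrite /a !mulrA ee.
have ge : g * e = g by apply: gr; rewrite /a -!mulrA ee.
have chig t : chi t g = chi t a.
  by apply/eqP; rewrite -subr_eq0; apply/eqP; rewrite -(lin_funB (chiL t));
    move: t; change ([set x | forall i, chi i x = 0] (g - a)); rewrite -JE.
have [] := prim g (e - g) gg.
- by rewrite mulrBl !mulrBr ee eg ge gg subrr subr0.
- by rewrite mulrBr ge gg subrr.
- by rewrite mulrBl eg gg subrr.
- by rewrite addrC subrK.
- move=> g0; have := chig i; rewrite g0 (lin_fun0 (chiL i)) chia xi mulr1 => /esym/eqP.
  by rewrite (negbTE ei).
- move=> eg0; have := chig j; have -> : g = e by apply/eqP; rewrite eq_sym -subr_eq0 eg0.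
  by rewrite chia xj mulr0 => /eqP; rewrite (negbTE ej).
Qed.

(** A point of [A] takes the value [1] on exactly one member of the family, since
    the members are orthogonal with sum [1]; so there are no other points than
    those of the members. *)
Lemma orth_prim_points (V : finType) (e : V -> A) : orth_idems e ->
  (forall v, prim_idem (e v)) -> exists chi : V -> A -> k,
    [/\ forall v, linear (chi v : A -> k^o), forall v x y, chi v (x * y) = chi v x * chi v y,
        jac A = [set x | forall v, chi v x = 0] &
        forall v w, chi v (e w) = (v == w)%:R].
Proof.
move=> eO ep; have [eM e1] := eO.
have [T [chi [chiA _ JE chis]]] := palg_pt A.
have chiL i := (chiA i).1; have chiM i x y : chi i (x * y) = chi i x * chi i y.
  by have [_ [_ h]] := chiA i.
have /choice[p pP] v : exists i, chi i (e v) = 1 /\ forall j, chi j (e v) != 0 -> j = i.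
  by have [i i1 iP] := prim_idem_point chiA JE chis (ep v); exists i.
exists (fun v => chi (p v)); split=> //.
  rewrite JE; apply/seteqP; split=> x //= xP i.
  have [v ev] : exists v, chi i (e v) != 0.
    apply: contrapT => nex; have := (chiA i).2.1.
    rewrite -e1 (lin_fun_sum (chiL i)) big1 => [/esym/eqP|v _]; first by rewrite oner_eq0.
    by apply/eqP; apply: contraT => ev; case: nex; exists v.
  by rewrite ((pP v).2 _ ev).
move=> v w; have [<-|vw] := eqVneq v w; first exact: (pP v).1.
have := chiM (p v) (e v) (e w); rewrite eM (negbTE vw) (pP v).1 mul1r => <-.
exact: (lin_fun0 (chiL (p v))).
Qed.

End Idempotents.

Section GabrielVertices.
Variables (k : fieldType) (A : palg k).
Local Notation V := (vq_vert (gq A)).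
Implicit Types (u v w : V).

Let s := idem_seq A.

Lemma idem_seq_orbit_inj : {in s &, injective (@inner_orbit k A)}.
Proof.
have [us ps os _] := idem_seqP A => e f es fs ef; apply/eqP; apply: contraT => nef.
have [e0 ee _] := ps _ es; case/eqP: e0; apply: jac_idem0 => //.
have Jef : jac A (e - f) by apply: inner_orbit_jac; rewrite -ef; apply: inner_orbit_refl.
by have := jacM_l e Jef; rewrite mulrBr ee os // subr0.
Qed.

Lemma gq_repP u : gq_rep (Some u) \in s /\ inner_orbit (gq_rep (Some u)) = val u.
Proof.
have uin := valP u; rewrite -index_mem size_map in uin.
split; first exact: mem_nth.
by rewrite -(nth_map 0 set0) // nth_index // (valP u).
Qed.

Lemma gq_repE u e : e \in s -> val u = inner_orbit e -> gq_rep (Some u) = e.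
Proof.
move=> es ue; have [us uo] := gq_repP u.
by apply: idem_seq_orbit_inj; rewrite // uo.
Qed.

Lemma gq_vert_of e : e \in s -> exists u, gq_rep (Some u) = e.
Proof.
move=> es; have oin : inner_orbit e \in [seq inner_orbit e | e <- s] by apply: map_f.
by exists (SeqSub oin); apply: gq_repE.
Qed.

Lemma gq_rep_inj : injective (fun u => gq_rep (Some u)).
Proof.
move=> u v uv; apply: val_inj; rewrite -(gq_repP u).2 -(gq_repP v).2.
by rewrite uv.
Qed.

Lemma gq_rep_prim u : prim_idem (gq_rep (Some u)).
Proof. by have [_ ps _ _] := idem_seqP A; apply: ps (gq_repP u).1. Qed.

Lemma gq_rep_orth : orth_idems (fun u => gq_rep (Some u)).
Proof.
have [us ps os s1] := idem_seqP A; split=> [u v|].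
  have [->|uv] := eqVneq; first by have [_ -> _] := gq_rep_prim v.
  by apply: os (gq_repP u).1 (gq_repP v).1 _; rewrite (inj_eq gq_rep_inj).
rewrite -[RHS]s1 -(big_map (fun u => gq_rep (Some u)) xpredT id) /index_enum -enumT.
apply: perm_big; apply: uniq_perm => //.
  by rewrite map_inj_uniq ?enum_uniq //; apply: gq_rep_inj.
move=> e; apply/mapP/idP => [[u _ ->]|/gq_vert_of[u <-]]; first exact: (gq_repP u).1.
by exists u; rewrite ?mem_enum.
Qed.

(** An orbit of idempotents is the same thing as a class of idempotents modulo
    [J(A)]. *)
Lemma gq_rep_mem u (a : A) : a * a = a -> val u a <-> jac A (a - gq_rep (Some u)).
Proof.
move=> aa; rewrite -(gq_repP u).2; split; first exact: inner_orbit_jac.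
move=> Ja; apply: idem_inner_orbit => //; first by have [] := gq_rep_prim u.
exact: (linear_setBC (jac_linear A)).
Qed.

Lemma gq_points : exists chi : V -> A -> k,
  [/\ forall v, linear (chi v : A -> k^o), forall v x y, chi v (x * y) = chi v x * chi v y,
      jac A = [set x | forall v, chi v x = 0] &
      forall v w, chi v (gq_rep (Some w)) = (v == w)%:R].
Proof. exact: orth_prim_points gq_rep_orth gq_rep_prim. Qed.

End GabrielVertices.

(** * Arithmetic of completed path algebras *)

Section CpaStructure.
Variables (k : fieldType) (Q : vquiver k).
Local Notation V := (vq_vert Q).
Local Notation S := (vqSigma Q).
Local Notation M := (vqArrows Q).
Local Notation C := (cpa Q).

Lemma cpa_mulE (a b : C) n : (a * b) n = \sum_(i < n.+1) cpa_lmul b (a i) n.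
Proof. by []. Qed.

Lemma cpa_addE (a b : C) n : (a + b) n = a n + b n.
Proof. by []. Qed.

Lemma cpa_subE (a b : C) n : (a - b) n = a n - b n.
Proof. by []. Qed.

Lemma cpa_big_sumE (I : Type) (r : seq I) (P : pred I) (F : I -> C) n :
  (\sum_(i <- r | P i) F i) n = \sum_(i <- r | P i) F i n.
Proof. by elim/big_rec2: _ => [//|i y x _ <-]. Qed.

Lemma cpa_scaleE (c : k) (a : C) n : (c *: a) n = ([ffun=> c] : S) *: a n.
Proof. by []. Qed.

(** [cpa_sig] and [cpa_arr] extend [cpa_idem] and [cpa_arrow] linearly to [Sigma] and
    [VQ_1]. *)
Definition cpa_sig (s : S) : C :=
  fun n => match n return vqT Q n with 0 => s | _ => 0 end.

Definition cpa_arr (y : M) : C :=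
  fun n => match n return vqT Q n with 1 => @ptens k Q (vqT Q 0) y (1 : S) | _ => 0 end.

Lemma cpa_sig_mul s (a : C) n : (cpa_sig s * a) n = s *: a n.
Proof.
rewrite cpa_mulE big_ord_recl big1 => [|i _]; last exact: cpa_lmul0.
exact: addr0.
Qed.

Lemma cpa_arr_mul0 y (a : C) : (cpa_arr y * a) 0%N = 0.
Proof. by rewrite cpa_mulE big_ord1; apply: cpa_lmul0. Qed.

Lemma cpa_arr_mul y (a : C) n : (cpa_arr y * a) n.+1 = ptens y (a n).
Proof.
rewrite cpa_mulE big_ord_recl [X in X + _]cpa_lmul0 add0r big_ord_recl.
rewrite big1 => [|i _]; last exact: cpa_lmul0.
rewrite addr0 -[RHS](_ : ptens y ((1 : S) *: a n) = _); last by rewrite scale1r.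
exact: (@cpa_lmul_ptens _ _ a 0 n y ((1 : S) : vqT Q 0)).
Qed.

Lemma cpa_sig1 : cpa_sig 1 = 1.
Proof. by apply: cpa_ext => -[]. Qed.

Lemma cpa_sigM s t : cpa_sig s * cpa_sig t = cpa_sig (s * t).
Proof. by apply: cpa_ext => -[|n]; rewrite cpa_sig_mul //= scaler0. Qed.

Lemma cpa_arr_sig y s : cpa_arr y * cpa_sig s = cpa_arr (vqa_ract y s).
Proof.
apply: cpa_ext => -[|[|n]]; rewrite ?cpa_arr_mul0 ?cpa_arr_mul //=.
  rewrite ptens_bal; congr ptens; exact: (esym (mulr1 s)).
by rewrite ptens0r.
Qed.

Lemma cpa_sig_arr y s : cpa_sig s * cpa_arr y = cpa_arr (s *: y).
Proof.
by apply: cpa_ext => -[|[|n]]; rewrite cpa_sig_mul /= ?scaler0 // ptensZ.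
Qed.

Lemma cpa_arrD y z : cpa_arr (y + z) = cpa_arr y + cpa_arr z.
Proof.
by apply: cpa_ext => -[|[|n]]; rewrite cpa_addE /= ?addr0 // ptensDl.
Qed.

Lemma cpa_arr0 : cpa_arr 0 = 0.
Proof. by apply: (addrI (cpa_arr 0)); rewrite -cpa_arrD !addr0. Qed.

Lemma cpa_arrZ (c : k) y : cpa_arr (([ffun=> c] : S) *: y) = c *: cpa_arr y.
Proof.
by apply: cpa_ext => -[|[|n]]; rewrite cpa_scaleE /= ?scaler0 // ptensZ.
Qed.

Lemma cpa_arr_sum (I : Type) (r : seq I) (P : pred I) (F : I -> M) :
  cpa_arr (\sum_(i <- r | P i) F i) = \sum_(i <- r | P i) cpa_arr (F i).
Proof.
by elim/big_rec2: _ => [|i y x _ <-]; rewrite ?cpa_arr0 ?cpa_arrD.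
Qed.

(** The isomorphism [VQ_1 (x) Sigma = VQ_1] given by the right action; it shows that
    no arrow is lost in degree 1 of the path algebra. *)
Let tens1_val (u : seq (M * S)) : M := \sum_(p <- u) vqa_ract p.1 p.2.

Let tens1_valP u v : @tens_eq k Q (vqT Q 0) u v -> tens1_val u = tens1_val v.
Proof.
rewrite /tens1_val; elim=> {u v}.
- by [].
- by move=> u v _ ->.
- by move=> u v w _ -> _.
- by move=> u u' v v' _ E _ E'; rewrite !big_cat /= E E'.
- by move=> u v; rewrite !big_cat /= addrC.
- move=> m; rewrite big_seq1 big_nil; apply: functional_extensionality_dep => p.
  by rewrite /vqa_ract /= [LHS]scaler0.
- move=> x y m; rewrite !big_cons !big_nil !addr0; apply: functional_extensionality_dep => p.
  exact: scalerDr.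
- move=> x m n; rewrite !big_cons !big_nil !addr0; apply: functional_extensionality_dep => p.
  rewrite /vqa_ract /= -[RHS]scalerDl; congr (_ *: _).
  by rewrite -[m + n]/(m + n : S) ffunE.
- move=> x s m; rewrite !big_seq1; apply: functional_extensionality_dep => p.
  by rewrite /vqa_ract /= scalerA -[s *: m]/(s * m : S) ffunE mulrC.
Qed.

Lemma cpa_arr_inj : injective cpa_arr.
Proof.
move=> y z /(congr1 (fun a : C => a 1%N)) /= /tens_piP/tens1_valP.
rewrite /tens1_val !big_seq1 /=.
have r1 x : vqa_ract x 1 = x :> M.
  apply: functional_extensionality_dep => p.
  by rewrite /vqa_ract ffunE scale1r.
by rewrite !r1.
Qed.

Lemma cpa_deg1 (X : vqT Q 1) : exists y, X = @ptens k Q (vqT Q 0) y (1 : S).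
Proof.
elim/tens_ind: X => [|x s X [y ->]].
  by exists 0; rewrite ptens0l.
exists (vqa_ract x s + y); rewrite ptensDl ptens_bal.
congr (ptens _ _ + _); exact: (esym (mulr1 (s : S))).
Qed.

Lemma vqa_addE (y z : M) p : (y + z) p = y p + z p.
Proof. by []. Qed.

Lemma vqa_scaleE (s : S) (y : M) p : (s *: y) p = (s : {ffun V -> k}) p.2 *: y p.
Proof. by []. Qed.

Lemma vqa_sumE (I : Type) (r : seq I) (P : pred I) (F : I -> M) p :
  (\sum_(i <- r | P i) F i) p = \sum_(i <- r | P i) F i p.
Proof. by elim/big_rec2: _ => [//|i y x _ <-]. Qed.

Lemma vq_arrowE (y : M) : y = \sum_(p : V * V) vq_arrow (y p).
Proof.
apply: functional_extensionality_dep => -[v w]; rewrite vqa_sumE.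
rewrite (bigD1 (v, w)) //= [X in X + _]dfwithin big1 ?addr0 // => -[v' w'] ne.
exact: dfwithout.
Qed.

Lemma vq_arrow_linear v w (c : k) (x y : vq_sp (Some v) (Some w)) :
  vq_arrow (c *: x + y) = ([ffun=> c] : S) *: (vq_arrow x : M) + vq_arrow y.
Proof.
apply: functional_extensionality_dep => p.
rewrite vqa_addE vqa_scaleE ffunE.
have [<-|ne] := eqVneq (v, w) p; first by rewrite /vq_arrow !dfwithin.
by rewrite /vq_arrow !dfwithout // scaler0 addr0.
Qed.

Lemma cpa_arrowE v w (x : vq_sp (Some v) (Some w)) :
  cpa_arrow x = cpa_arr (vq_arrow x).
Proof. by []. Qed.

Lemma cpa_idemE v : cpa_idem (Some v) = cpa_sig [ffun u => (u == v)%:R] :> C.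
Proof. by []. Qed.

Lemma cpa_idem_star : cpa_idem None = 0 :> C.
Proof. by apply: cpa_ext => -[]. Qed.

Lemma cpa_arrow_star v w (x : vq_sp v w) : v = None \/ w = None -> cpa_arrow x = 0 :> C.
Proof. by case: v w x => [v|] [w|] x []. Qed.

Lemma cpa_arrow_linear v w : linear (fun x : vq_sp v w => cpa_arrow x : C).
Proof.
case: v w => [v|] [w|] c x y; try by rewrite /= scaler0 addr0.
by rewrite !cpa_arrowE vq_arrow_linear cpa_arrD cpa_arrZ.
Qed.

Lemma cpa_arrow_inj v w : injective (fun x : vq_sp (Some v) (Some w) => cpa_arrow x : C).
Proof.
move=> x y /cpa_arr_inj /(congr1 (fun m : M => m (v, w))).
by rewrite /vq_arrow !dfwithin.
Qed.

Lemma cpa_sigE s : cpa_sig s = \sum_v (s : {ffun V -> k}) v *: cpa_idem (Some v) :> C.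
Proof.
apply: cpa_ext => n; rewrite cpa_big_sumE.
case: n => [|n] /=; last by rewrite big1 // => v _; rewrite cpa_scaleE scaler0.
apply/ffunP => u; rewrite sum_ffunE (bigD1 u) //= big1 ?addr0.
  by rewrite !ffunE eqxx mulr1.
by move=> v vu; rewrite !ffunE eq_sym (negbTE vu) mulr0.
Qed.

Lemma cpa_idem_orth : 
  (forall v w, (cpa_idem (Some v) : C) * cpa_idem (Some w) = cpa_idem (Some v) *+ (v == w)) /\
  \sum_v (cpa_idem (Some v) : C) = 1.
Proof.
split=> [v w|].
  rewrite !cpa_idemE cpa_sigM.
  have [->|vw] := eqVneq; [congr cpa_sig | apply: cpa_ext => -[|n] //];
    apply/ffunP => u; rewrite !ffunE -natrM mulnb; last first.
    by have [->|//] := eqVneq u v; rewrite (negbTE vw).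
  by rewrite andbb.
rewrite -cpa_sig1 cpa_sigE; apply: eq_bigr => v _.
by rewrite ffunE scale1r.
Qed.

Lemma cpa_arrow_idem v w (x : vq_sp v w) :
  cpa_arrow x = (cpa_idem w : C) * cpa_arrow x * cpa_idem v.
Proof.
case: v w x => [v|] [w|] x; try by rewrite /= mulr0 mul0r.
rewrite !cpa_arrowE !cpa_idemE cpa_sig_arr cpa_arr_sig; congr cpa_arr.
apply: functional_extensionality_dep => p.
rewrite /vqa_ract vqa_scaleE !ffunE.
have [<-|ne] := eqVneq (v, w) p; first by rewrite !eqxx !scale1r.
by rewrite /vq_arrow dfwithout // !scaler0.
Qed.

Lemma cpa_arrow_component (y : M) v w :
  (cpa_idem (Some w) : C) * cpa_arr y * cpa_idem (Some v) = cpa_arrow (y (v, w)).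
Proof.
rewrite cpa_arrowE !cpa_idemE cpa_sig_arr cpa_arr_sig; congr cpa_arr.
apply: functional_extensionality_dep => -[v' w']; rewrite /vqa_ract vqa_scaleE !ffunE /=.
have [[<- <-]|ne] := eqVneq (v, w) (v', w').
  by rewrite !eqxx !scale1r /vq_arrow dfwithin.
rewrite /vq_arrow dfwithout // scalerA -natrM mulnb.
by move: ne; rewrite eq_sym xpair_eqE => /negbTE ->; rewrite scale0r.
Qed.

Lemma vqa_ract_const (c : k) (y : M) : vqa_ract y [ffun=> c] = ([ffun=> c] : S) *: y.
Proof.
apply: functional_extensionality_dep => p; rewrite /vqa_ract.
by rewrite vqa_scaleE !ffunE.
Qed.

Definition arrow_index : finType :=
  {p : V * V & 'I_(\dim {: vq_sp (Some p.1) (Some p.2)})}.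

Definition arrow_basis (b : arrow_index) : vq_sp (Some (tag b).1) (Some (tag b).2) :=
  (vbasis {: vq_sp (Some (tag b).1) (Some (tag b).2)})`_(tagged b).

Lemma vqa_basisE (y : M) : exists c : arrow_index -> k,
  y = \sum_b ([ffun=> c b] : S) *: (vq_arrow (arrow_basis b) : M).
Proof.
exists (fun b => coord (vbasis {: vq_sp (Some (tag b).1) (Some (tag b).2)}) (tagged b) (y (tag b))).
rewrite -(sig_big_dep (fun=> true) (fun _ _ => true) (fun p i =>
  ([ffun=> coord (vbasis {: vq_sp (Some p.1) (Some p.2)}) i (y p)] : S) *:
  (vq_arrow ((vbasis {: vq_sp (Some p.1) (Some p.2)})`_i) : M))) /=.
rewrite {1}[y]vq_arrowE; apply: eq_bigr => p _.
rewrite {1}(coord_vbasis (memvf (y p))).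
elim/big_rec2: _ => [|i z t _ <-]; last first.
  by rewrite vq_arrow_linear.
apply: functional_extensionality_dep => q.
have [<-|ne] := eqVneq (p.1, p.2) q; first by rewrite /vq_arrow dfwithin.
by rewrite /vq_arrow dfwithout.
Qed.

Lemma vqT_basisE n (X : vqT Q n.+1) : exists t : arrow_index -> vqT Q n,
  X = \sum_b ptens (vq_arrow (arrow_basis b)) (t b) /\ (X = 0 -> forall b, t b = 0).
Proof.
suff [t tE] : exists t : arrow_index -> vqT Q n,
    X = \sum_b ptens (vq_arrow (arrow_basis b)) (t b).
  have [X0|X0] := pselect (X = 0); last by exists t.
  by exists (fun=> 0); split=> //; rewrite X0 big1 // => b _; rewrite ptens0r.
elim/(@tens_ind k Q (vqT Q n)): X => [|x m X [t ->]].
  by exists (fun=> 0); rewrite big1 // => b _; rewrite ptens0r.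
have [c xE] := vqa_basisE x.
exists (fun b => ([ffun=> c b] : S) *: m + t b).
rewrite [RHS](eq_bigr (fun b => ptens (([ffun=> c b] : S) *: (vq_arrow (arrow_basis b) : M)) m +
  ptens (vq_arrow (arrow_basis b)) (t b))) => [|b _]; last first.
 by rewrite ptensDr -ptens_bal vqa_ract_const.
rewrite big_split /=; congr (_ + _); rewrite {1}xE.
by elim/big_rec2: _ => [|b z u _ <-]; rewrite ?ptens0l ?ptensDl.
Qed.

(** It will turn out to be the [n]-th power of the radical. *)
Definition cge n : set C := [set a | forall i, (i < n)%N -> a i = 0].

(** The paths of positive length are sorted by their first arrow, expanded in a
    basis. Peeling off one arrow in this way is the step of most inductions below. *)
Lemma cpa_decomp (a : C) : exists a' : arrow_index -> C,
  a = \sum_v (a 0%N : {ffun V -> k}) v *: cpa_idem (Some v) +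
      \sum_b cpa_arrow (arrow_basis b) * a' b /\
  forall n, cge n.+1 a -> forall b, cge n (a' b).
Proof.
pose t n := sval (cid (vqT_basisE (a n.+1))).
have tP n : a n.+1 = \sum_b ptens (vq_arrow (arrow_basis b)) (t n b) /\
    (a n.+1 = 0 -> forall b, t n b = 0).
  by rewrite /t; case: cid.
exists (fun b n => t n b); split; last first.
  by move=> n an b i lt_in; apply: (tP i).2; apply: an.
rewrite -cpa_sigE; apply: cpa_ext => n; rewrite cpa_addE cpa_big_sumE.
case: n => [|n]; first by rewrite big1 ?addr0 // => b _; apply: cpa_arr_mul0.
rewrite add0r (tP n).1; apply: eq_bigr => b _.
by rewrite cpa_arrowE cpa_arr_mul.
Qed.

Lemma cpa_lmul_eq0 (b : C) m n (X : vqT Q m) :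
  (forall i, (i <= n)%N -> b i = 0) -> cpa_lmul b X n = 0.
Proof.
elim: m n X => [|m IH] n X b0; first by rewrite /= b0 // scaler0.
case: n b0 => [//|n] b0.
have {}IH (x : vqT Q m) : cpa_lmul b x n = 0.
  by apply: IH => i /leqW; apply: b0.
elim/(@tens_ind k Q (vqT Q m)): X => [|x t X IHX]; first exact: cpa_lmul0.
rewrite (cpa_lmulD b n.+1 (ptens x t : vqT Q m.+1)) IHX addr0.
by rewrite cpa_lmul_ptens IH ptens0r.
Qed.

Lemma cge_ideal n : ideal (cge n).
Proof.
split; first split=> [//|a b an bn i lt_in|a b bn i lt_in].
- by rewrite cpa_addE an // bn // addr0.
- rewrite cpa_mulE big1 // => j _; apply: cpa_lmul_eq0 => l li.
  by apply: bn; apply: leq_ltn_trans lt_in.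
- move=> a b bn i lt_in; rewrite cpa_mulE big1 // => j _.
  by rewrite bn ?cpa_lmul0 // (leq_ltn_trans _ lt_in) // -ltnS.
Qed.

Lemma cge_linear n : linear_set (cge n).
Proof. exact: ideal_linear (cge_ideal n). Qed.

Lemma cge0 : cge 0 = setT.
Proof. by apply/seteqP; split. Qed.

Lemma cge_dec m n : (m <= n)%N -> cge n `<=` cge m.
Proof. by move=> mn a an i im; apply: an; apply: leq_trans mn. Qed.

Lemma cge1E a : cge 1 a <-> a 0%N = 0.
Proof. by split=> [->//|a0 [|i]]. Qed.

Lemma cge_arr y : cge 1 (cpa_arr y).
Proof. exact/cge1E. Qed.

Lemma cge_arrow v w (x : vq_sp v w) : cge 1 (cpa_arrow x).
Proof. by case: v w x => [v|] [w|] x //; apply: cge_arr. Qed.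

Lemma cge_arr_mul n y a : cge n a -> cge n.+1 (cpa_arr y * a).
Proof.
move=> an [|i]; first by rewrite cpa_arr_mul0.
by rewrite cpa_arr_mul ltnS => /an ->; rewrite ptens0r.
Qed.

Lemma cpa_deg01 (a : C) : exists y : M, cge 2 (a - (cpa_sig (a 0%N) + cpa_arr y)).
Proof.
have [y yE] := cpa_deg1 (a 1%N); exists y => -[|[|i]] // _.
  by rewrite cpa_subE cpa_addE /= addr0 subrr.
by rewrite cpa_subE cpa_addE /= add0r yE subrr.
Qed.

Lemma cge_mul1 n a b : cge 1 a -> cge n b -> cge n.+1 (a * b).
Proof.
have [a' [aE a'P]] := cpa_decomp a.
move=> /cge1E a0 bn; rewrite aE mulrDl; apply: (linear_setD (cge_linear n.+1)).
  rewrite big1 ?mul0r; first exact: (cge_linear _).1.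
  by move=> v _; rewrite a0 ffunE scale0r.
rewrite mulr_suml; apply: (linear_set_sum (cge_linear n.+1)) => c _.
rewrite -mulrA; apply: cge_arr_mul.
by have [[_ _ h] _] := cge_ideal n; apply: h.
Qed.

Lemma cgeS n : cge n.+1 = ideal_mul (cge 1) (cge n).
Proof.
apply/seteqP; split=> [a an|]; last first.
  by apply: ideal_mul_sub => [|a b]; [exact: cge_linear | exact: cge_mul1].
have [a' [aE a'P]] := cpa_decomp a; rewrite aE big1 ?add0r => [|v _]; last first.
  by rewrite an // ffunE scale0r.
have IL : linear_set (ideal_mul (cge 1) (cge n)).
  by apply/ideal_linear/ideal_mul_ideal; apply: cge_ideal.
apply: (linear_set_sum IL) => b _; apply: mem_ideal_mul; first exact: cge_arrow.
exact: a'P.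
Qed.

Lemma cge_span n : fin_span setT (cge n).
Proof.
elim: n => [|n [T [w [_ wspan]]]].
  by exists 'I_0, (fun=> 0); split=> // x _; exists (fun=> 0).
exists (V + arrow_index * T)%type, (fun p => match p with
  | inl v => cpa_idem (Some v)
  | inr (b, t) => cpa_arrow (arrow_basis b) * w t end).
split=> // a _; have [a' [aE _]] := cpa_decomp a.
have /choice[c cP] b : exists c : T -> k, cge n (a' b - \sum_t c t *: w t).
  exact: wspan.
exists (fun p => match p with
  | inl v => (a 0%N : {ffun V -> k}) v
  | inr (b, t) => c b t end).
rewrite big_sumType /= {1}aE opprD addrACA subrr add0r.
rewrite (eq_bigr (fun p => cpa_arrow (arrow_basis p.1) * (c p.1 p.2 *: w p.2))) => [|[b t] _ /=]; last first.
  by rewrite talg_scalerAr.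
rewrite -(pair_bigA _ (fun b t => cpa_arrow (arrow_basis b) * (c b t *: w t))) /= -sumrB.
apply: (linear_set_sum (cge_linear _)) => b _.
by rewrite -mulr_sumr -mulrBr; apply: cge_arr_mul.
Qed.

Lemma cge_sep a : (forall n, cge n a) -> a = 0.
Proof. by move=> an; apply: cpa_ext => i; apply: an (ltnSn i). Qed.

Lemma cge_complete (u : nat -> C) : (forall n, cge n (u n)) ->
  exists s, forall n, cge n (s - \sum_(i < n) u i).
Proof.
move=> un; exists (fun i => (\sum_(j < i.+1) u j) i) => n i lt_in.
rewrite cpa_subE !cpa_big_sumE (big_ord_widen n (fun j => u j i)) //.
rewrite [X in _ - X](bigID (fun j : 'I_n => (j < i.+1)%N)) /= opprD addrA subrr sub0r.
by rewrite big1 ?oppr0 // => j; rewrite -leqNgt => ij; apply: un.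
Qed.

(** In a product of discrete spaces a neighbourhood constrains finitely many
    coordinates. *)
Lemma cge_nbhs (a : C) (U : set C) : nbhs a U <-> exists n, forall b, cge n b -> U (a + b).
Proof.
pose K n := discrete_topology (vqT Q n).
pose F : set_system (forall n, K n) := [set U | exists n, forall b, cge n b -> U ((a : C) + b)].
have FF : Filter F.
  split=> [|P R [m mP] [n nR]|P R PR [n nP]]; first by exists 0%N.
    exists (maxn m n) => b bmn; split.
      by apply/mP/(cge_dec (leq_maxl m n)).
    by apply/nR/(cge_dec (leq_maxr m n)).
  by exists n => b /nP/PR.
split.
  suff : F --> (a : prod_topology K) by move=> /(_ U).
  apply/cvg_sup => i A. rewrite nbhsE => -[B [[O _ <-] Oa] BA].
  exists i.+1 => b b0; apply: BA => /=.
  by move: Oa => /=; rewrite -[X in O X](_ : a i + b i = a i) // b0 ?addr0.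
move=> [n nU]; have proj i : nbhs (a : prod_topology K) [set b | b i = a i].
  have := @proj_continuous nat K i (a : prod_topology K) [set a i].
  apply; apply: open_nbhs_nbhs; split=> //; exact: discrete_open.
have NF : Filter (nbhs (a : prod_topology K)) by exact: nbhs_filter.
have all : nbhs (a : prod_topology K) [set b | forall i, (i < n)%N -> b i = a i].
  elim: n {nU} => [|n IH]; first by apply: filterS filterT => b _ i; rewrite ltn0.
  apply: filterS (filterI IH (proj n)) => b [bn bE] i.
  by rewrite ltnS leq_eqVlt => /orP[/eqP->|/bn].
apply: filterS all => b bE; rewrite -[b](subrK a) addrC; apply: nU => i lt_in.
by rewrite cpa_subE bE // subrr.
Qed.

End CpaStructure.

(** * Path algebras and their quotients as objects of PAlg *)

(** A recognition principle: a complete separated filtration by ideals of finite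
    codimension which defines the topology, is multiplicative, and starts with the
    common kernel of finitely many points, is the filtration by the powers of the
    radical of an object of PAlg. *)
Section Filtered.
Variables (k : fieldType) (A : topAlgType k) (F : nat -> set A).
Hypothesis F_ideal : forall n, ideal (F n).
Hypothesis F0 : F 0 = setT.
Hypothesis F_dec : forall n, F n.+1 `<=` F n.
Hypothesis F_mul : forall n, F n.+1 = ideal_mul (F 1) (F n).
Hypothesis F_nbhs : forall x U, nbhs x U <-> exists n, forall y, F n y -> U (x + y).
Hypothesis F_sep : forall x, (forall n, F n x) -> x = 0.
Hypothesis F_complete : forall u : nat -> A, (forall n, F n (u n)) ->
  exists s, forall n, F n (s - \sum_(i < n) u i).
Hypothesis F_span : forall n, fin_span setT (F n).
Variables (V : finType) (chi : V -> A -> k) (e : V -> A).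
Hypothesis chi_linear : forall v, linear (chi v : A -> k^o).
Hypothesis chi_mul : forall v, monoid_morphism (chi v).
Hypothesis chi_ker : F 1 = [set x | forall v, chi v x = 0].
Hypothesis chi_e : forall v w, chi v (e w) = (v == w)%:R.

Let FL n : linear_set (F n). Proof. exact: ideal_linear. Qed.

Let FMl n a x : F n x -> F n (a * x).
Proof. by have [[_ _ h] _] := F_ideal n; apply: h. Qed.
Let FMr n a x : F n x -> F n (x * a).
Proof. by have [_ h] := F_ideal n; apply: h. Qed.

Lemma filtered_open n : open (F n).
Proof.
by rewrite openE => x Fx; apply/F_nbhs; exists n => y Fy; apply: linear_setD.
Qed.

Lemma filtered_basis : pseudocompact_basis (range F).
Proof.
have decn m n : (m <= n)%N -> F n `<=` F m.
  move=> /subnK <-; elim: (n - m)%N => [//|d IH].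
  by rewrite addSn; apply: subset_trans IH.
split.
- move=> _ [n _ <-]; split=> //; first exact: filtered_open.
  exact: fin_span_codim.
- by move=> U /F_nbhs[n nU]; exists (F n) => [|y /nU]; [exists n | rewrite add0r].
- apply/seteqP; split=> [x Fx|x ->].
    by apply: F_sep => n; apply: Fx; exists n.
  by move=> _ [n _ <-]; apply: (FL n).1.
- move=> x xP; have [|s sP] := F_complete (u := fun n => x (F n.+1) - x (F n)).
    by move=> n; apply: xP; [exists n.+1 | exists n |].
  exists (x (F 0%N) + s) => _ [n _ <-].
  have := sP n; rewrite -(big_mkord xpredT (fun i => x (F i.+1) - x (F i))).
  by rewrite telescope_sumr // opprB addrA (addrC s).
Qed.

Lemma filtered_pseudocompact : pseudocompact A.
Proof.
have nb (n : nat) (x : A) : nbhs x [set y | F n (y - x)].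
  by apply/F_nbhs; exists n => y Fy /=; rewrite addrC addKr.
split.
- move=> x y xy; apply/eqP; rewrite -subr_eq0; apply/eqP; apply: F_sep => n.
  have [z [/= Fx Fy]] := xy _ _ (nb n x) (nb n y).
  by apply: (linear_set_trans (FL n) (y := z)) => //; apply: (linear_setBC (FL n)).
- move=> [a b] U /F_nbhs[n nU].
  exists ([set y | F n (y - a)], [set y | F n (y - b)]) => [|[y z] [/= Fy Fz]].
    by split; apply: nb.
  have -> : y + z = a + b + ((y - a) + (z - b)) by rewrite addrACA !subrKC.
  by apply: nU; apply: linear_setD.
- move=> [a b] U /F_nbhs[n nU].
  exists ([set y | F n (y - a)], [set y | F n (y - b)]) => [|[y z] [/= Fy Fz]].
    by split; apply: nb.
  have -> : y * z = a * b + ((y - a) * z + a * (z - b)).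
    by rewrite mulrBl mulrBr [_ + (a * z - _)]addrA subrK subrKC.
  by apply: nU; apply: linear_setD; [|apply: FMr|apply: FMl].
- move=> c x U /F_nbhs[n nU]; apply/F_nbhs; exists n => y Fy /=.
  by rewrite scalerDr; apply: nU; apply: (linear_setZ (FL n)).
- by exists (range F); apply: filtered_basis.
Qed.

Let left_unit x : F 1 x -> exists s, s * (1 - x) = 1.
Proof.
move=> Fx; have FX n : F n (x ^+ n).
  elim: n => [|n IH]; first by rewrite F0.
  by rewrite exprS F_mul; apply: mem_ideal_mul.
have [s sP] := F_complete FX; exists s; apply/eqP; rewrite -subr_eq0; apply/eqP.
apply: F_sep => n; rewrite -{1}[s](subrK (\sum_(i < n) x ^+ i)) mulrDl -addrA.
apply: (linear_setD (FL n)); first by apply: FMr.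
have -> : (\sum_(i < n) x ^+ i) * (1 - x) - 1 = - x ^+ n.
  have comm : GRing.comm (\sum_(i < n) x ^+ i) (1 - x).
    apply: commrB; first exact: commr1.
    by apply/commr_sym/commr_sum => i _; apply: commrX.
  by rewrite comm -[1 - x]opprB mulNr -subrX1 opprB addrAC subrr sub0r.
exact: linear_setN.
Qed.

(** If a maximal open left ideal [L] did not contain [x] in [F 1], then [L + A x] would
    contain [1], and so [L] would contain some [1 - c x], which is a unit. *)
Lemma filtered_jac : jac A = F 1.
Proof.
apply/seteqP; split=> [x Jx|x Fx L [lL oL L1 maxL]].
  rewrite chi_ker => v /=; have [c1 cM] := chi_mul v.
  have cL := chi_linear v.
  suff /Jx : max_open_left_ideal [set x | chi v x = 0] by [].
  split.
  - split=> [|y z /= cy cz|a y /= cy]; first exact: (lin_fun0 cL).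
      by rewrite /= (lin_funD cL) cy cz; apply: addr0.
    by rewrite cM cy mulr0.
  - rewrite openE => y /= cy; apply/F_nbhs; exists 1%N => z.
    by rewrite chi_ker => /(_ v) cz /=; rewrite (lin_funD cL) cy cz; apply: addr0.
  - by rewrite /= c1 => /eqP; rewrite oner_eq0.
  - move=> L [L0 LD LM] _ L1 sL; apply/seteqP; split=> // y Ly.
    apply: contrapT => /= /eqP cy; apply: L1.
    rewrite -(subrK ((chi v y)^-1 *: y) 1); apply: LD; last first.
      by rewrite algZM; apply: LM.
    apply: sL => /=; rewrite (lin_funB cL) (lin_funZ cL) c1.
    by rewrite -[X in _ - X]/((chi v y)^-1 * chi v y) mulVf // subrr.
have LL := left_ideal_linear lL.
apply: contrapT => nLx; pose L' := [set y | exists c, L (y - c * x)].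
have sL : L `<=` L' by move=> y Ly; exists 0; rewrite mul0r subr0.
have lL' : left_ideal L'.
  have [_ _ LM] := lL; split=> [|y z [c yc] [d zd]|a y [c yc]].
  - by exists 0; rewrite mul0r subrr; apply: LL.1.
  - by exists (c + d); rewrite mulrDl opprD addrACA; apply: linear_setD.
  - by exists (a * c); rewrite -mulrA -mulrBr; apply: LM.
have [[c Lc]|L'1] := pselect (L' 1).
  have [s sc] := left_unit (FMl c Fx).
  by apply: L1; rewrite -sc; have [_ _ LM] := lL; apply: LM.
apply: nLx; rewrite -(maxL L') //; first by exists 1; rewrite mul1r subrr; apply: LL.1.
move: oL; rewrite !openE => oL y L'y; apply/F_nbhs.
have /F_nbhs[n nL] := oL 0 LL.1; exists n => z /nL; rewrite add0r => /sL.
exact: (linear_setD (left_ideal_linear lL') L'y).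
Qed.

Lemma filtered_pointed : pointed_alg A.
Proof.
exists V, chi; split=> //.
- move=> v x U /= Ux; apply/F_nbhs; exists 1%N => y; rewrite chi_ker => /(_ v) cy /=.
  rewrite (lin_funD (chi_linear v)) cy [_ + _]addr0.
  exact: nbhs_singleton Ux.
- by rewrite filtered_jac.
- move=> g; exists (\sum_w g w *: e w) => v.
  rewrite (lin_fun_sum (chi_linear v)) (bigD1 v) //= big1 ?addr0.
    rewrite (lin_funZ (chi_linear v)) chi_e eqxx; exact: mulr1.
  move=> w wv; rewrite (lin_funZ (chi_linear v)) chi_e eq_sym (negbTE wv).
  exact: scaler0.
Qed.

Lemma filtered_jac2 : jac2 A = F 2.
Proof. by rewrite (F_mul 1) /jac2 filtered_jac. Qed.

Lemma filtered_fin : fin_codim (jac2 A).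
Proof. by rewrite filtered_jac2; apply: fin_span_codim. Qed.

End Filtered.

(** The images of the sets [cge n] satisfy the recognition principle in any quotient
    of [k[[Q]]] by a closed ideal [p^-1(0)] without terms of degree 0 and 1. *)
Section CpaQuotient.
Variables (k : fieldType) (Q : vquiver k) (A : topAlgType k) (p : cpa Q -> A).
Local Notation V := (vq_vert Q).
Hypothesis pA : alg_hom p.
Hypothesis p_onto : forall a, exists c, p c = a.
Hypothesis p_nbhs : forall c U, nbhs (p c) U <-> nbhs c [set x | U (p x)].
Hypothesis p_ker2 : forall c, p c = 0 -> cge 2 c.
Hypothesis p_closed : forall c, (forall n, exists2 b, cge n b & p (c + b) = 0) -> p c = 0.

Let F n := p @` @cge k Q n.

Let p_linear := pA.1.

Let F_ideal n : ideal (F n).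
Proof.
have [[c0 cD cM] cMr] := cge_ideal Q n.
split; first split.
- by exists 0; rewrite ?(alg_hom0 pA).
- by move=> _ _ [c nc <-] [d nd <-]; exists (c + d); [exact: cD | rewrite (alg_homD pA)].
- move=> a _ [c nc <-]; have [d <-] := p_onto a.
  by exists (d * c); [exact: cM | rewrite (alg_homM pA)].
- move=> a _ [c nc <-]; have [d <-] := p_onto a.
  by exists (c * d); [exact: cMr | rewrite (alg_homM pA)].
Qed.

Let F0 : F 0 = setT.
Proof. by apply/seteqP; split=> // a _; have [c <-] := p_onto a; exists c; rewrite ?cge0. Qed.

Let F_dec n : F n.+1 `<=` F n.
Proof. by move=> _ [c nc <-]; exists c => //; apply: cge_dec nc. Qed.

Let F_mul n : F n.+1 = ideal_mul (F 1) (F n).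
Proof.
rewrite /F cgeS; apply/seteqP; split=> [_ [c [s sP ->] <-]|].
  exists [seq (p x.1, p x.2) | x <- s].
    by move=> _ /mapP[x /sP[x1 x2] ->]; split; [exists x.1 | exists x.2].
  by rewrite big_map (alg_hom_sum pA); apply: eq_bigr => x _; rewrite (alg_homM pA).
apply: ideal_mul_sub.
  apply: (linear_set_image p_linear); apply: ideal_linear.
  by apply: ideal_mul_ideal; apply: cge_ideal.
move=> _ _ [c c1 <-] [d dn <-]; exists (c * d); last by rewrite (alg_homM pA).
exact: mem_ideal_mul.
Qed.

Let F_nbhs x U : nbhs x U <-> exists n, forall y, F n y -> U (x + y).
Proof.
have [c <-] := p_onto x; rewrite p_nbhs cge_nbhs; split=> -[n nU]; exists n.
  by move=> _ [b nb <-]; rewrite -(alg_homD pA); apply: nU.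
by move=> b nb; rewrite /= (alg_homD pA); apply: nU; exists b.
Qed.

Let F_sep x : (forall n, F n x) -> x = 0.
Proof.
have [c <-] := p_onto x => Fc; apply: p_closed => n; have [b nb pb] := Fc n.
exists (- b); first exact: (linear_setN (cge_linear Q n)).
by rewrite (alg_homB pA) pb subrr.
Qed.

Let F_complete (u : nat -> A) : (forall n, F n (u n)) ->
  exists s, forall n, F n (s - \sum_(i < n) u i).
Proof.
move=> /(_ _)/cid2-/all_sig[d] dP.
have [|s sP] := @cge_complete k Q d; first by move=> n; have [] := dP n.
exists (p s) => n; exists (s - \sum_(i < n) d i); first exact: sP.
rewrite (alg_homB pA) (alg_hom_sum pA); congr (_ - _).
by apply: eq_bigr => i _; have [] := dP i.
Qed.

Let F_span n : fin_span setT (F n).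
Proof.
have [T [v [_ span]]] := cge_span Q n; exists T, (p \o v); split=> // x _.
have [c <-] := p_onto x; have [l cl] := span c Logic.I; exists l.
exists (c - \sum_t l t *: v t) => //; rewrite (alg_homB pA) (alg_hom_sum pA).
by congr (_ - _); apply: eq_bigr => t _; rewrite (lin_funZ p_linear).
Qed.

Let lift a := sval (cid (p_onto a)).
Let liftK a : p (lift a) = a. Proof. exact: svalP (cid (p_onto a)). Qed.

Let chi (v : V) (a : A) : k := (lift a 0%N : {ffun V -> k}) v.

Let chiE v c : chi v (p c) = (c 0%N : {ffun V -> k}) v.
Proof.
have : cge 2 (lift (p c) - c).
  by apply: p_ker2; rewrite (alg_homB pA) liftK subrr.
move=> /(_ 0%N isT); rewrite cpa_subE => /eqP; rewrite subr_eq0 => /eqP E.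
by rewrite /chi E.
Qed.

Let chi_linear v : linear (chi v : A -> k^o).
Proof.
move=> a x y; have [[c <-] [d <-]] := (p_onto x, p_onto y).
rewrite -p_linear !chiE cpa_addE cpa_scaleE.
by rewrite [LHS]ffunE; congr (_ + _); rewrite [LHS]ffunE ffunE.
Qed.

Let chi_mul v : monoid_morphism (chi v).
Proof.
split; first by rewrite -(alg_hom1 pA) chiE [LHS]ffunE.
move=> x y; have [[c <-] [d <-]] := (p_onto x, p_onto y).
by rewrite -(alg_homM pA) !chiE cpa_mulE big_ord1 [LHS]ffunE.
Qed.

Let chi_ker : F 1 = [set x | forall v, chi v x = 0].
Proof.
apply/seteqP; split=> [_ [c c1 <-] v|x].
  by rewrite chiE c1 // ffunE.
have [c <-] := p_onto x => /= chic; exists c => //; apply/cge1E.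
by apply/ffunP => v; rewrite -chiE chic ffunE.
Qed.

Let chi_e v w : chi v (p (cpa_idem (Some w))) = (v == w)%:R.
Proof. by rewrite chiE ffunE. Qed.

Lemma cpa_quo_pseudocompact : pseudocompact A.
Proof. exact: filtered_pseudocompact F_ideal F_dec F_nbhs F_sep F_complete F_span. Qed.

Lemma cpa_quo_pointed : pointed_alg A.
Proof.
exact: (filtered_pointed F_ideal F0 F_mul F_nbhs F_sep F_complete chi_linear chi_mul chi_ker chi_e).
Qed.

Lemma cpa_quo_jac : jac A = p @` @cge k Q 1.
Proof.
exact: (filtered_jac F_ideal F0 F_mul F_nbhs F_sep F_complete chi_linear chi_mul chi_ker).
Qed.

Lemma cpa_quo_jac2 : jac2 A = p @` @cge k Q 2.
Proof.
exact: (filtered_jac2 F_ideal F0 F_mul F_nbhs F_sep F_complete chi_linear chi_mul chi_ker).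
Qed.

Lemma cpa_quo_fin : fin_codim (jac2 A).
Proof.
exact: (filtered_fin F_ideal F0 F_mul F_nbhs F_sep F_complete F_span chi_linear chi_mul chi_ker).
Qed.

End CpaQuotient.

Section CpaPalg.
Variables (k : fieldType) (Q : vquiver k).
Let C := cpa Q.

Let idA : alg_hom (id : C -> C). Proof. by do !split. Qed.
Let id_onto (a : C) : exists c, id c = a. Proof. by exists a. Qed.
Let id_nbhs (c : C) (U : set C) : nbhs (id c) U <-> nbhs c [set x | U (id x)].
Proof. by []. Qed.
Let id_ker2 (c : C) : id c = 0 -> cge 2 c.
Proof. by move=> ->; apply: (cge_linear Q 2).1. Qed.
Let id_closed (c : C) : (forall n, exists2 b, cge n b & id (c + b) = 0) -> id c = 0.
Proof.
move=> h; apply: cge_sep => n; have [b nb cb] := h n.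
rewrite -[c](addrK b) [c + b]cb sub0r; exact: (linear_setN (cge_linear Q n)).
Qed.

Definition cpa_palg : palg k := @Palg k (cpa Q)
  (cpa_quo_pseudocompact idA id_onto id_nbhs id_closed)
  (cpa_quo_pointed idA id_onto id_nbhs id_ker2 id_closed)
  (cpa_quo_fin idA id_onto id_nbhs id_ker2 id_closed).
Canonical cpa_palg.

Lemma jac_cpa : jac (cpa Q) = @cge k Q 1.
Proof. by rewrite (cpa_quo_jac idA id_onto id_nbhs id_ker2 id_closed) image_id. Qed.

Lemma jac2_cpa : jac2 (cpa Q) = @cge k Q 2.
Proof. by rewrite (cpa_quo_jac2 idA id_onto id_nbhs id_ker2 id_closed) image_id. Qed.

End CpaPalg.

Section IdealQuotient.
Variables (k : fieldType) (A : topAlgType k) (I : set A) (idI : ideal I).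

Definition ideal_submod : submod A :=
  Submod (ideal_linear idI).1 (ideal_linear idI).2.

Definition iquot : Type := lquot ideal_submod.
HB.instance Definition _ := GRing.Lmodule.on iquot.

Local Notation pi := (lquot_pi ideal_submod : A -> iquot).

Definition iquot_mul (X Y : iquot) : iquot :=
  pi ((repr (X : lquot ideal_submod) : A) * (repr (Y : lquot ideal_submod) : A)).

Lemma iquot_mulE x y : iquot_mul (pi x) (pi y) = pi (x * y).
Proof.
apply/lquot_piP => /=.
have [[_ ID IM] IMr] := idI; have := lquot_repr ideal_submod.
move=> r; rewrite -(subrKA (repr (lquot_pi ideal_submod x) * y)); apply: ID.
  by rewrite -mulrBr; apply/IM/r.
by rewrite -mulrBl; apply/IMr/r.
Qed.

Let ind (P : iquot -> Prop) : (forall x, P (pi x)) -> forall X, P X.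
Proof. exact: lquot_ind. Qed.

Let piD x y : pi (x + y) = pi x + pi y. Proof. exact: lquot_piD. Qed.

Lemma iquot_mulA : associative iquot_mul.
Proof. by elim/ind=> x; elim/ind=> y; elim/ind=> z; rewrite !iquot_mulE mulrA. Qed.
Lemma iquot_mul1l : left_id (pi 1) iquot_mul.
Proof. by elim/ind=> x; rewrite iquot_mulE mul1r. Qed.
Lemma iquot_mul1r : right_id (pi 1) iquot_mul.
Proof. by elim/ind=> x; rewrite iquot_mulE mulr1. Qed.
Lemma iquot_mulDl : left_distributive iquot_mul +%R.
Proof.
by elim/ind=> x; elim/ind=> y; elim/ind=> z; rewrite -piD !iquot_mulE mulrDl piD.
Qed.
Lemma iquot_mulDr : right_distributive iquot_mul +%R.
Proof.
by elim/ind=> x; elim/ind=> y; elim/ind=> z; rewrite -piD !iquot_mulE mulrDr piD.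
Qed.
HB.instance Definition _ := GRing.Zmodule_isPzRing.Build iquot
  iquot_mulA iquot_mul1l iquot_mul1r iquot_mulDl iquot_mulDr.

Let piM x y : pi (x * y) = pi x * pi y. Proof. by rewrite -iquot_mulE. Qed.

Let piZ (c : k) x : pi (c *: x) = c *: pi x. Proof. exact: linearZ. Qed.

Lemma iquot_scaleAl (c : k) (X Y : iquot) : c *: (X * Y) = (c *: X) * Y.
Proof. by elim/ind: X => x; elim/ind: Y => y; rewrite -piM -!piZ -piM talg_scalerAl. Qed.
Lemma iquot_scaleAr (c : k) (X Y : iquot) : c *: (X * Y) = X * (c *: Y).
Proof. by elim/ind: X => x; elim/ind: Y => y; rewrite -piM -!piZ -piM talg_scalerAr. Qed.
Definition iquot_open (U : set iquot) : Prop := open [set x | U (pi x)].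
Lemma iquot_openT : iquot_open setT. Proof. exact: openT. Qed.
Lemma iquot_openI (U U' : set iquot) : iquot_open U -> iquot_open U' ->
  iquot_open (U `&` U').
Proof. exact: openI. Qed.
Lemma iquot_open_bigU (J : Type) (f : J -> set iquot) : (forall i, iquot_open (f i)) ->
  iquot_open (\bigcup_i f i).
Proof. by move=> fo; apply: bigcup_open => i _; apply: fo. Qed.
HB.instance Definition _ := isOpenTopological.Build iquot
  iquot_openT iquot_openI iquot_open_bigU.

HB.instance Definition _ := PzRing_isAlgebra.Build k iquot
  (@scalerA k iquot) (@scale1r k iquot) (@scalerDr k iquot)
  (fun x a b => @scalerDl k iquot x a b) iquot_scaleAl iquot_scaleAr.

Definition iquot_alg : topAlgType k := iquot.

Definition iquot_pi : A -> iquot_alg := pi.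

Lemma iquot_pi_hom : alg_hom iquot_pi.
Proof. by split; [exact: linearP | split=> // x y; apply: piM]. Qed.

Lemma iquot_pi_onto X : exists x, iquot_pi x = X.
Proof. by elim/ind: X => x; exists x. Qed.

Lemma iquot_pi_ker x : iquot_pi x = 0 <-> I x.
Proof.
rewrite -[0 in X in X <-> _](linear0 (lquot_pi ideal_submod)).
by split=> [/lquot_piP|Ix]; rewrite ?subr0 //; apply/lquot_piP; rewrite subr0.
Qed.

End IdealQuotient.

Section CpaIdealQuotient.
Variables (k : fieldType) (Q : vquiver k) (I : set (cpa Q)) (relI : rel_ideal I).

Let idI : ideal I. Proof. by case: relI. Qed.
Let p := iquot_pi idI.
Let pA : alg_hom p. Proof. exact: iquot_pi_hom. Qed.

Let p_nbhs c U : nbhs (p c) U <-> nbhs c [set x | U (p x)].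
Proof.
rewrite nbhsE; split=> [[O [oO Oc] OU]|/cge_nbhs[n nU]].
  by rewrite nbhsE; exists [set x | O (p x)] => // x /OU.
exists (p @` [set x | cge n (x - c)]); last first.
  by move=> _ [x nx <-]; rewrite -[x](subrK c) addrC; apply: nU.
split; last by exists c => //=; rewrite subrr; apply: (cge_linear Q n).1.
have -> : open (p @` [set x : cpa Q | cge n (x - c)]) =
  open [set x | exists2 y, cge n (y - c) & p y = p x] by [].
rewrite openE => x [y ny yx]; apply/cge_nbhs; exists n => b nb /=.
exists (y + b); first by rewrite addrAC; apply: linear_setD (cge_linear Q n) _ _ ny nb.
by rewrite !(alg_homD pA) yx.
Qed.

Let p_ker2 c : p c = 0 -> cge 2 c.
Proof. by move=> /iquot_pi_ker Ic; have [_ _ I2] := relI; rewrite -jac2_cpa; apply: I2. Qed.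

Let p_closed c : (forall n, exists2 b, cge n b & p (c + b) = 0) -> p c = 0.
Proof.
move=> h; apply/iquot_pi_ker; have [_ cI _] := relI; apply: cI => U /cge_nbhs[n nU].
by have [b nb /iquot_pi_ker Icb] := h n; exists (c + b); split=> //; apply: nU.
Qed.

Definition iquot_palg : palg k := @Palg k (iquot_alg idI)
  (cpa_quo_pseudocompact pA (iquot_pi_onto (idI := idI)) p_nbhs p_closed)
  (cpa_quo_pointed pA (iquot_pi_onto (idI := idI)) p_nbhs p_ker2 p_closed)
  (cpa_quo_fin pA (iquot_pi_onto (idI := idI)) p_nbhs p_ker2 p_closed).

Lemma exists_cpa_quotient : exists (A : palg k) (p : cpa Q -> A),
  [/\ palg_morph p, forall a, exists c, p c = a, forall c, p c = 0 <-> I c,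
      jac A = p @` jac (cpa Q) & jac2 A = p @` jac2 (cpa Q)].
Proof.
have p_onto X := @iquot_pi_onto _ _ _ idI X.
have JE := cpa_quo_jac pA p_onto p_nbhs p_ker2 p_closed.
have J2E := cpa_quo_jac2 pA p_onto p_nbhs p_ker2 p_closed.
exists iquot_palg, p; rewrite jac_cpa jac2_cpa; split=> //.
  apply: palg_morphI => [//|a|b]; first by rewrite jac_cpa JE; exists a.
  by have [c <-] := p_onto b; exists c; rewrite subrr; have [] := left_ideal_jac iquot_palg.
by move=> c; apply: iquot_pi_ker.
Qed.
End CpaIdealQuotient.

(** * The universal property and the lifting property *)

Section Universal.
Variables (k : fieldType) (Q : vquiver k) (B : palg k).
Local Notation V := (vq_vert Q).
Local Notation S := (vqSigma Q).
Local Notation M := (vqArrows Q).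
Local Notation C := (cpa Q).
Variables (eps : V -> B) (tau : forall v w : V, vq_sp (Some v) (Some w) -> B).
Hypothesis epsO : orth_idems eps.
Hypothesis tauL : forall v w, linear (@tau v w).
Hypothesis tauE : forall v w x, @tau v w x = eps w * tau x * eps v.
Hypothesis tauJ : forall v w x, jac B (@tau v w x).

Let sg (s : S) : B := \sum_v (s : {ffun V -> k}) v *: eps v.
Let ar (y : M) : B := \sum_(p : V * V) tau (y p).

Let sgD s t : sg (s + t) = sg s + sg t.
Proof. by rewrite /sg -big_split /=; apply: eq_bigr => v _; rewrite ffunE scalerDl. Qed.

Let eps_sg v s : eps v * sg s = (s : {ffun V -> k}) v *: eps v.
Proof.
have [eM _] := epsO; rewrite /sg mulr_sumr (bigD1 v) //= big1 ?addr0 => [|w /negbTE wv].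
  by rewrite -talg_scalerAr eM eqxx.
by rewrite -talg_scalerAr eM eq_sym wv scaler0.
Qed.

Let sg_eps v s : sg s * eps v = (s : {ffun V -> k}) v *: eps v.
Proof.
have [eM _] := epsO; rewrite /sg mulr_suml (bigD1 v) //= big1 ?addr0 => [|w /negbTE wv].
  by rewrite -talg_scalerAl eM eqxx.
by rewrite -talg_scalerAl eM wv scaler0.
Qed.

Let sgM s t : sg (s * t) = sg s * sg t.
Proof.
rewrite [sg s in RHS]/sg mulr_suml; apply: eq_bigr => v _.
by rewrite -talg_scalerAl eps_sg scalerA ffunE.
Qed.

Let sg_const (c : k) : sg [ffun=> c] = c *: (1 : B).
Proof.
have [_ <-] := epsO; rewrite scaler_sumr; apply: eq_bigr => v _.
by rewrite ffunE.
Qed.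

Let arD y z : ar (y + z) = ar y + ar z.
Proof.
by rewrite /ar -big_split /=; apply: eq_bigr => p _; rewrite -(lin_funD (@tauL _ _)).
Qed.

Let ar_ract y s : ar (vqa_ract y s) = ar y * sg s.
Proof.
rewrite /ar mulr_suml; apply: eq_bigr => p _.
by rewrite (lin_funZ (@tauL _ _)) {2}tauE -mulrA eps_sg -talg_scalerAr -tauE.
Qed.

Let ar_lact s y : ar (s *: y) = sg s * ar y.
Proof.
rewrite /ar mulr_sumr; apply: eq_bigr => p _.
by rewrite (lin_funZ (@tauL _ _)) {2}tauE !mulrA sg_eps -!talg_scalerAl -tauE.
Qed.

Let ar_jac y : jac B (ar y).
Proof. by apply: (linear_set_sum (jac_linear B)). Qed.

Let ar_arrow v w (x : vq_sp (Some v) (Some w)) : ar (vq_arrow x) = tau x.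
Proof.
rewrite /ar (bigD1 (v, w)) //= big1 ?addr0 => [|p pvw].
  by rewrite /vq_arrow dfwithin.
by rewrite /vq_arrow dfwithout 1?eq_sym // (lin_fun0 (@tauL _ _)).
Qed.

(** The value on a representative of a tensor; that it does not depend on the
    representative is the compatibility of [ar] and [sg] with the actions. *)
Fixpoint univ_tens n : vqT Q n -> B :=
  match n return vqT Q n -> B with
  | 0 => sg
  | m.+1 => fun X => \sum_(p <- repr (X : tens (vqT Q m))) ar p.1 * @univ_tens m p.2
  end.

Let univ_seq n (u : seq (M * vqT Q n)) : B := \sum_(p <- u) ar p.1 * univ_tens p.2.

Let univ_seqP n u v :
  (forall X Y : vqT Q n, univ_tens (X + Y) = univ_tens X + univ_tens Y) ->
  (forall s (X : vqT Q n), univ_tens (s *: X) = sg s * univ_tens X) ->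
  @tens_eq k Q (vqT Q n) u v -> univ_seq u = univ_seq v.
Proof.
move=> uD uZ; rewrite /univ_seq; elim=> {u v}.
- by [].
- by move=> u v _ ->.
- by move=> u v w _ -> _.
- by move=> u u' v v' _ E _ E'; rewrite !big_cat /= E E'.
- by move=> u v; rewrite !big_cat /= addrC.
- move=> m; rewrite big_seq1 big_nil /=.
  have -> : ar 0 = 0 by apply: (addrI (ar 0)); rewrite -arD !addr0.
  by rewrite mul0r.
- by move=> x y m; rewrite !big_cons !big_nil !addr0 /= arD mulrDl.
- by move=> x m n'; rewrite !big_cons !big_nil !addr0 /= uD mulrDr.
- by move=> x s m; rewrite !big_seq1 /= ar_ract uZ mulrA.
Qed.

Let univ_tens_lin n :
  (forall X Y : vqT Q n, univ_tens (X + Y) = univ_tens X + univ_tens Y) /\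
  (forall s (X : vqT Q n), univ_tens (s *: X) = sg s * univ_tens X).
Proof.
elim: n => [|n [uD uZ]]; first by split; [exact: sgD | exact: sgM].
have piE u : univ_tens (tens_pi u : vqT Q n.+1) = univ_seq u.
  by apply: (univ_seqP uD uZ); apply: tens_repr.
split=> [X Y|s X].
  elim/(@tens_indpi k Q (vqT Q n)): X => u; elim/(@tens_indpi k Q (vqT Q n)): Y => v.
  by rewrite -[_ + _]/(tens_add _ _) tens_addE !piE /univ_seq big_cat.
elim/(@tens_indpi k Q (vqT Q n)): X => u.
rewrite -[_ *: _]/(tens_scale _ _) tens_scaleE !piE /univ_seq /tens_map big_map mulr_sumr.
by apply: eq_bigr => p _ /=; rewrite ar_lact mulrA.
Qed.

Let univ_tens0 n : univ_tens (0 : vqT Q n) = 0.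
Proof.
have [uD _] := univ_tens_lin n; apply: (addrI (univ_tens (0 : vqT Q n))).
by rewrite -uD !addr0.
Qed.

Let univ_ptens n x (t : vqT Q n) :
  univ_tens (ptens x t : vqT Q n.+1) = ar x * univ_tens t.
Proof.
have [uD uZ] := univ_tens_lin n.
apply: etrans (univ_seqP uD uZ (tens_repr [:: (x, t)])) _.
exact: big_seq1.
Qed.

Let univ_tensJ n (X : vqT Q n) : jpow B n (univ_tens X).
Proof.
elim: n X => [//|n IH] X; apply: (linear_set_sum (jpow_linear B n.+1)) => p _.
by rewrite jpowS; apply: mem_ideal_mul.
Qed.

Let psi (a : C) : B := sval (cid (jpow_complete (fun n => univ_tensJ (a n)))).

Let psiP (a : C) n : jpow B n (psi a - \sum_(i < n) univ_tens (a i)).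
Proof. by rewrite /psi; case: cid => s /=. Qed.

Let psi_eq (a : C) (b : B) :
  (forall n, jpow B n (b - \sum_(i < n) univ_tens (a i))) -> psi a = b.
Proof.
move=> bP; apply: jpow_sep_eq => n; apply: (linear_set_trans (jpow_linear B n) (psiP a n)).
exact: (linear_setBC (jpow_linear B n)).
Qed.

Let psi_linear : linear psi.
Proof.
move=> c a b; apply: psi_eq => n.
have -> : \sum_(i < n) univ_tens ((c *: a + b) i) =
  c *: \sum_(i < n) univ_tens (a i) + \sum_(i < n) univ_tens (b i).
  rewrite scaler_sumr -big_split /=; apply: eq_bigr => i _.
  have [uD uZ] := univ_tens_lin i.
  by rewrite cpa_addE cpa_scaleE uD uZ sg_const -talg_scalerAl mul1r.
by rewrite opprD addrACA -scalerBr; apply: (jpow_linear B n).2.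
Qed.

Let psi_sig s (a : C) : psi (cpa_sig s * a) = sg s * psi a.
Proof.
apply: psi_eq => n.
have -> : \sum_(i < n) univ_tens ((cpa_sig s * a) i) = sg s * \sum_(i < n) univ_tens (a i).
  rewrite mulr_sumr; apply: eq_bigr => i _; rewrite cpa_sig_mul.
  by have [_ ->] := univ_tens_lin i.
by rewrite -mulrBr; apply: jpowM_l.
Qed.

Let psi_arr y (a : C) : psi (cpa_arr y * a) = ar y * psi a.
Proof.
apply: psi_eq => -[|n] //.
have -> : \sum_(i < n.+1) univ_tens ((cpa_arr y * a) i) = ar y * \sum_(i < n) univ_tens (a i).
  rewrite big_ord_recl cpa_arr_mul0 univ_tens0 add0r mulr_sumr.
  by apply: eq_bigr => i _; rewrite -univ_ptens -cpa_arr_mul.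
by rewrite -mulrBr jpowS; apply: mem_ideal_mul.
Qed.

Let psi1 : psi 1 = 1.
Proof.
apply: psi_eq => -[|n] //.
rewrite big_ord_recl big1 => [|i _]; last exact: univ_tens0.
rewrite addr0 -[univ_tens _]/(sg [ffun=> 1]) sg_const scale1r subrr.
exact: (jpow_linear B n.+1).1.
Qed.

Let psi_sig1 s : psi (cpa_sig s) = sg s.
Proof. by rewrite -[cpa_sig s]mulr1 psi_sig psi1 mulr1. Qed.

Let psi_mul a b : psi (a * b) = psi a * psi b.
Proof.
apply: jpow_sep_eq => n; elim: n a => [//|n IH] a.
have [a' [aE _]] := cpa_decomp a; rewrite aE -cpa_sigE mulrDl.
rewrite !(lin_funD psi_linear) (mulrDl _ _ (psi b)) psi_sig psi_sig1 opprD addrACA subrr add0r !mulr_suml.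
rewrite !(lin_fun_sum psi_linear) mulr_suml -sumrB.
apply: (linear_set_sum (jpow_linear B n.+1)) => c _.
rewrite -mulrA cpa_arrowE !psi_arr -mulrA -mulrBr jpowS.
exact: mem_ideal_mul.
Qed.

(** The universal property of [k[[Q]]]: the values on the homogeneous components form a
    convergent series, because those of degree [n] lie in [J^n(B)]. *)
Lemma cpa_universal : exists f : C -> B, [/\ alg_hom f,
  forall a, jac C a -> jac B (f a), forall v, f (cpa_idem (Some v)) = eps v &
  forall v w (x : vq_sp (Some v) (Some w)), f (cpa_arrow x) = tau x].
Proof.
exists psi; split.
- by split; [exact: psi_linear | split; [exact: psi1 | exact: psi_mul]].
- move=> a; rewrite jac_cpa => /cge1E a0.
  have := psiP a 1; rewrite big_ord1 a0 univ_tens0 subr0 jpow1.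
  by [].
- move=> v; rewrite cpa_idemE psi_sig1 /sg.
  rewrite (bigD1 v) //= big1 ?addr0 => [|w /negbTE wv]; rewrite ffunE.
    by rewrite eqxx scale1r.
  by rewrite wv scale0r.
- by move=> v w x; rewrite cpa_arrowE -[cpa_arr _]mulr1 psi_arr psi1 mulr1 ar_arrow.
Qed.

End Universal.

(** Only a basis has to be lifted. *)
Lemma linear_lift (k : fieldType) (U : vectType k) (D B : lmodType k) (p : D -> B)
  (Z : set D) (g : U -> B) : linear p -> linear_set Z -> linear g ->
  (forall x, exists2 z, Z z & p z = g x) ->
  exists h : U -> D, linear h /\ forall x, Z (h x) /\ p (h x) = g x.
Proof.
move=> pL ZL gL ex; pose X := vbasis {: U}.
pose z i := sval (cid2 (ex X`_i)).
have zP i : Z (z i) /\ p (z i) = g X`_i by rewrite /z; case: cid2.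
exists (fun x => \sum_i coord X i x *: z i); split=> [a x y|x].
  rewrite scaler_sumr -big_split /=; apply: eq_bigr => i _.
  by rewrite linearP scalerDl scalerA.
split.
  by apply: (linear_set_sum ZL) => i _; apply: (linear_setZ ZL); have [] := zP i.
rewrite (lin_fun_sum pL) [in RHS](coord_vbasis (memvf x)) (lin_fun_sum gL).
by apply: eq_bigr => i _; rewrite (lin_funZ pL) (lin_funZ gL); have [_ ->] := zP i.
Qed.

Lemma alg_hom_orth (k : fieldType) (A B : palg k) (f : A -> B) (V : finType) (e : V -> A) :
  alg_hom f -> orth_idems e -> orth_idems (fun v => f (e v)).
Proof.
move=> fA [eM e1]; split=> [v w|].
  by rewrite -(alg_homM fA) eM; case: eqP => _; rewrite ?mulr1n ?mulr0n ?(alg_hom0 fA).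
by rewrite -(alg_hom_sum fA) e1 (alg_hom1 fA).
Qed.

Lemma cpa_orth (k : fieldType) (Q : vquiver k) :
  orth_idems (fun v => cpa_idem (Some v) : cpa Q).
Proof. exact: cpa_idem_orth. Qed.

Section Generators.
Variables (k : fieldType) (Q : vquiver k) (B : palg k) (f g : cpa Q -> B).
Hypotheses (fA : alg_hom f) (gA : alg_hom g).
Hypothesis gJ : forall a, jac (cpa Q) a -> jac B (g a).

Let diffE (a : cpa Q) (a' : arrow_index Q -> cpa Q) :
  a = \sum_v (a 0%N : {ffun _ -> k}) v *: cpa_idem (Some v) +
      \sum_b cpa_arrow (arrow_basis b) * a' b ->
  f a - g a =
    \sum_v (a 0%N : {ffun _ -> k}) v *: (f (cpa_idem (Some v)) - g (cpa_idem (Some v))) +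
    \sum_b ((f (cpa_arrow (arrow_basis b)) - g (cpa_arrow (arrow_basis b))) * f (a' b) +
            g (cpa_arrow (arrow_basis b)) * (f (a' b) - g (a' b))).
Proof.
move=> aE; rewrite {1 2}aE !(alg_homD fA) !(alg_homD gA) !(alg_hom_sum fA) !(alg_hom_sum gA).
rewrite opprD addrACA -!sumrB; congr (_ + _); apply: eq_bigr => i _.
  by rewrite (lin_funZ fA.1) (lin_funZ gA.1) scalerBr.
by rewrite (alg_homM fA) (alg_homM gA) mulrBl mulrBr addrA subrK.
Qed.

(** After peeling off [n] arrows, the difference of the two maps is seen to lie in
    [J^n(B)]. *)
Lemma cpa_hom_eq : (forall v, f (cpa_idem (Some v)) = g (cpa_idem (Some v))) ->
  (forall v w (x : vq_sp (Some v) (Some w)), f (cpa_arrow x) = g (cpa_arrow x)) -> f =1 g.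
Proof.
move=> fg0 fg1 a; apply: jpow_sep_eq => n; elim: n a => [//|n IH] a.
have [a' [aE _]] := cpa_decomp a; rewrite (diffE aE).
rewrite big1 ?add0r => [|v _]; last by rewrite fg0 subrr scaler0.
apply: (linear_set_sum (jpow_linear B n.+1)) => b _.
rewrite fg1 subrr mul0r add0r jpowS; apply: mem_ideal_mul => //.
by apply: gJ; rewrite jac_cpa; apply: cge_arrow.
Qed.

Lemma cpa_hom_sim1 :
  (forall v, jac B (f (cpa_idem (Some v)) - g (cpa_idem (Some v)))) ->
  (forall v w (x : vq_sp (Some v) (Some w)), jac2 B (f (cpa_arrow x) - g (cpa_arrow x))) ->
  sim1 f g.
Proof.
move=> fg0 fg1; have JL := jac_linear B; have J2L := @jac2_linear k B.
have fg_jac a : jac B (f a - g a).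
  have [a' [aE _]] := cpa_decomp a; rewrite (diffE aE).
  apply: (linear_setD JL); apply: (linear_set_sum JL) => i _.
    exact: (linear_setZ JL).
  apply: (linear_setD JL); first by apply: jacM_r; apply: jac2_jac; apply: fg1.
  by apply: jacM_r; apply: gJ; rewrite jac_cpa; apply: cge_arrow.
split=> // a; rewrite jac_cpa => /cge1E a0.
have [a' [aE _]] := cpa_decomp a; rewrite (diffE aE).
apply: (linear_setD J2L); apply: (linear_set_sum J2L) => i _.
  by rewrite a0 ffunE scale0r; apply: J2L.1.
apply: (linear_setD J2L); first by rewrite -jpow2; apply: jpowM_r; rewrite jpow2; apply: fg1.
apply: mem_ideal_mul => //.
by apply: gJ; rewrite jac_cpa; apply: cge_arrow.
Qed.

End Generators.

Section Lifting.
Variables (k : fieldType) (Q : vquiver k) (D B : palg k).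
Variables (p : D -> B) (f0 : cpa Q -> D) (f : cpa Q -> B).
Hypotheses (pA : alg_hom p) (f0A : alg_hom f0) (fA : alg_hom f).
Hypothesis p_onto : forall b, jac B b -> exists2 d, jac D d & p d = b.
Hypothesis f0J : forall a, jac (cpa Q) a -> jac D (f0 a).
Hypothesis fJ : forall a, jac (cpa Q) a -> jac B (f a).
Hypothesis sim_f : sim1 (p \o f0) f.

(** The central lifting property: a map [f0] to [D] whose composite with a surjection
    [p] is only similar to [f] can be corrected, within its class, to an exact lifting
    of [f]. The images of the vertices under [p \o f0] and [f] are conjugate by a unit
    of [B], which lifts to [D]; the arrows are corrected by liftings of elements of
    [J^2(B)], and cut to the right corners. *)
Lemma cpa_lift : exists h, [/\ alg_hom h, forall a, jac (cpa Q) a -> jac D (h a),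
  sim1 h f0 & forall a, p (h a) = f a].
Proof.
have p_onto2 b : jac2 B b -> exists2 d, jac2 D d & p d = b.
  have : jac2 B `<=` p @` jac2 D.
    apply: ideal_mul_sub => [|x y /p_onto[c Jc <-] /p_onto[d Jd <-]].
      exact: (linear_set_image pA.1 (left_ideal_linear (left_ideal_jac2 D))).
    by exists (c * d); [apply: mem_ideal_mul | rewrite (alg_homM pA)].
  by move=> h /h[d Jd <-]; exists d.
pose e v : D := f0 (cpa_idem (Some v)).
have eO : orth_idems e := alg_hom_orth f0A (cpa_orth Q).
have [w [u [Jw wu uw E]]] := orth_idems_conj (alg_hom_orth pA eO)
  (alg_hom_orth fA (cpa_orth Q)) (fun v => sim_f.1 (cpa_idem (Some v))).
have [W JW pW] := p_onto Jw; have [U [WU UW JU]] := jac_unit JW.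
have pU : p U = u.
  have pUw : p U * (1 + w) = 1.
    by rewrite -pW -(alg_hom1 pA) -(alg_homD pA) -(alg_homM pA) UW.
  by rewrite -[LHS]mulr1 -wu mulrA pUw mul1r.
pose eps v := (1 + W) * e v * U.
have epsO : orth_idems eps.
  have [eM e1] := eO; split=> [v v'|].
    rewrite /eps -!mulrA (mulrA U) UW mul1r (mulrA (e v)) eM.
    by case: eqP => _; rewrite ?mulr1n ?mulr0n ?mul0r ?mulr0.
  by rewrite -mulr_suml -mulr_sumr e1 mulr1 WU.
have peps v : p (eps v) = f (cpa_idem (Some v)).
  by rewrite E /eps !(alg_homM pA) (alg_homD pA) (alg_hom1 pA) pU pW.
have Jeps v : jac D (eps v - e v) by apply: inner_orbit_jac; exists W, U.
clearbody eps.
have J2L := @jac2_linear k D.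
have ex v v' : exists h : vq_sp (Some v) (Some v') -> D, linear h /\ forall x,
    jac2 D (h x) /\ p (h x) = f (cpa_arrow x) - p (f0 (cpa_arrow x)).
  apply: (linear_lift pA.1 J2L) => [a x y|x].
    have L := @cpa_arrow_linear k Q (Some v) (Some v').
    by rewrite L fA.1 f0A.1 pA.1 scalerBr opprD addrACA.
  have [d Jd dE] : exists2 d, jac2 D d & p d = p (f0 (cpa_arrow x)) - f (cpa_arrow x).
    by apply/p_onto2/sim_f.2; rewrite jac_cpa; apply: cge_arrow.
  exists (- d); first exact: (linear_setN J2L).
  by rewrite (alg_homN pA) dE opprB.
pose z v v' := sval (cid (ex v v')).
have zP v v' : linear (z v v') /\ forall x, jac2 D (z v v' x) /\
    p (z v v' x) = f (cpa_arrow x) - p (f0 (cpa_arrow x)).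
  exact: svalP (cid (ex v v')).
pose tau v v' (x : vq_sp (Some v) (Some v')) : D :=
  eps v' * (f0 (cpa_arrow x) + z v v' x) * eps v.
have Jarrow v v' (x : vq_sp (Some v) (Some v')) : jac D (f0 (cpa_arrow x)).
  by apply: f0J; rewrite jac_cpa; apply: cge_arrow.
have [h [hA hJ he hx]] : exists h : cpa Q -> D, [/\ alg_hom h,
    forall a, jac (cpa Q) a -> jac D (h a), forall v, h (cpa_idem (Some v)) = eps v &
    forall v v' (x : vq_sp (Some v) (Some v')), h (cpa_arrow x) = tau v v' x].
  apply: cpa_universal => // [v v' a x y|v v' x|v v' x].
  - have L := @cpa_arrow_linear k Q (Some v) (Some v').
    rewrite /tau L f0A.1 (zP v v').1 addrACA -scalerDr mulrDr mulrDl.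
    by rewrite -talg_scalerAr -talg_scalerAl.
  - by rewrite /tau orth_idems_corner.
  - apply: jacM_r; apply: jacM_l; apply: (linear_setD (jac_linear D)) => //.
    by apply: jac2_jac; have [] := (zP v v').2 x.
exists h; split=> //.
  apply: cpa_hom_sim1 => // [v|v v' x]; first by rewrite he.
  have -> : f0 (cpa_arrow x) = e v' * f0 (cpa_arrow x) * e v.
    by rewrite {1}cpa_arrow_idem !(alg_homM f0A).
  have [Jz _] := (zP v v').2 x.
  rewrite hx /tau mulrDr mulrDl addrAC; apply: (linear_setD J2L).
    by apply: jac2_sandwich.
  by rewrite -jpow2; apply: jpowM_r; apply: jpowM_l; rewrite jpow2.
have phA : alg_hom (p \o h).
  split=> [a x y|]; first by rewrite /= hA.1 pA.1.
  by split=> [|x y] /=; rewrite ?(alg_hom1 hA) ?(alg_hom1 pA) ?(alg_homM hA) ?(alg_homM pA).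
apply: (cpa_hom_eq (f := p \o h)) => // [v|v v' x] /=; first by rewrite he.
rewrite hx /tau !(alg_homM pA) !peps (alg_homD pA); have [_ ->] := (zP v v').2 x.
by rewrite addrC subrK -!(alg_homM fA) -cpa_arrow_idem.
Qed.

End Lifting.

(** * Maps of Vquivers and similar morphisms *)

Section QuiverMaps.
Variable k : fieldType.
Implicit Types Q R : vquiver k.

Lemma vq_sp_star Q (v w : option (vq_vert Q)) (x : vq_sp v w) :
  v = None \/ w = None -> x = 0.
Proof.
by move=> vw; move: x; case: vw => -> x; [apply: vq_sp_starl | apply: vq_sp_starr].
Qed.

Lemma cpa_arrow_inj_star Q (v w : option (vq_vert Q)) (x y : vq_sp v w) :
  cpa_arrow x = cpa_arrow y -> x = y.
Proof.
case: v w x y => [v|] [w|] x y E; first exact: cpa_arrow_inj E.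
all: by rewrite (vq_sp_star x) ?(vq_sp_star y); tauto.
Qed.

Lemma vqmap_ext Q R (r r' : vqmap Q R) : (forall v, vqm0 r v = vqm0 r' v) ->
  (forall v w (x : vq_sp v w), cpa_arrow (vqm1 r x) = cpa_arrow (vqm1 r' x)) -> r = r'.
Proof.
case: r r' => [r0 r1 a b c] [r0' r1' a' b' c'] /= /funext E0.
move: r1' a' b' c'; rewrite -{r0'}E0 => r1' a' b' c' E1.
have E : r1 = r1'.
  apply: functional_extensionality_dep => v; apply: functional_extensionality_dep => w.
  by apply: functional_extensionality_dep => x; apply: cpa_arrow_inj_star.
by move: c' {E1}; rewrite -E => c'; apply: vqmap_eq.
Qed.

Lemma vqmap_section Q R (r : vqmap Q R) :
  exists g : vq_vert R -> vq_vert Q, (forall w, vqm0 r (Some (g w)) = Some w) /\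
    forall v w, vqm0 r (Some v) = Some w -> v = g w.
Proof.
have /choice[g gP] : forall w, exists v, vqm0 r (Some v) = Some w /\
    forall v', vqm0 r (Some v') = Some w -> v' = v.
  by move=> w; have [v [rv uv]] := vqm0_bij r w; exists v; split=> // v' /uv.
by exists g; split=> [w|v w]; [have [] := gP w | have [_] := gP w; apply].
Qed.

(** The vertices of [Q] sent to [*] contribute nothing, the others correspond to the
    vertices of [R]. *)
Lemma vqmap_sum Q R (r : vqmap Q R) (A : zmodType) (F : option (vq_vert R) -> A) :
  F None = 0 -> \sum_v F (vqm0 r (Some v)) = \sum_w F (Some w).
Proof.
move=> F0; have [g [rg gr]] := vqmap_section r.
rewrite (bigID (fun v => vqm0 r (Some v) != None)) /= [X in _ + X]big1 ?addr0; last first.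
  by move=> v; rewrite negbK => /eqP->.
rewrite (reindex_omap g (fun v => vqm0 r (Some v))) /=; last first.
  by move=> v; case E: (vqm0 r (Some v)) => [w|] //= _; rewrite -(gr _ _ E).
by apply: eq_big => [w|w _]; rewrite rg ?eqxx.
Qed.

(** It means that [d] is similar to [k[[r]]]. Being stated on the generators, it
    composes without any mention of [k[[r]]]. *)
Definition tracks Q R (r : vqmap Q R) (d : cpa Q -> cpa R) : Prop :=
  (forall v, jac (cpa R) (d (cpa_idem v) - cpa_idem (vqm0 r v))) /\
  (forall v w (x : vq_sp v w), jac2 (cpa R) (d (cpa_arrow x) - cpa_arrow (vqm1 r x))).

Lemma exists_cpa_map Q R (r : vqmap Q R) : exists f, is_cpa_map r f.
Proof.
have [eM e1] := cpa_orth R.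
have [||v w x|v w x|f [fA fJ fe fx]] := @cpa_universal k Q (cpa_palg R)
  (fun v => cpa_idem (vqm0 r (Some v))) (fun v w x => cpa_arrow (vqm1 r x)).
- split=> [v w|].
    case Ev: (vqm0 r (Some v)) => [v'|]; last first.
      by rewrite cpa_idem_star mul0r mul0rn.
    case Ew: (vqm0 r (Some w)) => [w'|]; last first.
      rewrite cpa_idem_star mulr0; case: eqVneq => // vw.
      by move: Ew; rewrite -vw Ev.
    rewrite eM; congr (_ *+ nat_of_bool _).
    have [g [rg gr]] := vqmap_section r.
    by rewrite (gr _ _ Ev) (gr _ _ Ew); apply/eqP/eqP => [->|/(congr1 (fun v => vqm0 r (Some v)))] //;
      rewrite !rg => -[].
  by rewrite (vqmap_sum r (F := fun v => cpa_idem v : cpa R)) // cpa_idem_star.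
- move=> v w a x y; rewrite vqm1_linear; exact: cpa_arrow_linear.
- exact: cpa_arrow_idem.
- by rewrite jac_cpa; apply: cge_arrow.
exists f; split=> //; first exact: alg_hom_continuous.
- by case=> [v|]; rewrite ?fe // vqm0_star !cpa_idem_star (alg_hom0 fA).
- move=> v w x; case: v w x => [v|] [w|] x; first exact: fx.
  all: rewrite (vq_sp_star (vqm1 r x)) ?(vqm0_star r); last by tauto.
  all: rewrite (lin_fun0 (@cpa_arrow_linear _ _ _ _)); exact: (alg_hom0 fA).
Qed.

Lemma cpa_jac_sig Q (a : cpa Q) : jac (cpa Q) (a - cpa_sig (a 0%N)).
Proof. by rewrite jac_cpa; apply/cge1E; rewrite cpa_subE subrr. Qed.

Lemma cpa_map_morph Q R (r : vqmap Q R) f : is_cpa_map r f -> palg_morph f.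
Proof.
move=> [fA fc fe fx]; split=> // b; have [g [rg gr]] := vqmap_section r.
exists (\sum_w (b 0%N : {ffun _ -> k}) w *: cpa_idem (Some (g w))).
rewrite (alg_hom_sum fA).
under eq_bigr do rewrite (lin_funZ fA.1) fe rg.
rewrite -cpa_sigE; apply: (linear_setBC (jac_linear _)); exact: cpa_jac_sig.
Qed.

Lemma cpa_map_jac Q R (r : vqmap Q R) f : is_cpa_map r f ->
  forall a, jac (cpa Q) a -> jac (cpa R) (f a).
Proof. by move/cpa_map_morph/palg_morphJ. Qed.

Lemma tracks_sim1 Q R (r : vqmap Q R) (d f : cpa Q -> cpa R) : is_cpa_map r f -> alg_hom d ->
  tracks r d -> sim1 d f.
Proof.
move=> fr dA [d0 d1]; have [fA fc fe fx] := fr.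
apply: (cpa_hom_sim1 dA fA (cpa_map_jac fr)) => [v|v w x]; rewrite ?fe ?fx //.
Qed.

Lemma sim1_tracks Q R (r : vqmap Q R) (d f : cpa Q -> cpa R) : is_cpa_map r f ->
  sim1 d f -> tracks r d.
Proof.
move=> [fA fc fe fx] [d0 d1]; split=> [v|v w x]; rewrite -?fe -?fx //.
by apply: d1; rewrite jac_cpa; apply: cge_arrow.
Qed.

Lemma cpa_map_tracks Q R (r : vqmap Q R) f : is_cpa_map r f -> tracks r f.
Proof. by move=> fr; apply: sim1_tracks fr (sim1_refl f). Qed.

Lemma tracks_comp Q R T (s : vqmap R T) (r : vqmap Q R) (e : cpa R -> cpa T) d :
  palg_morph e -> tracks s e -> tracks r d -> tracks (vqmap_comp s r) (e \o d).
Proof.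
move=> em [e0 e1] [d0 d1]; have eA := pm_alg em.
split=> [v|v w x] /=.
  rewrite -(subrKA (e (cpa_idem (vqm0 r v)))) -(alg_homB eA).
  by apply: (linear_setD (jac_linear _)) => //; apply: palg_morphJ.
rewrite -(subrKA (e (cpa_arrow (vqm1 r x)))) -(alg_homB eA).
by apply: (linear_setD (jac2_linear _)) => //; apply: palg_morphJ2.
Qed.

Lemma cpa_onto_jac Q R (r : vqmap Q R) f : is_cpa_map r f ->
  (forall w w' (y : vq_sp (Some w) (Some w')), exists v v' (x : vq_sp v v'),
     cpa_arrow (vqm1 r x) = cpa_arrow y) ->
  forall b, jac (cpa R) b -> exists2 a, jac (cpa Q) a & f a = b.
Proof.
move=> fr r_onto b; have fm := cpa_map_morph fr; have [fA fc fe fx] := fr.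
rewrite -!jpow1; apply: (jpow_onto fA (palg_morphJ fm)) => [c|c Jc].
  have [a Ja] := pm_surj fm c; exists a; exact: (linear_setBC (jac_linear _)).
have [y yc] := cpa_deg01 c.
have c0 : c 0%N = 0 by move: Jc; rewrite jac_cpa => /cge1E.
have {}yc : jac2 (cpa R) (c - cpa_arr y).
  have E0 : cpa_sig (0 : vqSigma R) = 0 by apply: cpa_ext => -[].
  by rewrite jac2_cpa; move: yc; rewrite c0 E0 add0r.
have [a Ja fa] : exists2 a, jac (cpa Q) a & f a = cpa_arr y.
  rewrite [y]vq_arrowE cpa_arr_sum.
  elim/big_ind: _ => [|a1 a2 [b1 Jb1 <-] [b2 Jb2 <-]|[w w'] _].
  - by exists 0; rewrite ?(alg_hom0 fA) //; apply: (jac_linear _).1.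
  - by exists (b1 + b2); rewrite ?(alg_homD fA) //; apply: (linear_setD (jac_linear _)).
  - have [v [v' [x xE]]] := r_onto w w' (y (w, w')).
    exists (cpa_arrow x); first by rewrite jac_cpa; apply: cge_arrow.
    by rewrite fx xE.
by exists a => //; rewrite fa.
Qed.

End QuiverMaps.

(** * Morphisms of Vquivers with ideals *)

Section RelClass.
Variables (k : fieldType) (Q : vquiver k).
Implicit Types (d : cpa Q -> cpa Q) (I : set (cpa Q)).

Lemma id1_inv d : id1 d -> exists d', [/\ cancel d d', cancel d' d & id1 d'].
Proof.
move=> [dm d1]; have [d' [dK d'K dm' d1']] := sim1_id_bij (pm_alg dm) d1.
by exists d'.
Qed.

Lemma id1_id : id1 (id : cpa Q -> cpa Q).
Proof. by split; [apply: palg_morph_id | apply: sim1_refl]. Qed.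

Lemma id1_comp d e : id1 d -> id1 e -> id1 (d \o e).
Proof.
move=> [dm d1] [em e1]; split; first exact: palg_morph_comp.
exact: sim1_trans (sim1_compr em d1) e1.
Qed.

Lemma rel_class_refl I : rel_class I I.
Proof. by exists id; rewrite ?image_id //; apply: id1_id. Qed.

Lemma rel_class_image I d : id1 d -> rel_class (d @` I) = rel_class I.
Proof.
move=> d1; have [d' [dK d'K d1']] := id1_inv d1.
apply/seteqP; split=> _ [e e1 ->].
  by exists (e \o d); [apply: id1_comp | rewrite image_comp].
exists (e \o d'); first exact: id1_comp.
rewrite image_comp; apply/seteqP; split=> _ [x Ix <-]; exists x => //=; by rewrite dK.
Qed.

Lemma rel_class_eq I I' : rel_class I I' -> rel_class I' = rel_class I.
Proof. by move=> [d d1 ->]; apply: rel_class_image. Qed.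
End RelClass.

Section Morphisms.
Variable k : fieldType.
Implicit Types X Y : vqi k.

Lemma vqi_class_ex X : exists2 I, rel_ideal I & vqi_class (v := X) = rel_class I.
Proof. exact: vqi_classP. Qed.

Lemma vqi_class_refl X : exists2 I, rel_ideal I & vqi_class (v := X) I.
Proof. by have [I rI ->] := vqi_class_ex X; exists I => //; apply: rel_class_refl. Qed.

Lemma vqi_class_trans X I I' : vqi_class (v := X) I -> vqi_class (v := X) I' ->
  exists2 d, id1 d & I' = d @` I.
Proof.
have [I0 _ ->] := vqi_class_ex X => cI cI'.
by have : rel_class I I' by rewrite (rel_class_eq cI).
Qed.

(** A morphism similar to [k[[r]]] absorbs the automorphisms that [vqi_takes] allows on
    both sides, and such morphisms can be composed. *)
Lemma vqi_mor_tracks X Y (r : vqmap (vqi_quiver X) (vqi_quiver Y)) : vqi_mor r ->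
  forall I K, vqi_class (v := X) I -> vqi_class (v := Y) K ->
  exists d, [/\ palg_morph d, tracks r d & d @` I `<=` K].
Proof.
elim=> {X Y r} [X Y r [f fr [I' [K' [cI' cK' sK']]]] I K cI cK|
  X Y Z s r _ IHs _ IHr I L cI cL].
  have [d [dm d1] I'E] := vqi_class_trans cI cI'.
  have [e [em e1] KE] := vqi_class_trans cK' cK.
  have fm := cpa_map_morph fr.
  exists (e \o f \o d); split.
  - by apply: palg_morph_comp => //; apply: palg_morph_comp.
  - apply: (sim1_tracks fr); apply: sim1_trans (sim1_compr dm (sim1_compr fm e1)) _.
    exact: (sim1_compl fm d1).
  - move=> _ [x Ix <-]; rewrite KE; exists (f (d x)) => //; apply: sK'.
    by exists (d x) => //; rewrite I'E; exists x.
have [K rK cK] := vqi_class_refl Y.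
have [d [dm dr dK]] := IHr I K cI cK; have [e [em es eL]] := IHs K L cK cL.
exists (e \o d); split; [exact: palg_morph_comp | exact: tracks_comp |].
by move=> _ [x Ix <-]; apply: eL; exists (d x) => //; apply: dK; exists x.
Qed.

End Morphisms.

Section GraphQuiver.
Variables (k : fieldType) (Q R : vquiver k) (r : vqmap Q R).

Let sp v w : vectType k := (vq_sp v w * vq_sp (vqm0 r v) (vqm0 r w))%type.

Let sp_starl w (x : sp None w) : x = 0.
Proof.
case: x => x y; rewrite (vq_sp_starl x).
by rewrite (vq_sp_star y) // (vqm0_star r); left.
Qed.

Let sp_starr v (x : sp v None) : x = 0.
Proof.
case: x => x y; rewrite (vq_sp_starr x).
by rewrite (vq_sp_star y) // (vqm0_star r); right.
Qed.

(** The vertices of [Q], with the arrows of [Q] and those of [R]. Through it, [r]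
    factors as an injection followed by a map which is onto on arrows. *)
Definition graph_quiver : vquiver k := Vquiver sp_starl sp_starr.
Local Notation P := graph_quiver.

Let incl1 (v w : option (vq_vert Q)) (x : @vq_sp k Q v w) : @vq_sp k P v w := (x, 0).

Let incl1_linear v w : linear (@incl1 v w).
Proof.
move=> a x y; apply: (@injective_projections (vq_sp v w) (vq_sp (vqm0 r v) (vqm0 r w))) => //=.
by rewrite scaler0 addr0.
Qed.

Let proj1 (v w : option (vq_vert Q)) (x : @vq_sp k P v w) : vq_sp (vqm0 r v) (vqm0 r w) := vqm1 r x.1 + x.2.

Let proj1_linear v w : linear (@proj1 v w).
Proof.
move=> a x y; rewrite /proj1 /= vqm1_linear scalerDr.
by rewrite addrACA.
Qed.

Definition graph_incl : vqmap Q P :=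
  @Vqmap k Q P id incl1 erefl (@vqm0_bij k Q Q (vqmap_id Q)) incl1_linear.

Definition graph_proj : vqmap P R :=
  @Vqmap k P R (vqm0 r) proj1 (vqm0_star r) (vqm0_bij r) proj1_linear.

Lemma graph_factor : vqmap_comp graph_proj graph_incl = r.
Proof. by apply: vqmap_ext => // v w x /=; rewrite /proj1 addr0. Qed.

Lemma graph_proj_onto w w' (y : vq_sp (Some w) (Some w')) :
  exists v v' (x : @vq_sp k P v v'), cpa_arrow (vqm1 graph_proj x) = cpa_arrow y.
Proof.
have [g [rg _]] := vqmap_section r; exists (Some (g w)), (Some (g w')).
have : exists z : vq_sp (vqm0 r (Some (g w))) (vqm0 r (Some (g w'))), cpa_arrow z = cpa_arrow y.
  by rewrite !rg; exists y.
move=> [z zy]; exists ((0, z) : @vq_sp k P (Some (g w)) (Some (g w'))).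
by rewrite -zy /= /proj1 /= (lin_fun0 (@vqm1_linear _ _ _ r _ _)) add0r.
Qed.

(** The extension of [d] is [d] on the arrows of [Q] and the inclusion on those of [R],
    which have to be cut to the corners of the idempotents [d (cpa_idem v)]. *)
Lemma graph_extend d : palg_morph d -> tracks r d ->
  exists t : cpa P -> cpa R, [/\ palg_morph t, tracks graph_proj t &
    forall f, is_cpa_map graph_incl f -> forall a, t (f a) = d a].
Proof.
move=> dm [d0 d1]; have dA := pm_alg dm.
have [p pr] := exists_cpa_map graph_proj.
pose eps (v : vq_vert P) : cpa R := d (cpa_idem (Some v : option (vq_vert Q))).
have epsO : orth_idems eps by apply: (alg_hom_orth dA (cpa_orth Q)).
have daE (v w : vq_vert Q) (x : vq_sp (Some v) (Some w)) :
    d (cpa_arrow x) = eps w * d (cpa_arrow x) * eps v.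
  by rewrite -!(alg_homM dA) -cpa_arrow_idem.
pose tau (v w : vq_vert P) (x : @vq_sp k P (Some v) (Some w)) : cpa R :=
  d (cpa_arrow x.1) + eps w * cpa_arrow x.2 * eps v.
have [|||t [tA tJ te tx]] := @cpa_universal k P (cpa_palg R) eps tau epsO.
- move=> v w a x y; rewrite /tau.
  have -> : (a *: x + y).1 = a *: x.1 + y.1 by [].
  have -> : (a *: x + y).2 = a *: x.2 + y.2 by [].
  rewrite (@cpa_arrow_linear k Q (Some v) (Some w)) dA.1.
  rewrite (@cpa_arrow_linear k R (vqm0 r (Some v)) (vqm0 r (Some w))).
  by rewrite mulrDr mulrDl scalerDr -talg_scalerAr -talg_scalerAl addrACA.
- move=> v w x; rewrite /tau mulrDr mulrDl -daE; congr (_ + _).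
  by rewrite orth_idems_corner.
- move=> v w x; apply: (linear_setD (jac_linear _)).
    by apply: (palg_morphJ dm); rewrite jac_cpa; apply: cge_arrow.
  by apply: jacM_r; apply: jacM_l; rewrite jac_cpa; apply: cge_arrow.
have tp : sim1 t p.
  have [pA pc pe px] := pr.
  apply: (cpa_hom_sim1 tA pA (cpa_map_jac pr)) => [v|v w x].
    by rewrite te pe; apply: d0.
  rewrite tx px /tau (_ : vqm1 graph_proj x = vqm1 r x.1 + x.2) //.
  rewrite (lin_funD (@cpa_arrow_linear k R _ _)) opprD addrACA.
  apply: (linear_setD (jac2_linear _)); first exact: d1.
  rewrite {2}(cpa_arrow_idem x.2); apply: jac2_sandwich; [exact: d0 | exact: d0 |].
  by rewrite jac_cpa; apply: cge_arrow.
exists t; split; [exact: sim1_morph tA tp (cpa_map_morph pr) | exact: sim1_tracks pr tp |].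
move=> f fr; have [fA fc fe fx] := fr.
have tfA : alg_hom (t \o f).
  split=> [a x y|]; first by rewrite /= fA.1 tA.1.
  by split=> [|x y] /=; rewrite ?(alg_hom1 fA) ?(alg_hom1 tA) ?(alg_homM fA) ?(alg_homM tA).
apply: (cpa_hom_eq tfA dA (palg_morphJ dm)) => [v|v w x].
  by rewrite /= fe te.
rewrite [LHS](_ : _ = t (f (cpa_arrow x))) // fx (tx v w) /tau.
have -> : (vqm1 graph_incl x).1 = x by [].
have -> : (vqm1 graph_incl x).2 = 0 by [].
have -> : cpa_arrow (0 : vq_sp (vqm0 r (Some v)) (vqm0 r (Some w))) = 0.
  exact: (lin_fun0 (@cpa_arrow_linear _ _ _ _)).
by rewrite mulr0 mul0r addr0.
Qed.

End GraphQuiver.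

Section ClosedIdeals.
Variables (k : fieldType).

Lemma ideal_preimage (A B : topAlgType k) (f : A -> B) (K : set B) :
  alg_hom f -> ideal K -> ideal [set x | K (f x)].
Proof.
move=> fA [[K0 KD Kl] Kr]; split; first split=> [|x y fx fy|a x fx] /=.
- by rewrite (alg_hom0 fA).
- by rewrite (alg_homD fA); apply: KD.
- by rewrite (alg_homM fA); apply: Kl.
- by move=> a x fx /=; rewrite (alg_homM fA); apply: Kr.
Qed.

Lemma closed_preimage (A B : topAlgType k) (f : A -> B) (K : set B) :
  continuous f -> closed K -> closed [set x | K (f x)].
Proof. by move=> fc cK; apply: (closed_comp _ cK) => x _; apply: fc. Qed.

Definition closed_ideal_gen (A : topAlgType k) (X : set A) : set A :=
  [set x | forall L, ideal L -> closed L -> X `<=` L -> L x].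

Lemma closed_ideal_gen_sub (A : topAlgType k) (X L : set A) :
  ideal L -> closed L -> X `<=` L -> closed_ideal_gen X `<=` L.
Proof. by move=> iL cL sL x; apply. Qed.

Lemma sub_closed_ideal_gen (A : topAlgType k) (X : set A) : X `<=` closed_ideal_gen X.
Proof. by move=> x Xx L _ _; apply. Qed.

Lemma closed_ideal_gen_ideal (A : topAlgType k) (X : set A) : ideal (closed_ideal_gen X).
Proof.
split; first split=> [L [[L0 _ _] _] //|x y Xx Xy L iL cL sL|a x Xx L iL cL sL].
- by have [[_ LD _] _] := iL; apply: LD; [apply: Xx | apply: Xy].
- by have [[_ _ Ll] _] := iL; apply: Ll; apply: Xx.
- by move=> a x Xx L iL cL sL; have [_ Lr] := iL; apply: Lr; apply: Xx.
Qed.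

Lemma closed_ideal_gen_closed (A : topAlgType k) (X : set A) : closed (closed_ideal_gen X).
Proof.
move=> x clx L iL cL sL; apply: (cL) => U /clx[y [Xy Uy]].
by exists y; split=> //; apply: Xy.
Qed.

End ClosedIdeals.

Section MorOfTracks.
Variable k : fieldType.
Implicit Types X Y : vqi k.

Lemma closed_jac2 (Q : vquiver k) : closed (jac2 (cpa Q)).
Proof.
move=> a; rewrite jac2_cpa => cl.
have [|b [/= b2 ab]] := cl [set x | cge 2 (x - a)].
  by apply/cge_nbhs; exists 2%N => b b2 /=; rewrite addrC addKr.
by apply: (linear_set_congr (cge_linear Q 2)) b2; apply: (linear_setBC (cge_linear Q 2)).
Qed.

(** In general [d] is not the composite of [k[[r]]] with automorphisms similar to the
    identity: an arrow killed by [r] may be sent by [d] to a path outside the image of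
    [k[[r]]]. After factoring [r] through its graph, [k[[graph_incl]]] is fine as it
    stands, and the extension [t] of [d] differs from [k[[graph_proj]]] by an
    automorphism, because the latter is onto. The intermediate relation ideal is
    generated by the image of [I]. *)
Lemma tracks_vqi_mor X Y (r : vqmap (vqi_quiver X) (vqi_quiver Y)) d I K :
  palg_morph d -> tracks r d -> vqi_class (v := X) I -> vqi_class (v := Y) K ->
  d @` I `<=` K -> vqi_mor r.
Proof.
move=> dm dr cI cK dIK; set P := graph_quiver r.
have [f fr] := exists_cpa_map (graph_incl r); have [fA fc _ _] := fr.
have fm := cpa_map_morph fr.
have [p pr] := exists_cpa_map (graph_proj r); have [pA pc _ _] := pr.
have [t [tm tr tf]] := graph_extend dm dr.
have rel X' L : vqi_class (v := X') L -> rel_ideal L.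
  have [L0 [iL cL sL] ->] := vqi_class_ex X' => -[e e1 ->].
  have [e' [eK e'K [em' _]]] := id1_inv e1; have [em _] := e1.
  have -> : e @` L0 = [set x | L0 (e' x)].
    apply/seteqP; split=> [_ [x Lx <-] /=|x Lx]; first by rewrite eK.
    by exists (e' x); rewrite ?e'K.
  split; [exact: ideal_preimage (pm_alg em') iL | exact: closed_preimage (pm_cont em') cL |].
  by move=> x /sL Jx; rewrite -(e'K x); apply: palg_morphJ2.
have [iI cI' sI] := rel _ _ cI; have [iK cK' sK] := rel _ _ cK.
pose L := closed_ideal_gen (f @` I).
have rL : rel_ideal L.
  split; [exact: closed_ideal_gen_ideal | exact: closed_ideal_gen_closed |].
  apply: closed_ideal_gen_sub; [by rewrite -jpow2; apply: jpow_ideal | exact: closed_jac2 |].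
  by move=> _ [x /sI Jx <-]; apply: palg_morphJ2.
have tL : t @` L `<=` K.
  move=> _ [x Lx <-]; apply: (Lx [set x | K (t x)]).
  - exact: ideal_preimage (pm_alg tm) iK.
  - exact: closed_preimage (pm_cont tm) cK'.
  - by move=> _ [y Iy <-] /=; rewrite (tf f fr); apply: dIK; exists y.
have pt : sim1 (p \o id) t by apply/sim1_sym/(tracks_sim1 pr (pm_alg tm) tr).
have [h [hA hJ h1 ht]] := cpa_lift (f0 := id) pA (pm_alg (palg_morph_id _)) (pm_alg tm)
  (cpa_onto_jac pr (@graph_proj_onto _ _ _ r)) (fun _ => id)
  (palg_morphJ tm) pt.
have h1' : id1 h by split=> //; apply: sim1_morph hA h1 (palg_morph_id _).
have cP : is_rel_class (rel_class L) by exists L.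
pose XP : vqi k := @Vqi k P _ cP.
rewrite -(graph_factor r).
apply: (@vqi_mor_comp k X XP Y); apply: vqi_mor_takes.
  exists p => //; exists (h @` L), K; split=> //; first by exists h.
  by move=> _ [_ [x Lx <-] <-]; rewrite ht; apply: tL; exists x.
exists f => //; exists I, L; split=> //; first exact: rel_class_refl.
exact: sub_closed_ideal_gen.
Qed.

End MorOfTracks.

(** * The counit *)

Section PiJ2.
Variables (k : fieldType) (A : palg k).

Lemma piJ2P (x y : A) : piJ2 A x = piJ2 A y <-> jac2 A (x - y).
Proof. exact: lquot_piP. Qed.

Lemma piJP (x y : A) : piJ A x = piJ A y <-> jac A (x - y).
Proof. exact: lquot_piP. Qed.

Lemma piJ2_linear : linear (piJ2 A).
Proof. exact: lquot_pi_is_linear. Qed.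

Lemma piJ_linear : linear (piJ A).
Proof. exact: lquot_pi_is_linear. Qed.

Lemma gq_valP (v w : option (vq_vert (gq A))) (x : vq_sp v w) :
  exists2 j, jac A j & gq_val x = piJ2 A (gq_rep w * j * gq_rep v).
Proof. by have /asboolP := gq_cosetP (x : gq_space (gq_rep v) (gq_rep w)). Qed.

Lemma gq_val_inj (v w : option (vq_vert (gq A))) : injective (@gq_val k A v w).
Proof. exact: val_inj. Qed.

Lemma gq_val_star (v w : option (vq_vert (gq A))) (x : vq_sp v w) :
  v = None \/ w = None -> gq_val x = 0.
Proof.
have [j _ ->] := gq_valP x; case=> ->; rewrite /= ?mulr0 ?mul0r; exact: (lin_fun0 piJ2_linear).
Qed.

Lemma gq_val_linear (v w : option (vq_vert (gq A))) : linear (@gq_val k A v w).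
Proof. by []. Qed.

Lemma gq_val_arrow (v w v' w' : option (vq_vert (gq A))) (x : vq_sp v w) (y : vq_sp v' w') :
  v = v' -> w = w' -> gq_val x = gq_val y -> cpa_arrow x = cpa_arrow y.
Proof.
move=> vv' ww'; move: y; rewrite -{v'}vv' -{w'}ww' => y /gq_val_inj ->.
by [].
Qed.

Lemma gq_rep_jac_inj (v w : option (vq_vert (gq A))) :
  jac A (gq_rep v - gq_rep w) -> v = w.
Proof.
have [chi [chiL _ JE chi_rep]] := gq_points A.
have chiE u o : chi u (gq_rep o) = (Some u == o)%:R.
  by case: o => [o|]; [rewrite chi_rep (inj_eq Some_inj) | exact: (lin_fun0 (chiL u))].
rewrite JE => E; have {}E u : (Some u == v)%:R = (Some u == w)%:R :> k.
  by rewrite -!chiE; apply/eqP; rewrite -subr_eq0 -(lin_funB (chiL u)); apply/eqP; apply: E.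
have nz : (1 : k) != 0 := oner_neq0 k.
case: v w E => [v|] [w|] E //.
- have := E v; rewrite eqxx; case: eqP => // _ /eqP.
  by rewrite (negbTE nz).
- by have := E v; rewrite eqxx => /eqP; rewrite (negbTE nz).
- by have := E w; rewrite eqxx => /esym/eqP; rewrite (negbTE nz).
Qed.

End PiJ2.

Section Counit.
Variables (k : fieldType) (A : palg k).
Local Notation V := (vq_vert (gq A)).
Local Notation C := (cpa (gq A)).

(** The representatives of the counit, described by their classes modulo [J(A)] and
    [J^2(A)] on generators instead of splittings. *)
Definition is_counit (f : C -> A) : Prop :=
  [/\ palg_morph f, forall v, jac A (f (cpa_idem v) - gq_rep v) &
      forall v w (x : vq_sp v w), piJ2 A (f (cpa_arrow x)) = gq_val x].

Lemma is_counitI (f : C -> A) : palg_morph f ->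
  (forall v : V, jac A (f (cpa_idem (Some v)) - gq_rep (Some v))) ->
  (forall (v w : V) (x : vq_sp (Some v) (Some w)), piJ2 A (f (cpa_arrow x)) = gq_val x) ->
  is_counit f.
Proof.
move=> fm f0 f1; have fA := pm_alg fm; split=> // [[v|] //|v w x].
  rewrite cpa_idem_star (alg_hom0 fA) subrr; exact: (jac_linear A).1.
case: v w x => [v|] [w|] x; first exact: f1.
all: rewrite gq_val_star ?cpa_arrow_star; [|by tauto..].
all: by rewrite (alg_hom0 fA) (lin_fun0 (@piJ2_linear k A)).
Qed.

Lemma is_counit_sim1 f g : is_counit f -> is_counit g -> sim1 f g.
Proof.
move=> [fm f0 f1] [gm g0 g1].
apply: (cpa_hom_sim1 (pm_alg fm) (pm_alg gm) (palg_morphJ gm)) => [v|v w x].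
  apply: (linear_set_trans (jac_linear A) (f0 _)).
  exact: (linear_setBC (jac_linear A) (g0 _)).
by apply/piJ2P; rewrite f1 g1.
Qed.

Lemma sim1_is_counit f g : palg_morph f -> sim1 f g -> is_counit g -> is_counit f.
Proof.
move=> fm [fg0 fg1] [gm g0 g1]; split=> // [v|v w x].
  exact: (linear_set_trans (jac_linear A) (fg0 _) (g0 _)).
by rewrite -g1; apply/piJ2P/fg1; rewrite jac_cpa; apply: cge_arrow.
Qed.

Lemma counit_of_is_counit s t f : alg_splitting s -> bimod_splitting s t ->
  counit_of s t f -> palg_morph f -> is_counit f.
Proof.
move=> _ [_ tK _ _] [fA _ fe fx] fm; apply: is_counitI => // [v|v w x].
  apply/gq_rep_mem; last by have [] := fe v.
  by rewrite -(alg_homM fA) (orth_idemsM _ (cpa_orth (gq A))).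
have [j Jj xE] := gq_valP x; rewrite fx xE; apply: tK.
by apply: jacM_r; apply: jacM_l.
Qed.

(** The splitting [s] has the chosen idempotents as image; [t] is obtained by lifting a
    basis of each corner of [J(A) / J^2(A)], and the counit by the universal property
    of the path algebra. *)
Lemma exists_counit : exists s t f,
  [/\ alg_splitting s, bimod_splitting s t, counit_of s t f & is_counit f].
Proof.
have [chi [chiL chiM JE chi_rep]] := gq_points A.
pose e v : A := gq_rep (Some v : option V).
have eO : orth_idems e := gq_rep_orth A; have [eM e1] := eO.
have ee v : e v * e v = e v by apply: orth_idemsM eO.
have JL := jac_linear A; have J2L := @jac2_linear k A.
have repr_jac a : jac A (repr (piJ A a) - a) by exact: (lquot_repr (jac_submod A) a).
have repr_jac2 a : jac2 A (repr (piJ2 A a) - a) by exact: (lquot_repr (jac2_submod A) a).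
have chi_jac v a b : jac A (a - b) -> chi v a = chi v b.
  rewrite JE => /(_ v) /=; rewrite (lin_funB (chiL v)) => /eqP.
  by rewrite subr_eq0 => /eqP.
pose s (X : quoJ A) : A := \sum_v chi v (repr X) *: e v.
have sE a : s (piJ A a) = \sum_v chi v a *: e v.
  by apply: eq_bigr => v _; rewrite (chi_jac _ _ _ (repr_jac a)).
have chi_s v a : chi v (s (piJ A a)) = chi v a.
  rewrite sE (lin_fun_sum (chiL v)) (bigD1 v) //= big1 ?addr0 => [|w wv].
    by rewrite (lin_funZ (chiL v)) chi_rep eqxx; apply: mulr1.
  by rewrite (lin_funZ (chiL v)) chi_rep eq_sym (negbTE wv); apply: mulr0.
have s_mul a b : (\sum_v chi v a *: e v) * (\sum_v chi v b *: e v) =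
    \sum_v (chi v a * chi v b) *: e v.
  rewrite mulr_suml; apply: eq_bigr => v _; rewrite mulr_sumr (bigD1 v) //= big1 ?addr0.
    by rewrite -talg_scalerAl -talg_scalerAr ee scalerA.
  by move=> w wv; rewrite -talg_scalerAl -talg_scalerAr eM eq_sym (negbTE wv) !scaler0.
have chi1 v : chi v 1 = 1.
  have := chiM v (e v) 1; rewrite mulr1 chi_rep eqxx mul1r => <-.
  by [].
have sS : alg_splitting s.
  split.
  - move=> c X Y; rewrite -[X]lquot_reprK -[Y]lquot_reprK -(@piJ_linear k A) !sE.
    rewrite scaler_sumr -big_split /=; apply: eq_bigr => v _.
    by rewrite chiL scalerA -scalerDl.
  - by rewrite sE -[RHS]e1; apply: eq_bigr => v _; rewrite chi1 scale1r.
  - by move=> a b; rewrite !sE s_mul; apply: eq_bigr => v _; rewrite chiM.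
  - move=> X; rewrite -[X]lquot_reprK; apply/piJP; rewrite JE => v /=.
    by rewrite (lin_funB (chiL v)) chi_s subrr.
(* Liftings of the corners to [J(A)], not yet in the corners of [A]. *)
have ex v w : exists h : vq_sp (Some v : option V) (Some w) -> A, linear h /\
    forall x, jac A (h x) /\ piJ2 A (h x) = gq_val x.
  apply: (linear_lift (p := piJ2 A)) => // [|x]; first exact: piJ2_linear.
  have [j Jj xE] := gq_valP x; exists (gq_rep (Some w) * j * gq_rep (Some v)) => //.
  by apply: jacM_r; apply: jacM_l.
pose h v w := sval (cid (ex v w)).
have hP v w : linear (h v w) /\ forall x, jac A (h v w x) /\ piJ2 A (h v w x) = gq_val x.
  exact: svalP (cid (ex v w)).
pose tau v w (x : vq_sp (Some v : option V) (Some w)) : A := e w * h v w x * e v.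
have tauL v w : linear (@tau v w).
  by move=> a x y; rewrite /tau (hP v w).1 mulrDr mulrDl -talg_scalerAr -talg_scalerAl.
have tauE v w x : @tau v w x = e w * tau v w x * e v.
  by rewrite /tau orth_idems_corner.
have tauJ v w x : jac A (@tau v w x).
  by apply: jacM_r; apply: jacM_l; have [] := (hP v w).2 x.
have tauK v w x : piJ2 A (@tau v w x) = gq_val x.
  have [j Jj xE] := gq_valP x; rewrite xE; apply/piJ2P.
  rewrite -[gq_rep _ * j * _](orth_idems_corner v w j eO).
  rewrite -mulrBl -mulrBr -jpow2; apply: jpowM_r; apply: jpowM_l; rewrite jpow2.
  by apply/piJ2P; rewrite -xE; have [] := (hP v w).2 x.
(* The component of a class in a corner; outside [J(A) / J^2(A)], where [t] is not
   constrained, the default is [0]. *)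
have memP v w (X : quoJ2 A) : gq_mem (gq_rep (Some v : option V)) (gq_rep (Some w : option V))
    (if `[< exists2 j, jac A j & X = piJ2 A j >] then piJ2 A (e w * repr X * e v) else 0).
  apply/asboolP; case: ifP => [/asboolP[j Jj ->]|_]; last first.
    exists 0; [exact: JL.1 | by rewrite mulr0 mul0r (lin_fun0 (@piJ2_linear k A))].
  exists (repr (piJ2 A j)) => //; apply: (linear_set_congr JL _ Jj).
  exact: jac2_jac (repr_jac2 j).
pose comp v w X : vq_sp (Some v : option V) (Some w) := GqSpace (memP v w X).
have compE v w j : jac A j -> gq_val (comp v w (piJ2 A j)) = piJ2 A (e w * j * e v).
  move=> Jj; rewrite /comp /gq_val /=; case: ifP => [_|/asboolP[]]; last by exists j.
  apply/piJ2P; rewrite -mulrBl -mulrBr -jpow2; apply: jpowM_r; apply: jpowM_l; rewrite jpow2.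
  exact: repr_jac2.
pose t (X : quoJ2 A) : A := \sum_v \sum_w tau v w (comp v w X).
have tJ X : jac A (t X).
  by apply: (linear_set_sum JL) => v _; apply: (linear_set_sum JL) => w _.
have [f [fA fJ fe fx]] := cpa_universal (gq_rep_orth A) tauL tauE tauJ.
have fm : palg_morph f.
  apply: palg_morphI => // b; exists (\sum_v chi v b *: cpa_idem (Some v)).
  rewrite (alg_hom_sum fA) JE => v /=; rewrite (lin_funB (chiL v)).
  rewrite (eq_bigr (fun v => chi v b *: e v)) => [|w _]; last first.
    by rewrite (lin_funZ fA.1) fe.
  by rewrite -sE chi_s subrr.
have fC : is_counit f.
  apply: is_counitI => // [v|v w x]; last by rewrite fx.
  by rewrite fe subrr; apply: JL.1.
have piS (F : V -> V -> A) :
    piJ2 A (\sum_v \sum_w F v w) = \sum_v \sum_w piJ2 A (F v w).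
  rewrite (lin_fun_sum (@piJ2_linear k A)); apply: eq_bigr => v _.
  exact: (lin_fun_sum (@piJ2_linear k A)).
have e_s v X : e v * s X = chi v (repr X) *: e v.
  rewrite mulr_sumr (bigD1 v) //= big1 ?addr0 => [|w /negbTE wv].
    by rewrite -talg_scalerAr ee.
  by rewrite -talg_scalerAr eM eq_sym wv scaler0.
have s_e v X : s X * e v = chi v (repr X) *: e v.
  rewrite mulr_suml (bigD1 v) //= big1 ?addr0 => [|w /negbTE wv].
    by rewrite -talg_scalerAl ee.
  by rewrite -talg_scalerAl eM wv scaler0.
clearbody s.
exists s, t, f; split=> //.
- split=> // [j Jj|c i j Ji Jj|X Y j Jj].
  + rewrite /t [in RHS](orth_idems_decomp j eO) !piS; apply: eq_bigr => v _; apply: eq_bigr => w _.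
    by rewrite tauK compE.
  + rewrite /t scaler_sumr -big_split /=; apply: eq_bigr => v _.
    rewrite scaler_sumr -big_split /=; apply: eq_bigr => w _.
    rewrite -tauL; congr tau; apply: gq_val_inj.
    rewrite (gq_val_linear c) !compE //; last exact: JL.2.
    by rewrite mulrDr mulrDl -talg_scalerAr -talg_scalerAl (@piJ2_linear k A).
  + rewrite /t mulr_sumr mulr_suml; apply: eq_bigr => v _.
    rewrite mulr_sumr mulr_suml; apply: eq_bigr => w _.
    have -> : comp v w (piJ2 A (s X * j * s Y)) =
        (chi w (repr X) * chi v (repr Y)) *: comp v w (piJ2 A j).
      apply: gq_val_inj; rewrite (lin_funZ (@gq_val_linear k A _ _)).
      rewrite !compE //; last by apply: jacM_r; apply: jacM_l.
      have -> : e w * (s X * j * s Y) * e v = (e w * s X) * j * (s Y * e v).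
        by rewrite !mulrA.
      rewrite e_s s_e -!talg_scalerAl -talg_scalerAr scalerA.
      by rewrite (lin_funZ (@piJ2_linear k A)).
    rewrite (lin_funZ (tauL v w)) tauE.
    have -> y : s X * (e w * y * e v) * s Y = (s X * e w) * y * (e v * s Y).
      by rewrite !mulrA.
    by rewrite e_s s_e -!talg_scalerAl -talg_scalerAr scalerA.
- split=> // [|v|v w x]; first exact: (alg_hom_continuous fA).
    rewrite fe; split; first by apply/gq_rep_mem; [exact: ee | rewrite subrr; apply: JL.1].
    exists (piJ A (e v)) => //; rewrite sE (bigD1 v) //= big1 ?addr0.
      by rewrite chi_rep eqxx scale1r.
    by move=> w wv; rewrite chi_rep (negbTE wv) scale0r.
  have [j Jj xE] := gq_valP x.
  have Jj' : jac A (e w * j * e v) by apply: jacM_r; apply: jacM_l.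
  have compx v' w' : tau v' w' (comp v' w' (gq_val x)) =
      tau v' w' (comp v' w' (gq_val x)) *+ ((v' == v) && (w' == w)).
    have [//|ne] := boolP ((v' == v) && (w' == w)).
    rewrite mulr0n; have -> : comp v' w' (gq_val x) = 0.
      apply: gq_val_inj; rewrite xE compE // (lin_fun0 (@gq_val_linear k A _ _)).
      have -> : e w' * (e w * j * e v) * e v' = (e w' * e w) * j * (e v * e v').
        by rewrite !mulrA.
      rewrite !eM; move: ne; rewrite negb_and (eq_sym v').
      case/orP=> /negbTE ->; rewrite mulr0n ?mulr0 ?mul0r; exact: (lin_fun0 (@piJ2_linear k A)).
    exact: (lin_fun0 (tauL v' w')).
  rewrite fx /t (bigD1 v) //= [X in _ + X]big1 ?addr0 => [|v' /negbTE v'v]; last first.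
    by apply: big1 => w' _; rewrite compx v'v mulr0n.
  rewrite (bigD1 w) //= big1 ?addr0 => [|w' /negbTE w'w]; last first.
    by rewrite compx w'w andbF mulr0n.
  congr tau; apply: gq_val_inj; rewrite xE compE //.
  by rewrite orth_idems_corner.
Qed.

Lemma counit_repP f : counit_rep f <-> is_counit f.
Proof.
split=> [[fm [s [t [f0 [sS tS f0C ff0]]]]]|fC].
  have f0m : palg_morph f0.
    have [f0A f0c _ _] := f0C; exact: sim1_morph f0A (sim1_sym ff0) fm.
  exact: sim1_is_counit fm ff0 (counit_of_is_counit sS tS f0C f0m).
have [fm _ _] := fC; have [s [t [f0 [sS tS f0C f0i]]]] := exists_counit.
by split=> //; exists s, t, f0; split=> //; apply: is_counit_sim1.
Qed.

Section Kernel.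
Variable f : C -> A.
Hypothesis fC : is_counit f.
Let fm : palg_morph f. Proof. by case: fC. Qed.
Let fA : alg_hom f. Proof. exact: pm_alg fm. Qed.
Let fJ a : jac C a -> jac A (f a). Proof. exact: palg_morphJ. Qed.

(** The elements of [J(A)] are sums of their corners, which are images of arrows
    modulo [J^2(A)]. *)
Lemma counit_onto n b : jpow A n b -> exists2 a, jpow C n a & f a = b.
Proof.
have [_ f0 f1] := fC.
apply: (jpow_onto fA fJ) => {n} [c|c Jc].
  have [a Ja] := pm_surj fm c; exists a; exact: (linear_setBC (jac_linear _)).
pose e v : A := gq_rep (Some v : option V).
have mem v w : gq_mem (e v) (e w) (piJ2 A (e w * c * e v)) by apply/asboolP; exists c.
pose x v w : vq_sp (Some v : option V) (Some w) := GqSpace (mem v w).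
exists (\sum_v \sum_w cpa_arrow (x v w)).
  apply: (linear_set_sum (jac_linear C)) => v _; apply: (linear_set_sum (jac_linear C)) => w _.
  by rewrite jac_cpa; apply: cge_arrow.
rewrite {1}(orth_idems_decomp c (gq_rep_orth A)).
rewrite (alg_hom_sum fA) -sumrB; apply: (linear_set_sum (@jac2_linear k A)) => v _.
rewrite (alg_hom_sum fA) -sumrB; apply: (linear_set_sum (@jac2_linear k A)) => w _.
by apply/piJ2P; rewrite f1.
Qed.

(** The images of the vertices are linearly independent modulo [J(A)], and the spaces of
    arrows are embedded in the corners of [J(A) / J^2(A)]. *)
Lemma counit_ker_jac2 a : f a = 0 -> jac2 C a.
Proof.
move=> fa0; have [_ f0 f1] := fC; have JL := jac_linear A; have J2L := @jac2_linear k A.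
have [chi [chiL chiM JE chi_rep]] := gq_points A.
have [y ay] := cpa_deg01 a; set b := cpa_sig (a 0%N) + cpa_arr y in ay.
have fb : jac2 A (f b).
  have : jac2 C (a - b) by rewrite jac2_cpa.
  move/(palg_morphJ2 fm); rewrite (alg_homB fA) fa0 sub0r => /(linear_setN J2L).
  by rewrite opprK.
have Jy : jac A (f (cpa_arr y)) by apply: fJ; rewrite jac_cpa; apply: cge_arr.
have a0 : a 0%N = 0.
  apply/ffunP => v; rewrite [RHS]ffunE.
  have : jac A (f (cpa_sig (a 0%N))).
    rewrite -[cpa_sig _](addrK (cpa_arr y)) -/b (alg_homB fA).
    by apply: (linear_setB JL) => //; apply: jac2_jac.
  rewrite cpa_sigE (alg_hom_sum fA).
  have Je : jac A (\sum_v (a 0%N : {ffun _ -> k}) v *: f (cpa_idem (Some v)) -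
      \sum_v (a 0%N : {ffun _ -> k}) v *: gq_rep (Some v : option V)).
    rewrite -sumrB; apply: (linear_set_sum JL) => w _; rewrite -scalerBr.
    exact: (linear_setZ JL).
  under eq_bigr do rewrite (lin_funZ fA.1).
  move=> J1; have := linear_set_congr JL (linear_setBC JL Je) J1.
  rewrite JE => /(_ v); rewrite (lin_fun_sum (chiL v)) (bigD1 v) //= big1 ?addr0.
    by rewrite (lin_funZ (chiL v)) chi_rep eqxx => <-; rewrite [RHS]mulr1.
  by move=> w wv; rewrite (lin_funZ (chiL v)) chi_rep eq_sym (negbTE wv); apply: mulr0.
have sig0 : cpa_sig (0 : vqSigma (gq A)) = 0 by apply: cpa_ext => -[].
have y0 p : y p = 0.
  case: p => v w; apply: gq_val_inj; rewrite (lin_fun0 (@gq_val_linear k A _ _)).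
  rewrite -(f1 (Some v) (Some w) (y (v, w))) -[RHS](lin_fun0 (@piJ2_linear k A)).
  apply/piJ2P; rewrite subr0.
  have -> : cpa_arrow (y (v, w)) = cpa_idem (Some w) * b * cpa_idem (Some v).
    by rewrite /b a0 sig0 add0r cpa_arrow_component.
  by rewrite !(alg_homM fA) -jpow2; apply: jpowM_r; apply: jpowM_l; rewrite jpow2.
have E : y = 0 by apply: functional_extensionality_dep.
by rewrite jac2_cpa; move: ay; rewrite /b a0 sig0 E cpa_arr0 addr0 subr0.
Qed.

Lemma counit_ker_rel : rel_ideal [set a | f a = 0].
Proof.
split; last exact: counit_ker_jac2.
- split; first split=> /= [|a b fa fb|a b fb].
  + exact: (alg_hom0 fA).
  + by rewrite (alg_homD fA) fa fb addr0.
  + by rewrite (alg_homM fA) fb mulr0.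
  + by move=> a b fb /=; rewrite (alg_homM fA) fb mul0r.
- apply: (closed_preimage (K := [set 0 : A]) (pm_cont fm)) => x clx.
  apply: jpow_sep => n.
  have [|_ [/= -> Jx]] := clx [set y | jpow A n (y - x)].
    by apply/jpow_nbhs; exists n => y Jy /=; rewrite addrC addKr.
  by move: Jx; rewrite sub0r => /(linear_setN (jpow_linear A n)); rewrite opprK.
Qed.

End Kernel.

(** Two representatives of the counit differ by an automorphism similar to the
    identity, by the lifting property. *)
Lemma counit_ker_class f g : is_counit f -> is_counit g ->
  rel_class [set a | g a = 0] = rel_class [set a | f a = 0].
Proof.
move=> fC gC; have [fm _ _] := fC; have [gm _ _] := gC.
have f_onto b : jac A b -> exists2 a, jac C a & f a = b.
  by rewrite -!jpow1; apply: counit_onto.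
have [h [hA hJ h1 hg]] := cpa_lift (f0 := id) (pm_alg fm) (pm_alg (palg_morph_id _))
  (pm_alg gm) f_onto (fun _ => id) (palg_morphJ gm) (is_counit_sim1 fC gC).
have h1' : id1 h by split=> //; apply: sim1_morph hA h1 (palg_morph_id _).
have [h' [hK h'K _]] := id1_inv h1'.
have -> : [set a | f a = 0] = h @` [set a | g a = 0].
  apply/seteqP; split=> [a /= fa|_ [a /= ga <-]]; last by rewrite hg.
  by exists (h' a); rewrite /= ?h'K // -hg h'K.
by rewrite rel_class_image.
Qed.

Lemma gq_classE f : is_counit f -> gq_class A = rel_class [set a | f a = 0].
Proof.
move=> fC; apply/seteqP; split=> [I [g /counit_repP gC]|I If].
  by rewrite (counit_ker_class fC gC).
by exists f => //; apply/counit_repP.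
Qed.

Lemma is_rel_gq_class : is_rel_class (gq_class A).
Proof.
have [s [t [f [_ _ _ fC]]]] := exists_counit.
by exists [set a | f a = 0]; [exact: counit_ker_rel fC | exact: gq_classE].
Qed.

End Counit.

(** * Adjuncts *)

Section Adjunct.
Variables (k : fieldType) (Q : vquiver k) (B : palg k).
Implicit Types (f : cpa Q -> B) (r : vqmap Q (gq B)).

(** [r] corresponds to the class of [f] under the adjunction between the path algebra
    and the Gabriel quiver. *)
Definition adjunct f r : Prop :=
  (forall v, jac B (f (cpa_idem v) - gq_rep (vqm0 r v))) /\
  (forall v w (x : vq_sp v w), piJ2 B (f (cpa_arrow x)) = gq_val (vqm1 r x)).

Lemma adjunct_inj f r r' : adjunct f r -> adjunct f r' -> r = r'.
Proof.
move=> [f0 f1] [f0' f1'].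
have E v : vqm0 r v = vqm0 r' v.
  apply: gq_rep_jac_inj.
  apply: (linear_set_trans (jac_linear B) (y := f (cpa_idem v))) => //.
  exact: (linear_setBC (jac_linear B)).
apply: vqmap_ext => // v w x; apply: gq_val_arrow => //.
by rewrite -f1 -f1'.
Qed.

Lemma sim1_adjunct f g r : sim1 f g -> adjunct g r -> adjunct f r.
Proof.
move=> [fg0 fg1] [g0 g1]; split=> [v|v w x].
  exact: (linear_set_trans (jac_linear B) (fg0 _) (g0 _)).
by rewrite -g1; apply/piJ2P/fg1; rewrite jac_cpa; apply: cge_arrow.
Qed.

Lemma counit_adjunct e d r : is_counit e -> tracks r d -> adjunct (e \o d) r.
Proof.
move=> [em e0 e1] [d0 d1]; have eA := pm_alg em; split=> [v|v w x] /=.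
  apply: (linear_set_trans (jac_linear B) _ (e0 _)).
  by rewrite -(alg_homB eA); apply: palg_morphJ.
by rewrite -e1; apply/piJ2P; rewrite -(alg_homB eA); apply: palg_morphJ2.
Qed.

Lemma adjunct_sim1 f r e d : alg_hom f -> adjunct f r -> is_counit e -> palg_morph d ->
  tracks r d -> sim1 f (e \o d).
Proof.
move=> fA [f0 f1] eC dm dr; have [em _ _] := eC.
have edm : palg_morph (e \o d) by apply: palg_morph_comp.
have [g0 g1] := counit_adjunct eC dr.
apply: (cpa_hom_sim1 fA (pm_alg edm) (palg_morphJ edm)) => [v|v w x].
  by apply: (linear_set_trans (jac_linear B) (f0 _)); apply: (linear_setBC (jac_linear B)).
by apply/piJ2P; rewrite f1 g1.
Qed.

(** Each point of [B] takes the value [1] at exactly one of the orthogonal idempotents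
    coming from the vertices of [Q]; this defines a map from the vertices of [gq B]
    to those of [Q], injective since [f] is onto modulo [J(B)]. *)
Lemma exists_adjunct f : palg_morph f -> exists r, adjunct f r.
Proof.
move=> fm; have fA := pm_alg fm; have JL := jac_linear B.
have [chi [chiL chiM JE chi_rep]] := gq_points B.
have JP x : jac B x <-> forall v, chi v x = 0 by rewrite JE.
have [eM e1] := alg_hom_orth fA (cpa_orth Q).
pose a v := f (cpa_idem (Some v)).
have aa v : a v * a v = a v by rewrite eM eqxx.
have chi01 w v : chi w (a v) != 0 -> chi w (a v) = 1.
  by move=> nz; apply: (mulfI nz); rewrite -chiM aa mulr1.
have chi1 w : chi w 1 = 1.
  have := chiM w (gq_rep (Some w)) 1; rewrite mulr1 chi_rep eqxx mul1r => <-.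
  by [].
have ex w : exists v, chi w (a v) = 1.
  apply: contrapT => nex; have := chi1 w; rewrite -e1 (lin_fun_sum (chiL w)) big1.
    by move/esym/eqP; rewrite oner_eq0.
  by move=> v _; apply/eqP; apply: contraT => /chi01 E; case: nex; exists v.
(* [p] assigns to a point of [B] the vertex of [Q] lying over it. *)
pose p w := sval (cid (ex w)).
have pP w : chi w (a (p w)) = 1 by apply: (svalP (cid (ex w))).
have p_uniq w v : chi w (a v) != 0 -> v = p w.
  move=> nz; apply/eqP; apply: contraT => ne.
  have := chiM w (a v) (a (p w)); rewrite eM (negbTE ne) mulr0n pP mulr1 (lin_fun0 (chiL w)).
  by move=> E; rewrite -E eqxx in nz.
have chi_a w v : chi w (a v) = (v == p w)%:R.
  have [->|ne] := eqVneq; first exact: pP.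
  by apply/eqP; apply: contraT => /p_uniq E; rewrite E eqxx in ne.
have p_inj : injective p.
  move=> w w' pw; apply/eqP; apply: contraT => ne.
  have [c Jc] := pm_surj fm (gq_rep (Some w)).
  have chic u : chi u (gq_rep (Some w)) = (c 0%N : {ffun _ -> k}) (p u).
    have J1 : jac B (gq_rep (Some w) - f (cpa_sig (c 0%N))).
      apply: (linear_set_trans JL (linear_setBC JL Jc)).
      by rewrite -(alg_homB fA); apply: (palg_morphJ fm); apply: cpa_jac_sig.
    move: J1 => /JP/(_ u); rewrite (lin_funB (chiL u)) => /eqP.
    rewrite subr_eq0 => /eqP ->; rewrite cpa_sigE (alg_hom_sum fA) (lin_fun_sum (chiL u)).
    rewrite (bigD1 (p u)) //= big1 ?addr0 => [|v /negbTE vp].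
      by rewrite (lin_funZ fA.1) (lin_funZ (chiL u)) pP; apply: mulr1.
    by rewrite (lin_funZ fA.1) (lin_funZ (chiL u)) chi_a vp; apply: mulr0.
  have := chic w'; rewrite -pw -chic !chi_rep eqxx (eq_sym w') (negbTE ne) => /esym/eqP.
  by rewrite oner_eq0.
pose r0 (v : option (vq_vert Q)) : option (vq_vert (gq B)) :=
  if v is Some u then [pick w | p w == u] else None.
have r0p w : r0 (Some (p w)) = Some w.
  rewrite /r0; case: pickP => [w' /eqP/p_inj ->//|/(_ w)].
  by rewrite eqxx.
have r0E v w : r0 (Some v) = Some w -> v = p w.
  by rewrite /r0; case: pickP => // w' /eqP <- [->].
have f0 v : jac B (f (cpa_idem v) - gq_rep (r0 v)).
  case: v => [v|]; last first.
    rewrite cpa_idem_star (alg_hom0 fA) subrr; exact: JL.1.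
  apply/JP => w; rewrite (lin_funB (chiL w)) chi_a.
  case E: (r0 (Some v)) => [u|].
    by rewrite chi_rep (r0E _ _ E) (inj_eq p_inj) eq_sym subrr.
  rewrite (lin_fun0 (chiL w)) subr0; case: eqP => // vp.
  by move: E; rewrite vp r0p.
have r0_bij w : exists! v, r0 (Some v) = Some w.
  by exists (p w); split=> // v /r0E.
have mem v w (x : vq_sp v w) : gq_mem (gq_rep (r0 v)) (gq_rep (r0 w)) (piJ2 B (f (cpa_arrow x))).
  have Jx : jac B (f (cpa_arrow x)).
    by apply: (palg_morphJ fm); rewrite jac_cpa; apply: cge_arrow.
  apply/asboolP; exists (f (cpa_arrow x)) => //; apply/piJ2P.
  rewrite {1}cpa_arrow_idem !(alg_homM fA).
  exact: jac2_sandwich.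
pose r1 v w (x : vq_sp v w) : @vq_sp k (gq B) (r0 v) (r0 w) := GqSpace (mem v w x).
have r1L v w : linear (@r1 v w).
  move=> c x y; apply: gq_val_inj; rewrite (gq_val_linear c) /gq_val /=.
  by rewrite (@cpa_arrow_linear k Q v w) fA.1 (@piJ2_linear k B).
by exists (@Vqmap k Q (gq B) r0 r1 erefl r0_bij r1L).
Qed.

End Adjunct.

Section Spec.
Variables (k : fieldType) (A B : palg k).

(** Both sides prescribe the classes of the images of the idempotents modulo [J(B)] and
    of the corners of [J(A)] modulo [J^2(B)]. *)
Lemma gq_hom_specP (al : palg_hom A B) (r : vqmap (gq A) (gq B)) f : is_counit f ->
  gq_hom_spec al r <-> adjunct (al \o f) r.
Proof.
move=> fC; have [fm f0 f1] := fC; have alm := ph_morph al; have alA := pm_alg alm.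
have alJ := palg_morphJ alm; have alJ2 := palg_morphJ2 alm.
have JL := jac_linear B.
have idem_al v : al (gq_rep (Some v)) * al (gq_rep (Some v)) = al (gq_rep (Some v)).
  by rewrite -(alg_homM alA); have [_ -> _] := gq_rep_prim (v : vq_vert (gq A)).
have arrowE (v w : vq_vert (gq A)) (x : vq_sp (Some v) (Some w)) j :
    gq_val x = piJ2 A (gq_rep (Some w) * j * gq_rep (Some v)) ->
    piJ2 B (al (f (cpa_arrow x))) =
    piJ2 B (al (gq_rep (Some w)) * al j * al (gq_rep (Some v))).
  move=> xE; apply/piJ2P; rewrite -!(alg_homM alA) -(alg_homB alA); apply: alJ2.
  by apply/piJ2P; rewrite f1.
split=> [[s0 s1]|[a0 a1]].
  split=> [[v|]|v w x] /=; last 2 first.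
  - rewrite cpa_idem_star (alg_hom0 (pm_alg fm)) (alg_hom0 alA) vqm0_star subrr.
    exact: JL.1.
  - { case: v w x => [v|] [w|] x.
        have [j Jj xE] := gq_valP x; rewrite (arrowE _ _ _ _ xE).
        have [[vs vo] [ws wo]] := (gq_repP v, gq_repP w).
        by rewrite (s1 v w _ _ vs (esym vo) ws (esym wo) x j Jj xE).
      all: rewrite gq_val_star ?cpa_arrow_star ?(vqm0_star r); [|by tauto..].
      all: rewrite (alg_hom0 (pm_alg fm)) (alg_hom0 alA).
      all: exact: (lin_fun0 (@piJ2_linear k B)). }
  - apply: (linear_set_trans JL (y := al (gq_rep (Some v)))).
      by rewrite -(alg_homB alA); apply: alJ.
    have [vs vo] := gq_repP v; have := s0 v _ vs (esym vo).
    case: eqP => [-> ->|_ [w -> wE]]; first by rewrite subrr; apply: JL.1.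
    by apply/gq_rep_mem; rewrite ?wE //; apply: inner_orbit_refl.
have a0' v : jac B (al (gq_rep (Some v)) - gq_rep (vqm0 r (Some v))).
  apply: (linear_set_trans JL _ (a0 _)); apply: (linear_setBC JL).
  by rewrite -(alg_homB alA); apply: alJ.
split=> [v e es vE|v w e g es vE gs wE x j Jj xE].
  have eE := gq_repE es vE; rewrite -eE; have := a0' v.
  case: eqP => [->|ne].
    rewrite sub0r => /(linear_setN JL); rewrite opprK => Jr.
    by apply: gq_rep_jac_inj; rewrite [gq_rep None]/(0 : B) subr0.
  case E: (vqm0 r (Some v)) => [w|] Jr.
    exists w => //; rewrite -(gq_repP w).2; apply: inner_orbit_eq.
    by rewrite (gq_repP w).2; apply/gq_rep_mem.
  by case: ne; apply: jac_idem0 => //; rewrite subr0 in Jr.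
rewrite -a1 /=; rewrite -(gq_repE es vE) -(gq_repE gs wE); apply: arrowE.
by rewrite (gq_repE es vE) (gq_repE gs wE).
Qed.

End Spec.

(** * The equivalence *)

Lemma equivalence_criterion (C D : category) (F : functor C D) :
  (forall x y (f g : cat_hom x y), fun_hom F f = fun_hom F g -> f = g) ->
  (forall x y (h : cat_hom (F x) (F y)), exists f, fun_hom F f = h) ->
  (forall d, exists c (h : cat_hom (F c) d), is_iso h) ->
  is_equivalence F.
Proof.
move=> faithful full ess.
pose ob d := sval (cid (ess d)).
pose e d : cat_hom (F (ob d)) d := sval (cid (svalP (cid (ess d)))).
have eP d : is_iso (e d) := svalP (cid (svalP (cid (ess d)))).
pose e' d : cat_hom d (F (ob d)) := sval (cid (eP d)).
have e'e d : cat_comp (e' d) (e d) = cat_id _ by have [] := svalP (cid (eP d)).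
have ee' d : cat_comp (e d) (e' d) = cat_id d by have [] := svalP (cid (eP d)).
pose lift x y (h : cat_hom (F x) (F y)) := sval (cid (full x y h)).
have liftK x y h : fun_hom F (@lift x y h) = h := svalP (cid (full x y h)).
pose hom d d' (u : cat_hom d d') : cat_hom (ob d) (ob d') :=
  lift _ _ (cat_comp (e' d') (cat_comp u (e d))).
have homK d d' u : fun_hom F (@hom d d' u) = cat_comp (e' d') (cat_comp u (e d)).
  exact: liftK.
have hom1 d : hom d d (cat_id d) = cat_id (ob d).
  by apply: faithful; rewrite liftK fun_hom1 cat_1comp e'e.
have homM d d' d'' (v : cat_hom d' d'') (u : cat_hom d d') :
    hom _ _ (cat_comp v u) = cat_comp (hom _ _ v) (hom _ _ u).
  apply: faithful; rewrite fun_homM !liftK -!cat_compA; congr (cat_comp _ _).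
  by congr (cat_comp _ _); rewrite (cat_compA (e d')) ee' cat_1comp.
exists (@Functor D C ob hom hom1 homM); split.
  exists (fun x => lift _ _ (e (F x))); split=> [x y f|x].
    apply: faithful; rewrite [LHS]fun_homM [RHS]fun_homM !liftK.
    by rewrite (cat_compA (e (F y))) ee' cat_1comp.
  exists (lift _ _ (e' (F x))); split; apply: faithful.
    by rewrite fun_homM !liftK fun_hom1 e'e.
  by rewrite fun_homM !liftK fun_hom1 ee'.
exists e; split=> [d d' u|d]; last exact: eP.
rewrite [X in cat_comp _ X](homK _ _ u).
by rewrite (cat_compA (e d')) ee' cat_1comp.
Qed.

Section InverseMap.
Variables (k : fieldType) (Q R : vquiver k) (r : vqmap Q R).
Hypothesis r_vert : forall v, vqm0 r (Some v) <> None.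
Hypothesis r_inj : forall (v w : vq_vert Q) (x : vq_sp (Some v) (Some w)), vqm1 r x = 0 -> x = 0.
Hypothesis r_onto : forall (v w : vq_vert Q) (y : vq_sp (vqm0 r (Some v)) (vqm0 r (Some w))),
  exists x, vqm1 r x = y.

Let inj v w (x x' : vq_sp v w) : cpa_arrow (vqm1 r x) = cpa_arrow (vqm1 r x') -> x = x'.
Proof.
move=> /cpa_arrow_inj_star E; apply/eqP; rewrite -subr_eq0; apply/eqP.
have {}E : vqm1 r (x - x') = 0 by rewrite (lin_funB (@vqm1_linear _ _ _ r _ _)) E subrr.
case: v w x x' E => [v|] [w|] x x'; first exact: r_inj.
all: by move=> _; apply: vq_sp_star; tauto.
Qed.

(** On arrows the inverse is defined by [cpa_arrow], because [r (g w) = w] holds only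
    propositionally and the spaces of arrows depend on the vertices. *)
Lemma vqmap_inverse : exists r' : vqmap R Q,
  vqmap_comp r' r = vqmap_id Q /\ vqmap_comp r r' = vqmap_id R.
Proof.
have [g [rg gr]] := vqmap_section r; pose g0 := omap g.
have rg0 w : vqm0 r (g0 w) = w by case: w => [w|]; [apply: rg | apply: vqm0_star].
have gr0 v : g0 (vqm0 r v) = v.
  case: v => [v|]; last by rewrite vqm0_star.
  case E: (vqm0 r (Some v)) => [w|]; last by case: (r_vert E).
  by rewrite /= (gr _ _ E).
have ex v w (y : vq_sp v w) : exists x : vq_sp (g0 v) (g0 w), cpa_arrow (vqm1 r x) = cpa_arrow y.
  { case: v w y => [v|] [w|] y.
      have [z zy] : exists z : vq_sp (vqm0 r (Some (g v))) (vqm0 r (Some (g w))), cpa_arrow z = cpa_arrow y.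
        by rewrite !rg; exists y.
      by have [x xz] := r_onto z; exists x; rewrite xz.
    all: exists 0; rewrite (vq_sp_star y) ?(lin_fun0 (@vqm1_linear _ _ _ r _ _)); last by tauto.
    all: by rewrite !(lin_fun0 (@cpa_arrow_linear _ _ _ _)). }
pose g1 v w (y : vq_sp v w) := sval (cid (ex v w y)).
have g1P v w y : cpa_arrow (vqm1 r (@g1 v w y)) = cpa_arrow y := svalP (cid (ex v w y)).
have g1L v w : linear (@g1 v w).
  move=> a y z; apply: inj; rewrite vqm1_linear g1P !(cpa_arrow_linear a) !g1P.
  by [].
have g0_bij v : exists! w, g0 (Some w) = Some v.
  case E: (vqm0 r (Some v)) => [w|]; last by case: (r_vert E).
  exists w; split=> [|w' gw']; first by rewrite -E gr0.
  by apply: Some_inj; rewrite -E -gw' rg0.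
exists (@Vqmap k R Q g0 g1 erefl g0_bij g1L); split; apply: vqmap_ext => //=.
have transport v w u u' (x : vq_sp v w) (z : vq_sp u u') : u = v -> u' = w ->
    cpa_arrow (vqm1 r z) = cpa_arrow (vqm1 r x) -> cpa_arrow z = cpa_arrow x.
  by move=> uv uw; move: z; rewrite uv uw => z /inj ->.
by move=> v w x; apply: transport => //; rewrite g1P.
Qed.

End InverseMap.

Section Functor.
Variable k : fieldType.

Lemma counit_ex (A : palg k) : exists f : cpa (gq A) -> A, is_counit f.
Proof. by have [s [t [f [_ _ _ fC]]]] := exists_counit A; exists f. Qed.
Definition counit (A : palg k) : cpa (gq A) -> A := sval (cid (counit_ex A)).
Lemma counitP (A : palg k) : is_counit (@counit A).
Proof. exact: svalP (cid (counit_ex A)). Qed.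
Lemma counit_morph (A : palg k) : palg_morph (@counit A).
Proof. by have [] := counitP A. Qed.
Lemma counit_ontoT (A : palg k) a : exists c, @counit A c = a.
Proof. by have [c _ <-] := counit_onto (counitP A) (n := 0) (b := a) Logic.I; exists c. Qed.
Lemma counit_onto_jac (A : palg k) a : jac A a -> exists2 c, jac (cpa (gq A)) c & @counit A c = a.
Proof. by rewrite -!jpow1 => Ja; apply: (counit_onto (counitP A) Ja). Qed.

Definition gq_ob (A : palg k) : vqi k := Vqi (is_rel_gq_class A).

Lemma gq_ob_class (A : palg k) : vqi_class (v := gq_ob A) [set c | counit c = 0].
Proof. by rewrite /= (gq_classE (counitP A)); apply: rel_class_refl. Qed.

(** By the lifting property, [p] is the composite of the counit and a morphism similar
    to [k[[r]]], which sends [I] into the kernel of the counit. *)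
Lemma adjunct_vqi_mor (X : vqi k) (B : palg k) (p : cpa (vqi_quiver X) -> B)
    (r : vqmap (vqi_quiver X) (gq B)) I : vqi_class (v := X) I -> palg_morph p ->
  (forall c, I c -> p c = 0) -> adjunct p r -> @vqi_mor k X (gq_ob B) r.
Proof.
move=> cI pm pI ar; have bm := counit_morph B; have bC := counitP B.
have [f fr] := exists_cpa_map r; have fm := cpa_map_morph fr.
have sim : sim1 (@counit B \o f) p.
  exact: sim1_sym (adjunct_sim1 (pm_alg pm) ar bC fm (cpa_map_tracks fr)).
have [h [hA hJ h1 hp]] := cpa_lift (pm_alg bm) (pm_alg fm) (pm_alg pm)
  (@counit_onto_jac B) (palg_morphJ fm) (palg_morphJ pm) sim.
apply: (@tracks_vqi_mor k X (gq_ob B) r h I [set c | counit c = 0]) => //.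
- exact: sim1_morph hA h1 fm.
- exact: sim1_tracks fr h1.
- exact: gq_ob_class.
- by move=> _ [c Ic <-] /=; rewrite hp; apply: pI.
Qed.

Lemma gq_hom_ex (A B : palg k) (al : palg_hom A B) :
  exists r : vqi_hom (gq_ob A) (gq_ob B), gq_hom_spec al (vqih_map r).
Proof.
have am := counit_morph A.
have pm : palg_morph (al \o @counit A) by apply: palg_morph_comp (ph_morph al) am.
have [r ar] := exists_adjunct pm.
have mr : @vqi_mor k (gq_ob A) (gq_ob B) r.
  apply: (adjunct_vqi_mor (gq_ob_class A) pm) ar => c /= ->.
  exact: alg_hom0 (pm_alg (ph_morph al)).
by exists (VqiHom mr); apply/(gq_hom_specP al _ (counitP A)).
Qed.

Lemma gq_hom_spec_sim1 (A B : palg k) (al be : palg_hom A B) r :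
  sim1 al be -> gq_hom_spec be r -> gq_hom_spec al r.
Proof.
move=> ab /(gq_hom_specP be r (counitP A)) ar; apply/(gq_hom_specP al r (counitP A)).
by apply: sim1_adjunct ar; apply: sim1_compr ab; apply: counit_morph.
Qed.

Lemma gq_hom_spec_inj (A B : palg k) (al : palg_hom A B) r r' :
  gq_hom_spec al r -> gq_hom_spec al r' -> r = r'.
Proof.
move=> /(gq_hom_specP al r (counitP A)) ar /(gq_hom_specP al r' (counitP A)).
exact: adjunct_inj.
Qed.

Lemma gq_hom_spec_id (A : palg k) : gq_hom_spec (palg_id A) (vqmap_id (gq A)).
Proof. by apply/(gq_hom_specP _ _ (counitP A)); have [_ f0 f1] := counitP A. Qed.

(** The naturality of the counit in the category PAlg_1. *)
Lemma gq_hom_spec_sim (A B : palg k) (al : palg_hom A B) r f : gq_hom_spec al r ->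
  palg_morph f -> tracks r f -> sim1 (al \o @counit A) (@counit B \o f).
Proof.
move=> /(gq_hom_specP al r (counitP A)) ar fm fr.
apply: adjunct_sim1 ar (counitP B) fm fr.
exact: pm_alg (palg_morph_comp (ph_morph al) (counit_morph A)).
Qed.

Lemma gq_hom_spec_comp (A B C : palg k) (be : palg_hom B C) (al : palg_hom A B) s r :
  gq_hom_spec be s -> gq_hom_spec al r -> gq_hom_spec (palg_comp be al) (vqmap_comp s r).
Proof.
move=> bs ar; apply/(gq_hom_specP _ _ (counitP A)).
have [f fr] := exists_cpa_map r; have [g gs] := exists_cpa_map s.
have [fm gm] := (cpa_map_morph fr, cpa_map_morph gs).
have [ft gt] := (cpa_map_tracks fr, cpa_map_tracks gs).
apply: (sim1_adjunct (g := @counit C \o (g \o f))); last first.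
  exact: counit_adjunct (counitP C) (tracks_comp gm gt ft).
have s1 := sim1_compl (ph_morph be) (gq_hom_spec_sim ar fm ft).
exact: sim1_trans s1 (sim1_compr fm (gq_hom_spec_sim bs gm gt)).
Qed.

Lemma exists_gq_infty : inhabited (gq_infty k).
Proof.
pose hom (A B : palg k) (F : palg1_hom A B) : vqi_hom (gq_ob A) (gq_ob B) :=
  sval (cid (gq_hom_ex (palg1_repr F))).
have homP A B F : gq_hom_spec (palg1_repr F) (vqih_map (@hom A B F)).
  exact: svalP (cid (gq_hom_ex (palg1_repr F))).
have homP' (A B : palg k) (al : palg_hom A B) : gq_hom_spec al (vqih_map (hom A B (palg1_class al))).
  apply: gq_hom_spec_sim1 (homP A B (palg1_class al)).
  by apply/sim1_sym/palg1_classP/palg1_reprK.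
constructor; apply: (@GqInfty k (@is_rel_gq_class k) hom homP').
- move=> A; apply: vqi_hom_eq; apply: gq_hom_spec_inj (homP' _ _ _) _.
  exact: gq_hom_spec_id.
- move=> A B C; elim/palg1_ind=> g; elim/palg1_ind=> f; apply: vqi_hom_eq.
  rewrite palg1_compE; apply: gq_hom_spec_inj (homP' _ _ _) _.
  exact: gq_hom_spec_comp.
Qed.

End Functor.

Section Equivalence.
Variables (k : fieldType).

(** By naturality, the class of [al \o counit] is determined by [r], and the counit is
    onto. *)
Lemma gq_hom_spec_faithful (A B : palg k) (al be : palg_hom A B) r :
  gq_hom_spec al r -> gq_hom_spec be r -> sim1 al be.
Proof.
move=> ar br; have [f fr] := exists_cpa_map r; have fm := cpa_map_morph fr.
have [s0 s1] : sim1 (al \o @counit k A) (be \o @counit k A).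
  apply: sim1_trans (gq_hom_spec_sim ar fm (cpa_map_tracks fr)) _.
  exact: sim1_sym (gq_hom_spec_sim br fm (cpa_map_tracks fr)).
split=> a => [|Ja]; first by have [c <-] := counit_ontoT a; apply: s0.
by have [c Jc <-] := counit_onto_jac Ja; apply: s1.
Qed.

(** A morphism similar to [k[[h]]] that sends the kernel of one counit into that of the
    other induces a map between the quotients, which are [A] and [B]. *)
Lemma gq_hom_spec_full (A B : palg k) (h : vqi_hom (gq_ob A) (gq_ob B)) :
  exists al : palg_hom A B, gq_hom_spec al (vqih_map h).
Proof.
have [am bm] := (counit_morph A, counit_morph B).
have [aA bA] := (pm_alg am, pm_alg bm).
have [d [dm dr dK]] := vqi_mor_tracks (vqih_mor h) (gq_ob_class A) (gq_ob_class B).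
have dA := pm_alg dm.
pose lift a := sval (cid (@counit_ontoT k A a)).
have liftK a : counit (lift a) = a := svalP (cid (counit_ontoT a)).
pose al a := @counit k B (d (lift a)).
have alE c : al (counit c) = counit (d c).
  apply/eqP; rewrite -subr_eq0 -(alg_homB bA) -(alg_homB dA); apply/eqP.
  by apply: dK; exists (lift (counit c) - c); rewrite //= (alg_homB aA) liftK subrr.
have alA : alg_hom al.
  split; last split.
  - by move=> a x y; rewrite -[x]liftK -[y]liftK -aA.1 !alE dA.1 bA.1.
  - by rewrite -(alg_hom1 aA) alE (alg_hom1 dA) (alg_hom1 bA).
  - by move=> x y; rewrite -[x]liftK -[y]liftK -(alg_homM aA) !alE (alg_homM dA) (alg_homM bA).
have alm : palg_morph al.
  apply: palg_morphI => // [a Ja|b].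
    have [c Jc <-] := counit_onto_jac Ja; rewrite alE.
    by apply: (palg_morphJ bm); apply: (palg_morphJ dm).
  have [c cb] := pm_surj (palg_morph_comp bm dm) b.
  by exists (counit c); rewrite alE.
exists (PalgHom alm); apply/(gq_hom_specP _ _ (counitP A)).
have -> : PalgHom alm \o counit (A := A) = @counit k B \o d by apply/funext => c; apply: alE.
exact: counit_adjunct (counitP B) dr.
Qed.

Lemma id_cpa_map (Q : vquiver k) : is_cpa_map (vqmap_id Q) (id : cpa Q -> cpa Q).
Proof. by do !split=> //; move=> x. Qed.

(** The adjunct of a presentation [p : k[[Q]] -> A] by a relation ideal is an
    isomorphism of Vquivers, because [p] induces isomorphisms modulo the radical
    and modulo its square. *)
Lemma adjunct_bijective (Q : vquiver k) (A : palg k) (p : cpa Q -> A) r :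
  palg_morph p -> (forall c, p c = 0 -> jac2 (cpa Q) c) ->
  jac A = p @` jac (cpa Q) -> jac2 A = p @` jac2 (cpa Q) -> adjunct p r ->
  exists r', vqmap_comp r' r = vqmap_id Q /\ vqmap_comp r r' = vqmap_id (gq A).
Proof.
move=> pm pK JE J2E [a0 a1]; have pA := pm_alg pm.
have JL := jac_linear (cpa Q); have J2L := @jac2_linear k (cpa_palg Q).
have J_inv c : jac A (p c) -> jac (cpa Q) c.
  rewrite JE => -[d Jd dc]; apply: (linear_set_congr JL) Jd.
  by apply: (@jac2_jac k (cpa_palg Q)); apply: pK; rewrite (alg_homB pA) dc subrr.
have J2_inv c : jac2 A (p c) -> jac2 (cpa Q) c.
  rewrite J2E => -[d Jd dc]; apply: (linear_set_congr J2L) Jd.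
  by apply: pK; rewrite (alg_homB pA) dc subrr.
apply: vqmap_inverse.
- move=> v rv; have := a0 (Some v); rewrite rv [gq_rep None]/(0 : A) subr0.
  move/J_inv; rewrite jac_cpa => /cge1E/ffunP/(_ v); rewrite !ffunE eqxx => /eqP.
  by rewrite oner_eq0.
- move=> v w x rx; have : jac2 A (p (cpa_arrow x)).
    rewrite -[p _]subr0; apply/piJ2P; rewrite a1 rx.
    by rewrite (lin_fun0 (@gq_val_linear k A _ _)) (lin_fun0 (@piJ2_linear k A)).
  move/J2_inv; rewrite jac2_cpa => x2; apply: cpa_arrow_inj_star.
  rewrite (lin_fun0 (@cpa_arrow_linear k Q _ _)); apply: cpa_ext => -[|[|n]] //.
  exact: x2.
move=> v w y; have [j Jj yE] := gq_valP y.
move: (Jj); rewrite JE => -[c Jc cj].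
have [z cz] := cpa_deg01 c.
have c0 : c 0%N = 0 by move: Jc; rewrite jac_cpa => /cge1E.
have sig0 : cpa_sig (0 : vqSigma Q) = 0 by apply: cpa_ext => -[].
rewrite c0 sig0 add0r -jac2_cpa in cz.
exists (z (v, w)); apply: gq_val_inj; rewrite -a1 yE; apply/piJ2P.
rewrite -(cpa_arrow_component z v w) !(alg_homM pA).
apply: (linear_set_trans (@jac2_linear k A)
  (y := p (cpa_idem (Some w)) * j * p (cpa_idem (Some v)))).
  rewrite -mulrBl -mulrBr -jpow2; apply: jpowM_r; apply: jpowM_l; rewrite jpow2.
  rewrite -cj -(alg_homB pA); apply: (palg_morphJ2 pm).
  exact: (linear_setBC J2L).
exact: jac2_sandwich.
Qed.

(** The algebra is [k[[Q]] / I]. Both the adjunct of the projection and its inverse are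
    morphisms, since the projection and the counit lift through each other. *)
Lemma gq_ob_ess_surj (X : vqi k) : exists (A : palg k) (f : cat_hom (gq_ob A : vquiv_infty k) X),
  is_iso f.
Proof.
have [I rI XI] := vqi_class_ex X; have [_ _ I2] := rI.
have cI : vqi_class (v := X) I by rewrite XI; apply: rel_class_refl.
have [A [p [pm p_onto pK JE J2E]]] := exists_cpa_quotient rI; exists A.
have pA := pm_alg pm; have am := counit_morph A; have aC := counitP A.
have [r ar] := exists_adjunct pm.
have [|r' [r'r rr']] := adjunct_bijective pm _ JE J2E ar.
  by move=> c /pK/I2.
have mr : @vqi_mor k X (gq_ob A) r.
  by apply: (adjunct_vqi_mor cI pm) ar => c /pK.
have [f fr] := exists_cpa_map r; have [f' fr'] := exists_cpa_map r'.
have [fm fm'] := (cpa_map_morph fr, cpa_map_morph fr').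
have [ft ft'] := (cpa_map_tracks fr, cpa_map_tracks fr').
have ff' : sim1 (f \o f') id.
  apply: (tracks_sim1 (id_cpa_map _)); first exact: (pm_alg (palg_morph_comp fm fm')).
  by rewrite -rr'; apply: tracks_comp.
have pf' : sim1 (p \o f') (@counit k A).
  apply: sim1_trans (sim1_compr fm' (adjunct_sim1 pA ar aC fm ft)) _.
  exact: (sim1_compl am ff').
have p_jac b : jac A b -> exists2 c, jac (cpa (vqi_quiver X)) c & p c = b.
  by rewrite JE => -[c Jc <-]; exists c.
have [h [hA hJ h1 hp]] := cpa_lift pA (pm_alg fm') (pm_alg am) p_jac
  (palg_morphJ fm') (palg_morphJ am) pf'.
have mr' : @vqi_mor k (gq_ob A) X r'.
  apply: (@tracks_vqi_mor k (gq_ob A) X r' h [set c | counit c = 0] I) => //.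
  - exact: sim1_morph hA h1 fm'.
  - exact: sim1_tracks fr' h1.
  - exact: gq_ob_class.
  - by move=> _ [c /= c0 <-]; apply/pK; rewrite hp.
by exists (VqiHom mr'), (VqiHom mr); split; apply: vqi_hom_eq.
Qed.

Lemma gq_infty_equivalence (G : gq_infty k) : is_equivalence (gq_infty_functor G).
Proof.
case: G => cP ob hom homP hom1 homM.
have E : cP = @is_rel_gq_class k by apply: Prop_irrelevance.
subst cP; apply: equivalence_criterion.
- move=> A B; elim/palg1_ind=> f; elim/palg1_ind=> g /= fg; apply/palg1_classP.
  by apply: gq_hom_spec_faithful (homP _ _ f) _; rewrite fg; apply: homP.
- move=> A B h; have [al alh] := @gq_hom_spec_full A B h.
  exists (palg1_class al); apply: vqi_hom_eq.
  exact: gq_hom_spec_inj (homP _ _ al) alh.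
- exact: gq_ob_ess_surj.
Qed.

End Equivalence.

Theorem theorem7p4 (k : fieldType) (hk : perfect_field k) :
  inhabited (gq_infty k) /\
  forall G : gq_infty k, is_equivalence (gq_infty_functor G).
Proof.
split; [exact: exists_gq_infty | exact: gq_infty_equivalence].
Qed.
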